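(* Let $0<\varepsilon\le\varepsilon_0$ and let $h\in W^{1,p}(D_\varepsilon;\omega^\varepsilon)$ for some $1\le p\le\infty$. Then there exists $C>0$ independent of $\varepsilon$ and $h$ such that $$\Bigl|\int_\Omega h\,\omega^\varepsilon\,dx-\int_D h\,dx\Bigr|\le C\,\varepsilon^{2-\frac1p}\,\|h\|_{W^{1,p}(\Gamma_\varepsilon;\omega^\varepsilon)}.$$
   Context: $D\subset\mathbb{R}^n$ is a bounded domain with boundary of class $C^{1,1}$, and $\Omega\subset\mathbb{R}^n$ is a domain with $\overline D\subset\Omega$. $d_D(x)=\mathrm{dist}(x,D)-\mathrm{dist}(x,\mathbb{R}^n\setminus D)$; $D_t=\{x: d_D(x)<t\}$; $\Gamma_\varepsilon=D_\varepsilon\setminus\overline{D_{-\varepsilon}}$. The number $\varepsilon_0>0$ is fixed and sufficiently small depending only on $D,\Omega$ (so that $d_D$ is $C^{1,1}$ and nearest-point projection onto $\partial D$ is single-valued on $\Gamma_{2\varepsilon_0}\subset\Omega$). $S:\mathbb{R}\to\mathbb{R}$ is a fixed function satisfying: (S1) $S$ is Lipschitz, $S(t)=t/|t|$ for $|t|\ge1$, $S'(t)>0$ for $|t|<1$, and $S(-t)=-S(t)$; (S2) there are $\zeta_1,\zeta_2,\alpha>0$ with $\zeta_1t^\alpha\le(1+S(t-1))/2\le\zeta_2t^\alpha$ for all $t\in(0,2)$. Put $\omega^\varepsilon(x)=\frac12\bigl(1+S(-d_D(x)/\varepsilon)\bigr)$, so $D_\varepsilon=\{\omega^\varepsilon>0\}$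 (functions need only be defined on $D_\varepsilon$ in integrals against $\omega^\varepsilon$). For an open set $U\subset D_\varepsilon$, $L^p(U;\omega^\varepsilon)$ has norm $\|v\|^p_{L^p(U;\omega^\varepsilon)}=\int_U|v|^p\omega^\varepsilon dx$ ($p<\infty$), and $L^\infty(U;\omega^\varepsilon)=L^\infty(U)$. $W^{1,p}(U;\omega^\varepsilon)$ is the space of $v$ with $v$ and its weak first partial derivatives in $L^p(U;\omega^\varepsilon)$, normed by $\|v\|^p_{W^{1,p}(U;\omega^\varepsilon)}=\int_U(|v|^p+|\nabla v|^p)\omega^\varepsilon dx$ (usual modification for $p=\infty$). Convention $1/\infty=0$. *)

(* Defs.v *)
From HB Require Import structures.
From mathcomp Require Import all_boot all_order all_algebra.
From mathcomp Require Import all_classical all_reals all_analysis ess_sup_inf.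

Set Implicit Arguments.
Unset Strict Implicit.
Unset Printing Implicit Defensive.

Import Order.TTheory GRing.Theory Num.Theory.
Import numFieldNormedType.Exports.

Local Open Scope classical_set_scope.
Local Open Scope ring_scope.

(* R^n is 'rV[R]_n.  It carries the sigma-algebra generated by the n           *)
(* coordinates (the Borel sigma-algebra); its library topology is the usual    *)
(* one, but its library norm `|_| is the max norm, hence enorm below.          *)

Definition rV_display : measure_display.
Proof. exact: default_measure_display. Qed.

Section measurable_rV.
Context {R : realType} (n : nat).

Definition rV_coord (i : 'I_n) (x : 'rV[R]_n) : measurableTypeR R := x 0 i.

Let rV_set0 : g_sigma_preimage rV_coord set0.
Proof. exact: sigma_algebra0. Qed.

Let rV_setC A : g_sigma_preimage rV_coord A -> g_sigma_preimage rV_coord (~` A).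
Proof. exact: sigma_algebraC. Qed.

Let rV_bigcup (F : _^nat) : (forall i, g_sigma_preimage rV_coord (F i)) ->
  g_sigma_preimage rV_coord (\bigcup_i (F i)).
Proof. exact: sigma_algebra_bigcup. Qed.

HB.instance Definition _ := @isMeasurable.Build rV_display
  'rV[R]_n (g_sigma_preimage rV_coord) rV_set0 rV_setC rV_bigcup.

End measurable_rV.

Section measurable_rV_theory.
Context {R : realType}.

Lemma measurable_rV_coord n (i : 'I_n) :
  measurable_fun [set: 'rV[R]_n] (@rV_coord R n i).
Proof.
move=> _ Y mY; rewrite setTI; apply: sub_sigma_algebra => /=.
rewrite -bigcup_seq/=; exists i => /=; first by rewrite mem_index_enum.
by exists Y => //; rewrite setTI.
Qed.

Lemma measurable_fun_rVP d (T : measurableType d) n (f : T -> 'rV[R]_n) :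
  measurable_fun [set: T] f <->
  forall i, measurable_fun [set: T] (@rV_coord R n i \o f).
Proof.
split=> [mf i|mf].
  by apply: measurableT_comp => //; exact: measurable_rV_coord.
suff prefS : g_sigma_preimage (fun i => @rV_coord R n i \o f) `<=` measurable.
  move=> _ A mA; apply: prefS; rewrite g_sigma_preimage_comp.
  by exists A.
apply: smallest_sub; first exact: sigma_algebra_measurable.
case: n => [|n'] in f mf *; first by rewrite big_ord0.
rewrite -bigcup_mkord_ord; apply: bigcup_sub => i Ii.
by move=> A [B mB <-]; exact: mf.
Qed.

Definition rV_cons n (p : R * 'rV[R]_n) : 'rV[R]_n.+1 := row_mx p.1%:M p.2.

Definition rV_uncons n (x : 'rV[R]_n.+1) : R * 'rV[R]_n :=
  (x 0 0, rsubmx (x : 'rV[R]_(1 + n))).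

Lemma rV_consK n : cancel (@rV_cons n) (@rV_uncons n).
Proof.
by move=> [t v]; rewrite /rV_uncons /rV_cons row_mxKr mxE; case: splitP => //= j _;
  rewrite ord1 mxE.
Qed.

Lemma rV_unconsK n : cancel (@rV_uncons n) (@rV_cons n).
Proof.
move=> x; apply/rowP => i; rewrite /rV_cons /rV_uncons mxE.
case: splitP => j ij; rewrite ?mxE ?ord1 /=.
  by congr (x 0 _); apply/val_inj; rewrite /= ij ord1.
by congr (x 0 _); apply/val_inj.
Qed.

Lemma measurable_rV_cons n : measurable_fun [set: R * 'rV[R]_n] (@rV_cons n).
Proof.
apply/measurable_fun_rVP => i.
have [->|i0] := eqVneq i ord0.
  rewrite (_ : _ \o _ = (fst : R * 'rV[R]_n -> R)); last first.
    apply/funext => -[t v]; rewrite /= /rV_coord /rV_cons mxE.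
    by case: splitP => //= j _; rewrite ord1 mxE.
  exact: measurable_fst.
have i1n : (i.-1 < n)%N by rewrite prednK ?lt0n// -ltnS.
rewrite (_ : _ \o _ = @rV_coord R n (Ordinal i1n) \o snd); last first.
  apply/funext => -[t v]; rewrite /= /rV_coord /rV_cons mxE.
  case: splitP => j ij.
    by exfalso; move: i0; rewrite -val_eqE /= ij ord1.
  by congr (v 0 _); apply/val_inj; rewrite /= ij.
by apply: measurableT_comp; [exact: measurable_rV_coord|exact: measurable_snd].
Qed.

Lemma measurable_rV_uncons n :
  measurable_fun [set: 'rV[R]_n.+1] (@rV_uncons n).
Proof.
apply/measurable_fun_pair; first exact: measurable_rV_coord.
apply/measurable_fun_rVP => i.
rewrite (_ : _ \o _ = @rV_coord R n.+1 (lift ord0 i)); last first.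
  apply/funext => x; rewrite /= /rV_coord mxE.
  by congr (x 0 _); apply/val_inj.
exact: measurable_rV_coord.
Qed.

End measurable_rV_theory.

Section lebesgue_rV.
Context {R : realType}.
Local Open Scope ereal_scope.

Section step.
Variables (n : nat) (m : {sigma_finite_measure set 'rV[R]_n -> \bar R}).

Definition lebesgue_rVS : set 'rV[R]_n.+1 -> \bar R :=
  pushforward (@lebesgue_measure R \x m) (@rV_cons R n).

Let mcons := @measurable_rV_cons R n.

Let lebesgue_rVS0 : lebesgue_rVS set0 = 0. Proof. exact: measure0. Qed.

Let lebesgue_rVS_ge0 A : 0 <= lebesgue_rVS A. Proof. exact: measure_ge0. Qed.

Let lebesgue_rVS_sigma_additive : semi_sigma_additive lebesgue_rVS.
Proof. exact: measure_semi_sigma_additive. Qed.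

HB.instance Definition _ := isMeasure.Build _ _ _ lebesgue_rVS
  lebesgue_rVS0 lebesgue_rVS_ge0 lebesgue_rVS_sigma_additive.

Let lebesgue_rVS_sigma_finite : sigma_finite setT lebesgue_rVS.
Proof.
have /sigma_finiteP[F [TF ndF Foo]] := sigma_finiteT (@lebesgue_measure R).
have /sigma_finiteP[G [TG ndG Goo]] := sigma_finiteT m.
exists (fun i => @rV_uncons R n @^-1` (F i `*` G i)).
  rewrite -preimage_bigcup; apply/seteqP; split=> // x _ /=.
  have [[i _ Fi] [j _ Gj]] : (\bigcup_i F i) (rV_uncons x).1 /\
    (\bigcup_i G i) (rV_uncons x).2 by rewrite -TF -TG.
  exists (maxn i j) => //; split.
    by move: Fi; exact/subsetPset/ndF/leq_maxl.
  by move: Gj; exact/subsetPset/ndG/leq_maxr.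
move=> i; have [mF Fioo] := Foo i; have [mG Gioo] := Goo i; split.
  rewrite -[X in measurable X]setTI.
  by apply: measurable_rV_uncons => //; exact: measurableX.
rewrite /lebesgue_rVS /pushforward -comp_preimage.
rewrite (_ : _ \o _ = idfun); last by rewrite funeqE => x; exact: rV_consK.
rewrite preimage_id product_measure1E// lte_mul_pinfty//.
by rewrite ge0_fin_numE.
Qed.

HB.instance Definition _ := Measure_isSigmaFinite.Build _ _ _ lebesgue_rVS
  lebesgue_rVS_sigma_finite.

End step.

(* n-dimensional Lebesgue measure, as an iterated product *)
Fixpoint lebesgue_rV (n : nat) : {sigma_finite_measure set 'rV[R]_n -> \bar R} :=
  match n with
  | 0%N => \d_(0%R : 'rV[R]_0)
  | k.+1 => lebesgue_rVS (lebesgue_rV k)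
  end.

Lemma lebesgue_rV_box n (A : 'I_n -> set R) : (forall i, measurable (A i)) ->
  lebesgue_rV n [set x : 'rV[R]_n | forall i, A i (x 0%R i)] =
  \prod_(i < n) @lebesgue_measure R (A i).
Proof.
elim: n A => [|n IHn] A mA.
  rewrite big_ord0 /= diracE mem_set// => -[]//.
rewrite big_ord_recl /= /lebesgue_rVS /pushforward.
rewrite (_ : _ @^-1` _ = A ord0 `*`
    [set v : 'rV[R]_n | forall i : 'I_n, A (lift ord0 i) (v 0%R i)]).
  have mB : measurable [set v : 'rV[R]_n | forall i, A (lift ord0 i) (v 0%R i)].
    rewrite (_ : [set v | _] = \bigcap_i (@rV_coord R n i @^-1` A (lift ord0 i))).
      apply: fin_bigcap_measurable => // i _.
      rewrite -[X in measurable X]setTI.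
      by apply: measurable_rV_coord => //; exact: mA.
    by apply/seteqP; split=> v /= Av i; [move=> _; exact: Av|exact: Av].
  rewrite product_measure1E//; last exact: mA.
  by rewrite (IHn (fun i : 'I_n => A (lift ord0 i))).
apply/seteqP; split=> -[t v] /=.
  move=> Atv; split.
    have := Atv ord0; rewrite mxE; case: splitP => //= j _.
    by rewrite ord1 mxE.
  move=> i; have := Atv (lift ord0 i); rewrite mxE; case: splitP => j /= ij.
    by exfalso; move: ij; rewrite ord1.
  by move: ij => /eqP; rewrite eqSS => /eqP ij; rewrite (_ : i = j)//; apply/val_inj.
move=> [At Av] i; rewrite mxE; case: splitP => j ij.
  by rewrite ord1 mxE (_ : i = ord0)//; apply/val_inj; rewrite /= ij ord1.
by rewrite (_ : i = lift ord0 j)//; apply/val_inj; rewrite /= ij.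
Qed.

End lebesgue_rV.

Section euclidean.
Context {R : realType} (n : nat).
Local Notation Rn := 'rV[R]_n.
Implicit Types (D U A : set Rn) (x : Rn) (f : Rn -> R).

Definition enorm x : R := Num.sqrt (\sum_i x 0 i ^+ 2).

Definition dist x A : R := inf [set enorm (x - y) | y in A].

Definition partial (i : 'I_n) f x : R := 'D_(delta_mx 0 i) f x.

Definition grad f x : Rn := \row_i partial i f x.

Definition domain U := [/\ open U, connected U & U !=set0].

Definition boundary D : set Rn := closure D `\` interior D.

(* For open U: continuously differentiable with Lipschitz gradient on U *)
Definition C11 U f :=
  (forall x, U x -> differentiable f x) /\ [lipschitz grad f x | x in U].

Definition sdist D x : R := dist x D - dist x (~` D).

Definition sublevel D (t : R) : set Rn := [set x | sdist D x < t].

Definition tube D (e : R) : set Rn := sublevel D e `\` closure (sublevel D (- e)).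

End euclidean.

(* Near each boundary point D is, after an orthogonal change Q of coordinates, *)
(* the region above the graph of a C^{1,1} function of all coordinates but the *)
(* j-th.                                                                       *)
Definition C11_boundary {R : realType} (n : nat) (D : set 'rV[R]_n) :=
  forall x0, boundary D x0 ->
  exists (Q : 'M[R]_n) (j : 'I_n) (gamma : 'rV[R]_n.-1 -> R) (r : R),
  [/\ Q *m Q^T = 1%:M, C11 setT gamma, 0 < r &
      forall x, enorm (x - x0) < r ->
        (D x <-> gamma (col' j (x *m Q)) < (x *m Q) 0 j)].

(* What the smallness of eps0, depending only on D and Omega, is required to   *)
(* provide; the third clause says that the nearest-point projection onto the   *)
(* boundary of D is single-valued.                                             *)
Definition admissible_width {R : realType} (n : nat) (D Omega : set 'rV[R]_n)
    (eps0 : R) :=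
  [/\ 0 < eps0,
      C11 (tube D (2 * eps0)) (sdist D),
      forall x, tube D (2 * eps0) x ->
        exists! y, boundary D y /\ enorm (x - y) = dist x (boundary D) &
      tube D (2 * eps0) `<=` Omega].

Section phase_field.
Context {R : realType}.

Definition condS1 (S : R -> R) :=
  [/\ lipschitz S,
      forall t, 1 <= `|t| -> S t = t / `|t|,
      forall t, `|t| < 1 -> derivable S t 1 /\ 0 < derive1 S t &
      forall t, S (- t) = - S t].

Definition condS2 (S : R -> R) :=
  exists zeta1 zeta2 alpha : R,
  [/\ 0 < zeta1, 0 < zeta2, 0 < alpha &
      forall t, 0 < t -> t < 2 ->
        zeta1 * t `^ alpha <= (1 + S (t - 1)) / 2 <= zeta2 * t `^ alpha].

Definition omega (S : R -> R) n (D : set 'rV[R]_n) (eps : R) (x : 'rV[R]_n) : R :=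
  (1 + S (- sdist D x / eps)) / 2.

End phase_field.

Section weighted_sobolev.
Context {R : realType} (n : nat).
Local Notation Rn := 'rV[R]_n.
Local Notation mu := (@lebesgue_rV R n).
Implicit Types (U : set Rn) (v w f phi : Rn -> R) (g : Rn -> Rn) (p : \bar R).

Fixpoint Ck (k : nat) f : Prop :=
  match k with
  | 0%N => continuous f
  | k.+1 => (forall x, differentiable f x) /\ forall i, Ck k (partial i f)
  end.

Definition smooth f := forall k, Ck k f.

Definition test_function U phi :=
  [/\ smooth phi, compact (closure [set x | phi x != 0]) &
      closure [set x | phi x != 0] `<=` U].

Definition loc_integrable U v := measurable_fun U v /\
  forall K, compact K -> K `<=` U -> mu.-integrable K (EFin \o v).

Definition is_weak_grad U v g :=
  [/\ loc_integrable U v,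
      forall i, loc_integrable U (fun x => g x 0 i) &
      forall phi i, test_function U phi ->
        (\int[mu]_(x in U) (v x * partial i phi x)%:E =
         - \int[mu]_(x in U) (g x 0 i * phi x)%:E)%E].

(* A representative of the a.e.-unique weak gradient (arbitrary if v has none) *)
Definition wgrad U v : Rn -> Rn := get (is_weak_grad U v).

(* The exponent -oo is never used.  For p = +oo the weight plays no role, and  *)
(* extending by 0 outside U turns the essential supremum into that over U.     *)
Definition Lpw_norm p U w v : \bar R :=
  match p with
  | r%:E => ((\int[mu]_(x in U) (`|v x| `^ r * w x)%:E) `^ r^-1)%E
  | +oo%E => ess_sup mu ((fun x => `|v x|%:E) \_ U)
  | -oo%E => 0%E
  end.

Definition W1pw_norm p U w v : \bar R :=
  match p with
  | r%:E => ((\int[mu]_(x in U)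
      ((`|v x| `^ r + enorm (wgrad U v x) `^ r) * w x)%:E) `^ r^-1)%E
  | _ => maxe (Lpw_norm p U w v) (Lpw_norm p U w (fun x => enorm (wgrad U v x)))
  end.

Definition Lpw p U w v := measurable_fun U v /\ (Lpw_norm p U w v < +oo)%E.

Definition W1pw p U w v :=
  Lpw p U w v /\
  exists2 g, is_weak_grad U v g & forall i, Lpw p U w (fun x => g x 0 i).

End weighted_sobolev.

(* Main.v *)
(* Write d for the signed distance.  As a function of d / eps, omega - 1_D is an
   odd function with support in [-1, 1]; its primitive Phi is therefore even and
   supported in [-1, 1], and monotonicity of S gives |Phi| <= omega.  Since
   |grad d| = 1 off {d = 0}, integration by parts yields

     int h (omega - 1_D) = int h grad d . grad (eps Phi(d / eps))
                         = - eps int Phi(d / eps) (grad h . grad d + h Delta d),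

   which is at most C eps int omega (|h| + |grad h|) over the tube because grad d
   is Lipschitz.  Hoelder's inequality and |tube| <= C eps conclude.

   As Delta d only exists almost everywhere, the weak formula is tested against
   smooth approximations of Phi(d / eps) grad d, namely finite sums of lattice
   values times tensor products of a smooth compactly supported kernel that
   reproduces affine functions: the Lipschitz bound on grad d then bounds the
   divergence of the approximation without any differentiation.  The volume of
   the tube is bounded by Fubini: on a small cube some partial derivative of d
   stays away from 0, so the sections of the tube in that direction are short. *)
Require Import Defs.
From mathcomp Require Import all_boot all_order all_algebra.
From mathcomp Require Import all_classical all_reals all_analysis.
From mathcomp Require Import ess_sup_inf measurable_realfun ring lra.

Set Implicit Arguments.
Unset Strict Implicit.
Unset Printing Implicit Defensive.

Import Order.TTheory GRing.Theory Num.Theory.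
Import numFieldNormedType.Exports.

Local Open Scope classical_set_scope.
Local Open Scope ring_scope.

(** * Euclidean norm and distance *)

(** The profile of omega - 1_D cannot be tested directly: it jumps at d = 0 and its support reaches
    the boundary of the tube, whereas test functions have compact support inside the tube. It is
    replaced by odd Lipschitz profiles [Q] that vanish near |s| = eps, and dominated convergence
    with majorant |h| omega leads back to it. The Lipschitz constants of these profiles are not
    bounded uniformly, so two kinds of constants are kept apart. Those that multiply |P(d)|, [P]
    being the primitive of [Q], depend only on D and on the kernel. Those that depend on the profile
    only ever multiply the mesh size eta, which tends to 0 while the profile is fixed. Since Q(0) =
    0, the identity |grad d| = 1 is needed only off {d = 0}. There d is locally plus or minus a
    distance to a set: being 1-Lipschitz gives one inequality, and a short move towards an almost
    nearest point gives the other. *)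

Section euclidean_norm.
Context {R : realType} (n : nat).
Local Notation Rn := 'rV[R]_n.
Implicit Types (x y z : Rn) (A D : set Rn).

Lemma enorm_ge0 x : 0 <= enorm x.
Proof. exact: sqrtr_ge0. Qed.

Lemma sqr_enorm x : enorm x ^+ 2 = \sum_i x 0 i ^+ 2.
Proof. by rewrite sqr_sqrtr// sumr_ge0// => i _; rewrite sqr_ge0. Qed.

Lemma enorm0 : enorm (0 : Rn) = 0.
Proof.
by rewrite /enorm big1 ?sqrtr0// => i _; rewrite mxE expr0n.
Qed.

Lemma enormN x : enorm (- x) = enorm x.
Proof. by congr Num.sqrt; apply: eq_bigr => i _; rewrite mxE sqrrN. Qed.

Lemma enormBC x y : enorm (x - y) = enorm (y - x).
Proof. by rewrite -enormN opprB. Qed.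

Lemma enormZ (k : R) x : enorm (k *: x) = `|k| * enorm x.
Proof.
rewrite /enorm -sqrtr_sqr -sqrtrM ?sqr_ge0// mulr_sumr.
by congr Num.sqrt; apply: eq_bigr => i _; rewrite mxE exprMn.
Qed.

Lemma enorm_coord x i : `|x 0 i| <= enorm x.
Proof.
rewrite -sqrtr_sqr ler_sqrt; last by rewrite sumr_ge0// => j _; rewrite sqr_ge0.
by rewrite (bigD1 i)//= lerDl sumr_ge0// => j _; rewrite sqr_ge0.
Qed.

Lemma rV_coord_le_norm x i : `|x 0 i| <= `|x|.
Proof.
rewrite [leRHS]/Num.norm /= mx_normrE.
by apply/bigmax_geP; right => /=; exists (ord0, i).
Qed.

Lemma rV_norm_le x (e : R) : 0 <= e -> (forall i, `|x 0 i| <= e) -> `|x| <= e.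
Proof.
move=> e0 xe; rewrite [leLHS]/Num.norm /= mx_normrE.
by apply/bigmax_leP; split=> // -[i j] _ /=; rewrite ord1.
Qed.

Lemma norm_le_enorm x : `|x| <= enorm x.
Proof. by apply: rV_norm_le => [|i]; [exact: enorm_ge0|exact: enorm_coord]. Qed.

Lemma enorm_le_sum x : enorm x <= \sum_i `|x 0 i|.
Proof.
have s0 : 0 <= \sum_i `|x 0 i| by rewrite sumr_ge0.
rewrite -[leRHS]ger0_norm// -sqrtr_sqr ler_sqrt ?sqr_ge0//.
rewrite expr2 mulr_suml ler_sum// => i _.
rewrite -(real_normK (num_real (x 0 i))) expr2 ler_wpM2l//.
by rewrite (bigD1 i)//= lerDl sumr_ge0.
Qed.

Lemma enorm_le_norm x : enorm x <= n%:R * `|x|.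
Proof.
apply: (le_trans (enorm_le_sum x)).
rewrite -[X in X%:R]card_ord -mulr_natl -sumr_const mulr1 mulr_suml ler_sum// => i _.
by rewrite mul1r rV_coord_le_norm.
Qed.

Lemma enorm_CauchySchwarz x y : \sum_i x 0 i * y 0 i <= enorm x * enorm y.
Proof.
have [x0|x0] := eqVneq (enorm x) 0.
  rewrite x0 mul0r big1// => i _.
  have := enorm_coord x i; rewrite x0 normr_le0 => /eqP ->.
  by rewrite mul0r.
have [y0|y0] := eqVneq (enorm y) 0.
  rewrite y0 mulr0 big1// => i _.
  have := enorm_coord y i; rewrite y0 normr_le0 => /eqP ->.
  by rewrite mulr0.
have xp : 0 < enorm x by rewrite lt_def x0 enorm_ge0.
have yp : 0 < enorm y by rewrite lt_def y0 enorm_ge0.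
have : 0 <= \sum_i (enorm y * x 0 i - enorm x * y 0 i) ^+ 2.
  by rewrite sumr_ge0// => i _; rewrite sqr_ge0.
rewrite (eq_bigr (fun i => enorm y ^+ 2 * x 0 i ^+ 2 + enorm x ^+ 2 * y 0 i ^+ 2
   - (2 * enorm x * enorm y) * (x 0 i * y 0 i))); last by move=> i _; ring.
rewrite big_split big_split/= sumrN -!mulr_sumr -!sqr_enorm.
set s := \sum_i _.
have xyp : 0 < enorm x * enorm y by rewrite mulr_gt0.
rewrite (_ : _ + _ - _ = 2 * (enorm x * enorm y) * (enorm x * enorm y - s)); last by ring.
by rewrite pmulr_rge0 ?subr_ge0// mulr_gt0.
Qed.

Lemma enormD x y : enorm (x + y) <= enorm x + enorm y.
Proof.
have xy0 : 0 <= enorm x + enorm y by rewrite addr_ge0// enorm_ge0.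
rewrite -[leRHS]ger0_norm// -sqrtr_sqr ler_sqrt ?sqr_ge0//.
rewrite (eq_bigr (fun i => x 0 i ^+ 2 + y 0 i ^+ 2 + 2 * (x 0 i * y 0 i))); last first.
  by move=> i _; rewrite mxE; ring.
rewrite big_split big_split/= -mulr_sumr -!sqr_enorm.
by have := enorm_CauchySchwarz x y; lra.
Qed.

Lemma enorm_triangle x y z : enorm (x - z) <= enorm (x - y) + enorm (y - z).
Proof. by rewrite (_ : x - z = (x - y) + (y - z)) ?enormD// addrA subrK. Qed.

Lemma dist_set_lbound x A : has_lbound [set enorm (x - y) | y in A].
Proof. by exists 0 => _ [y _ <-]; exact: enorm_ge0. Qed.

Lemma dist_le x y A : A y -> dist x A <= enorm (x - y).
Proof. by move=> Ay; apply: ge_inf; [exact: dist_set_lbound|exists y]. Qed.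

Lemma dist_ge0 x A : 0 <= dist x A.
Proof.
have [->|/set0P[y Ay]] := eqVneq A set0.
  by rewrite /dist image_set0 inf0.
apply: lb_le_inf; first by exists (enorm (x - y)), y.
by move=> _ [z _ <-]; exact: enorm_ge0.
Qed.

Lemma dist_mem x A : A x -> dist x A = 0.
Proof.
move=> Ax; apply/eqP; rewrite eq_le dist_ge0 andbT.
by rewrite (le_trans (dist_le x Ax))// subrr enorm0.
Qed.

Lemma dist_adherent x A (e : R) : A !=set0 -> 0 < e ->
  exists2 y, A y & enorm (x - y) < dist x A + e.
Proof.
move=> [y Ay] e0.
have hi : has_inf [set enorm (x - y) | y in A].
  by split; [exists (enorm (x - y)), y|exact: dist_set_lbound].
by have [_ [z Az <-] zlt] := inf_adherent e0 hi; exists z.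
Qed.

Lemma dist_lip x y A : dist x A <= dist y A + enorm (x - y).
Proof.
(* The infimum of the empty set is 0 by convention, so the inequality survives for empty [A]. *)
have [->|/set0P A0] := eqVneq A set0.
  by rewrite /dist !image_set0 inf0 add0r enorm_ge0.
apply/ler_addgt0Pr => e e0.
have [z Az zlt] := dist_adherent y A0 e0.
apply: (le_trans (dist_le x Az)); apply: (le_trans (enorm_triangle x y z)).
by rewrite addrC addrAC lerD2r ltW.
Qed.

(** Each of the two distances is 1-Lipschitz, hence the factor 2. This crude constant suffices
    everywhere except for |grad d| = 1, where the sharp one is recovered on each side of the
    boundary. *)
Lemma sdist_lip D x y : `|sdist D x - sdist D y| <= 2 * enorm (x - y).
Proof.
rewrite /sdist; have := dist_lip x y D; have := dist_lip y x D.
have := dist_lip x y (~` D); have := dist_lip y x (~` D).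
by rewrite (enormBC y x) ler_norml => *; apply/andP; split; lra.
Qed.

Lemma sdist_lip_norm D x y : `|sdist D x - sdist D y| <= 2 * n%:R * `|x - y|.
Proof.
rewrite (le_trans (sdist_lip D x y))// -mulrA ler_pM2l// enorm_le_norm//.
Qed.

Lemma sdistN D x : D x -> sdist D x = - dist x (~` D).
Proof. by move=> Dx; rewrite /sdist dist_mem// sub0r. Qed.

Lemma sdistP D x : ~ D x -> sdist D x = dist x D.
Proof. by move=> Dx; rewrite /sdist (@dist_mem x (~` D))// subr0. Qed.

Lemma continuous_sdist D : continuous (sdist D).
Proof.
move=> x; apply/(@cvgrPdist_le _ _ _ (nbhs x) (nbhs_filter x)) => /= e e0.
have n1 : 0 < 2 * n%:R + 1 :> R by rewrite ltr_wpDl// mulr_ge0.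
apply/nbhs_ballP; exists ((2 * n%:R + 1)^-1 * e) => /=.
  by rewrite mulr_gt0// invr_gt0.
move=> y; rewrite -ball_normE /= => xy.
rewrite (le_trans (sdist_lip_norm D x y))//.
rewrite (@le_trans _ _ ((2 * n%:R + 1) * `|x - y|))//.
  by rewrite ler_wpM2r// lerDl.
by rewrite -ler_pdivlMl// ltW.
Qed.

End euclidean_norm.

(** * Lebesgue measure on row vectors *)

Section rV_measure.
Context {R : realType}.

Lemma measurable_rV_box n (A : 'I_n -> set R) : (forall i, measurable (A i)) ->
  measurable [set x : 'rV[R]_n | forall i, A i (x 0 i)].
Proof.
move=> mA; rewrite (_ : [set _ | _] = \bigcap_i (@rV_coord R n i @^-1` A i)).
  apply: fin_bigcap_measurable => // i _.
  by rewrite -[X in measurable X]setTI; apply: measurable_rV_coord => //; exact: mA.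
by apply/seteqP; split=> v /= Av i; [move=> _; exact: Av|exact: Av].
Qed.

(** The sigma-algebra is generated by the coordinates, so an open set is written as a countable
    union of boxes with rational centres and half-sides 1/(k+1). *)
Lemma open_measurable_rV n (U : set 'rV[R]_n) : open U -> measurable U.
Proof.
move=> oU.
pose B (p : 'rV[rat]_n * nat) := [set x : 'rV[R]_n |
  forall i, `](ratr (p.1 0 i) - p.2.+1%:R^-1), (ratr (p.1 0 i) + p.2.+1%:R^-1)[%classic
    (x 0 i)].
rewrite (_ : U = \bigcup_(p in [set p | B p `<=` U]) B p); last first.
  apply/seteqP; split=> [x Ux|x [p pU /pU//]].
  have /nbhs_ballP[r /= r0 xrU] : nbhs x U by exact: open_nbhs_nbhs.
  have [k [d [dE kr]]] : exists k (d : R), d = k.+1%:R^-1 /\ d < r / 2.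
    have [k _ /(_ k (leqnn k))] := near_infty_natSinv_lt (PosNum (divr_gt0 r0 (ltr0n R 2))).
    by exists k, k.+1%:R^-1.
  have d0 : 0 < d by rewrite dE invr_gt0.
  have /(_ _)/cid-/all_sig[q qx] : forall i, exists q : rat,
      ratr q \in `](x 0 i - d), (x 0 i + d)[.
    by move=> i; apply: rat_in_itvoo; rewrite ltrD2l gtrN.
  exists (\row_i q i, k) => /=; rewrite /B /= -dE.
    move=> y By; apply: xrU; rewrite -ball_normE /=.
    apply: (@le_lt_trans _ _ (d + d)); last by lra.
    apply: rV_norm_le => [|i]; first by rewrite addr_ge0 ?ltW.
    have := By i; have := qx i; rewrite /= !mxE !in_itv /= => /andP[? ?] /andP[? ?].
    by rewrite ler_norml; apply/andP; split; lra.
  move=> i; have := qx i; rewrite /= mxE !in_itv /= => /andP[? ?].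
  by apply/andP; split; lra.
rewrite bigcup_mkcond; apply: countable_bigcupT_measurable => // p.
case: ifP => _; last exact: measurable0.
by apply: (@measurable_rV_box n (fun i => `](ratr (p.1 0 i) - p.2.+1%:R^-1),
  (ratr (p.1 0 i) + p.2.+1%:R^-1)[%classic)) => i; exact: measurable_itv.
Qed.

Lemma closed_measurable_rV n (F : set 'rV[R]_n) : closed F -> measurable F.
Proof.
by move=> cF; rewrite -(setCK F); apply: measurableC; apply: open_measurable_rV; exact: closed_openC.
Qed.

Lemma continuous_measurable_rV n (f : 'rV[R]_n -> R) (A : set 'rV[R]_n) :
  measurable A -> continuous f -> measurable_fun A f.
Proof.
move=> mA cf; apply: measurable_funTS.
apply: (measurability _ (RGenOpens.measurableE R)).
move=> _ [_ [a [b ->]] <-]; rewrite setTI.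
apply: open_measurable_rV; apply: open_comp; last exact: interval_open.
by move=> x _; exact: cf.
Qed.

Lemma lebesgue_rV_bounded n (A : set 'rV[R]_n) (r : R) : 0 <= r ->
  A `<=` [set x | `|x| <= r] -> measurable A ->
  (lebesgue_rV n A <= ((2 * r) ^+ n)%:E)%E.
Proof.
move=> r0 Ar mA; pose I (i : 'I_n) := `[- r, r]%classic.
apply: (@le_trans _ _ (lebesgue_rV n [set x | forall i, I i (x 0 i)])).
  apply: le_measure; rewrite ?inE//.
    by apply: measurable_rV_box => i; exact: measurable_itv.
  move=> x /Ar /= xr i; rewrite /I /= in_itv /= -ler_norml.
  exact: le_trans (rV_coord_le_norm x i) xr.
rewrite lebesgue_rV_box; last by move=> i; exact: measurable_itv.
rewrite (eq_bigr (fun=> (2 * r)%:E)); last first.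
  move=> i _; rewrite lebesgue_measure_itv /= lte_fin.
  case: ifPn => [_|]; first by rewrite -EFinD; congr _%:E; lra.
  by rewrite -leNgt => h; congr _%:E; lra.
rewrite -(big_morph EFin (@EFinM R) erefl).
by rewrite prodr_const card_ord.
Qed.

Lemma lebesgue_measure_diam (A : set R) (l : R) : 0 <= l -> measurable A ->
  (forall x y, A x -> A y -> `|x - y| <= l) -> (lebesgue_measure A <= (2 * l)%:E)%E.
Proof.
move=> l0 mA Al; have [->|/set0P[x Ax]] := eqVneq A set0.
  by rewrite measure0 lee_fin mulr_ge0.
apply: (@le_trans _ _ (lebesgue_measure `[x - l, x + l]%classic)).
  apply: le_measure; rewrite ?inE//.
  move=> y Ay; have := Al _ _ Ax Ay; rewrite /= in_itv /= ler_norml => /andP[? ?].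
  by apply/andP; split; lra.
rewrite lebesgue_measure_itv /= lte_fin.
by case: ifPn => _; rewrite ?lee_fin -?EFinD ?lee_fin; lra.
Qed.

(** Fubini: every line in direction [j] meets [A] in a set of diameter at most [l], and the other
    coordinates range over intervals of length [r]. The induction peels off the first coordinate: if
    it is [j], one integrates over the others; otherwise it is frozen and the induction hypothesis
    bounds the slice. *)
Lemma lebesgue_rV_section n (j : 'I_n) (A : set 'rV[R]_n) (a : 'I_n -> R) (r l : R) :
  0 <= r -> 0 <= l -> measurable A ->
  A `<=` [set x | forall i, a i <= x 0 i <= a i + r] ->
  (forall x y, A x -> A y -> (forall i, i != j -> x 0 i = y 0 i) ->
    `|x 0 j - y 0 j| <= l) ->
  (lebesgue_rV n A <= (2 * l * r ^+ n.-1)%:E)%E.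
Proof.
elim: n j A a => [[]//|n IH] j A a r0 l0 mA Aa Al.
have mA' : measurable (@rV_cons R n @^-1` A).
  by rewrite -[X in measurable X]setTI; exact: measurable_rV_cons.
have consS (t : R) (v : 'rV[R]_n) (i : 'I_n) : rV_cons (t, v) 0 (lift ord0 i) = v 0 i.
  have := congr1 (fun p : R * 'rV[R]_n => p.2 0 i) (rV_consK (t, v)).
  by rewrite /= mxE => <-; congr (rV_cons _ _ _); exact/val_inj.
have cons0 (t : R) (v : 'rV[R]_n) : rV_cons (t, v) 0 ord0 = t.
  by have := congr1 fst (rV_consK (t, v)).
rewrite [X in (X <= _)%E](_ : _ = (@lebesgue_measure R \x lebesgue_rV n)%E (@rV_cons R n @^-1` A)) //.
have [j0|[k jk]] : j = ord0 \/ exists k, j = lift ord0 k.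
  by case: (unliftP ord0 j) => [k ->|->]; [right; exists k|left].
- subst j.
  (* The product measure is defined by integrating over the first coordinate last; uniqueness
     permits the opposite order, in which the short section in direction [j] is measured first. *)
  rewrite (@product_measure_unique _ _ _ _ _ _ _ (@lebesgue_measure R \x^ lebesgue_rV n)%E)//; last first.
    by move=> X Y mX mY; exact: product_measure2E.
  rewrite /product_measure2.
  pose I (i : 'I_n) := `[a (lift ord0 i), a (lift ord0 i) + r]%classic.
  pose B := [set v : 'rV[R]_n | forall i, I i (v 0 i)].
  have mB : measurable B by apply: measurable_rV_box => i; exact: measurable_itv.
  apply: (@le_trans _ _ (\int[lebesgue_rV n]_v ((2 * l)%:E * (\1_B v)%:E))%E).
    apply: ge0_le_integral => //.
    - exact: measurable_fun_ysection.
    - by apply: measurable_funeM; apply/measurable_EFinP; exact: measurable_indic.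
    move=> v _ /=; have [Bv|Bv] := pselect (B v); last first.
      rewrite indicE memNset// mule0 (_ : ysection _ _ = set0) ?measure0//.
      rewrite -subset0 => t; rewrite /ysection /= inE => /= Atv; apply: Bv => i.
      by have := Aa _ Atv (lift ord0 i); rewrite consS /I /= in_itv.
    rewrite indicE mem_set// mule1; apply: lebesgue_measure_diam => //.
      exact: measurable_ysection.
    move=> s t; rewrite /ysection /= !inE /= => As At.
    rewrite -[s](cons0 s v) -[X in _ - X](cons0 t v); apply: Al => // i i0.
    by case: (unliftP ord0 i) i0 => [k ->|->]; rewrite ?eqxx// !consS.
  rewrite ge0_integralZl//; last 2 first.
  - by apply/measurable_EFinP; exact: measurable_indic.
  - by rewrite lee_fin mulr_ge0.
  rewrite integral_indic// setIT.
  rewrite [X in (_ * X)%E](_ : _ = \prod_(i < n) lebesgue_measure (I i))%E; last first.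
    by apply: lebesgue_rV_box => i; exact: measurable_itv.
  rewrite (eq_bigr (fun=> r%:E)); last first.
    move=> i _; rewrite lebesgue_measure_itv /= lte_fin.
    case: ifPn => [_|]; first by rewrite -EFinD; congr _%:E; lra.
    by rewrite -leNgt => h; congr _%:E; lra.
  by rewrite -(big_morph EFin (@EFinM R) erefl) prodr_const card_ord.
- subst j; have n0 : (0 < n)%N by apply: leq_ltn_trans (ltn_ord k).
  rewrite /product_measure1.
  pose I := `[a ord0, a ord0 + r]%classic.
  have c0 : 0 <= 2 * l * r ^+ n.-1 by rewrite mulr_ge0 ?exprn_ge0// mulr_ge0.
  apply: (@le_trans _ _ (\int[lebesgue_measure]_t ((2 * l * r ^+ n.-1)%:E * (\1_I t)%:E))%E).
    apply: ge0_le_integral => //.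
    - exact: measurable_fun_xsection.
    - apply: measurable_funeM; apply/measurable_EFinP; apply: measurable_indic.
      exact: measurable_itv.
    move=> t _ /=; have [It|It] := pselect (I t); last first.
      rewrite indicE memNset// mule0 (_ : xsection _ _ = set0) ?measure0//.
      rewrite -subset0 => v; rewrite /xsection /= inE => /= Atv; apply: It.
      by have := Aa _ Atv ord0; rewrite cons0 /I /= in_itv.
    rewrite indicE mem_set// mule1.
    apply: (IH k _ (fun i => a (lift ord0 i))) => //.
    + exact: measurable_xsection.
    + move=> v; rewrite /xsection /= inE /= => Atv i.
      by have := Aa _ Atv (lift ord0 i); rewrite consS.
    + move=> v w; rewrite /xsection /= !inE /= => Av Aw vw.
      rewrite -(consS t v k) -(consS t w k); apply: Al => // i ik.
      case: (unliftP ord0 i) ik => [h ->|-> _]; last by rewrite !cons0.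
      by rewrite !consS => hk; apply: vw; apply: contra hk => /eqP ->.
  rewrite ge0_integralZl//; last first.
    apply/measurable_EFinP; apply: measurable_indic.
    exact: measurable_itv.
  rewrite integral_indic//; last exact: measurable_itv.
  rewrite (_ : I `&` _ = I); last by apply/seteqP; split=> [x []|x Ix].
  rewrite [X in (_ * X)%E](_ : _ = r%:E); last first.
    rewrite [LHS]lebesgue_measure_itv /= lte_fin.
    case: ifPn => [_|]; first by rewrite -EFinD; congr _%:E; lra.
    by rewrite -leNgt => h; congr _%:E; lra.
  by rewrite -EFinM lee_fin /= -[in leRHS](prednK n0) exprSr mulrA.
Qed.

End rV_measure.

(** * A smooth lattice kernel on the line *)

Section smooth_real_functions.
Context {R : realType}.
Implicit Types (f g : R -> R) (k : nat).

(** Existence of [k] successive derivatives as a nested existential: explicit derivatives can be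
    supplied, so closure under sums, products and composition follows by direct induction. *)
Fixpoint Dk k f : Prop := if k is k'.+1 then
  exists2 f', (forall x : R, is_derive x 1 f (f' x)) & Dk k' f' else True.

Lemma DkW k f : Dk k.+1 f -> Dk k f.
Proof. by elim: k f => // k IH f [f' ff' kf']; exists f' => //; exact: IH. Qed.

Lemma Dk_cst k (c : R) : Dk k (fun=> c).
Proof. by elim: k c => // k IH c; exists (fun=> 0) => // x; exact: is_derive_cst. Qed.

Lemma Dk_id k : Dk k id.
Proof. by case: k => // k; exists (fun=> 1); [move=> x; exact: is_derive_id|exact: Dk_cst]. Qed.

Lemma DkD k f g : Dk k f -> Dk k g -> Dk k (fun x => f x + g x).
Proof.
elim: k f g => // k IH f g [f' ff' kf'] [g' gg' kg'].
by exists (fun x => f' x + g' x); [move=> x; exact: is_deriveD|exact: IH].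
Qed.

Lemma DkM k f g : Dk k f -> Dk k g -> Dk k (fun x => f x * g x).
Proof.
elim: k f g => // k IH f g kf kg.
have [f' ff' kf'] := kf; have [g' gg' kg'] := kg.
exists (fun x => f x * g' x + g x * f' x); first by move=> x; exact: is_deriveM.
by apply: DkD; apply: IH => //; exact: DkW.
Qed.

Lemma Dk_comp k f g : Dk k f -> Dk k g -> Dk k (fun x => f (g x)).
Proof.
elim: k f g => // k IH f g [f' ff' kf'] kg; have [g' gg' kg'] := kg.
exists (fun x => f' (g x) * g' x); first by move=> x; exact: is_derive1_comp.
by apply: DkM => //; apply: IH => //; exact: DkW.
Qed.

Lemma DkV k g : (forall x, g x != 0) -> Dk k g -> Dk k (fun x => (g x)^-1).
Proof.
move=> g0; elim: k => // k IH kg; have [g' gg' kg'] := kg.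
exists (fun x => -1 * ((g x)^-1 * (g x)^-1) * g' x).
  move=> x; apply: (is_derive_eq (is_deriveV (g0 x) (gg' x))); rewrite /GRing.scale /=.
  by rewrite -invfM -expr2 mulN1r.
have kgV := IH (DkW kg).
by apply: DkM => //; apply: DkM; [exact: Dk_cst|exact: DkM].
Qed.

Lemma Dk_shift k f (c : R) : Dk k f -> Dk k (fun x => f (x + c)).
Proof.
by move=> kf; apply: (@Dk_comp k f (fun x => x + c)) => //; apply: DkD; [exact: Dk_id|exact: Dk_cst].
Qed.

Lemma is_derive_continuous f (a x : R) : is_derive x 1 f a -> {for x, continuous f}.
Proof. by move=> [d _]; apply: differentiable_continuous; exact/derivable1_diffP. Qed.

(** The flat function exp(-1/t), extended by 0, together with its products by powers of 1/t: up to
    linear combinations this family is closed under differentiation. *)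
Definition expV (m : nat) (t : R) : R := if 0 < t then t^-1 ^+ m * expR (- t^-1) else 0.

(** Keeping the term of degree m+1 in the exponential series of 1/t gives the bound. Used at index
    m+1 it makes the difference quotient of [expV m] at 0 tend to 0. *)
Lemma expV_bound m t : 0 <= expV m t <= m.+1`!%:R * `|t|.
Proof.
rewrite /expV; case: ifPn => t0; last by rewrite lexx/= mulr_ge0.
have V0 : 0 < t^-1 by rewrite invr_gt0.
apply/andP; split; first by rewrite mulr_ge0 ?expR_ge0// exprn_ge0// ltW.
have := @expR_ge1Dxn R _ m (ltW V0).
rewrite (gtr0_norm t0) expRN ler_pdivrMr ?expR_gt0// => h.
have f0 : 0 < m.+1`!%:R :> R by rewrite ltr0n fact_gt0.
rewrite mulrAC -ler_pdivrMr// -ler_pdivrMl// -[t^-1 ^+ m / t]exprSr mulrC.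
by apply: le_trans h; rewrite lerDr.
Qed.

Lemma is_derive_expV m (x : R) :
  is_derive x 1 (expV m) (expV m.+2 x - m%:R * expV m.+1 x).
Proof.
have [x0|x0|->] := ltgtP x 0.
- rewrite /expV ltNge (ltW x0) /= mulr0 subr0.
  apply: (@near_eq_is_derive _ _ _ (fun=> 0)) => //.
  near=> t; rewrite ifF//; apply/negbTE; rewrite -leNgt ltW//.
  by near: t; exact: lt_nbhsl.
- rewrite /expV x0.
  apply: (@near_eq_is_derive _ _ _ (fun t : R => t^-1 ^+ m * expR (- t^-1))).
    near=> t; rewrite ifT//.
    by near: t; exact: lt_nbhsr.
  have xn0 : x != 0 by rewrite gt_eqF.
  have dV : is_derive x 1 (fun t : R => t^-1) (- (x^-1 ^+ 2)).
    apply: (is_derive_eq (is_deriveV xn0 (is_derive_id x 1))).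
    by rewrite /GRing.scale /= mulr1 exprVn.
  have dVm : is_derive x 1 (fun t : R => t^-1 ^+ m) ((m%:R * x^-1 ^+ m.-1) *: - x^-1 ^+ 2).
    by have := is_deriveX m dV; rewrite (_ : _ ^+ m = fun t : R => t^-1 ^+ m)//; apply/funext => t; rewrite fctE.
  have dE := @is_derive1_comp R expR (fun t : R => - t^-1) x _ _ (is_derive_expR (- x^-1)) (is_deriveN dV).
  apply: (is_derive_eq (is_deriveM dVm dE)).
  rewrite /GRing.scale /=.
  by case: m dVm => [|m] dVm; rewrite /= ?exprS expr0; ring.
- rewrite /expV ltxx mulr0 subr0.
  have cv : h^-1 *: (expV m (h *: 1 + 0) - expV m 0) @[h --> (0 : R)^'] --> (0 : R).
    apply/cvgrPdist_le => e e0; near=> h.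
    rewrite /expV ltxx subr0 addr0 -/(expV _ _) sub0r normrN /GRing.scale /= mulr1.
    have h0 : h != 0 by near: h; exact: nbhs_dnbhs_neq.
    have f0 : 0 < m.+2`!%:R :> R by rewrite ltr0n fact_gt0.
    apply: (@le_trans _ _ (m.+2`!%:R * `|h|)).
      have /andP[e1 e2] := expV_bound m.+1 h; apply: le_trans e2.
      rewrite -(ger0_norm e1) -/(expV m h) /expV; case: ifPn => hp; last by rewrite mulr0.
      by rewrite mulrA -exprS.
    rewrite -ler_pdivlMl//; near: h; apply: dnbhs0_le.
    by rewrite mulr_gt0// invr_gt0.
  by apply: DeriveDef; [apply/cvg_ex; exists 0|exact: cvg_lim].
Unshelve. all: by end_near. Qed.

Lemma Dk_expV k m : Dk k (expV m).
Proof.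
elim: k m => // k IH m; exists (fun x => expV m.+2 x + (- m%:R) * expV m.+1 x).
  by move=> x; apply: is_derive_eq; [exact: is_derive_expV|rewrite mulNr].
by apply: DkD => //; apply: DkM => //; exact: Dk_cst.
Qed.

Definition smooth_step (t : R) : R := expV 0 t / (expV 0 t + expV 0 (1 - t)).

Lemma expV0_gt0 (t : R) : 0 < t -> 0 < expV 0 t.
Proof. by move=> t0; rewrite /expV t0 expr0 mul1r expR_gt0. Qed.

Lemma smooth_step_den (t : R) : expV 0 t + expV 0 (1 - t) != 0.
Proof.
have /andP[t0 _] := expV_bound 0 t; have /andP[t1 _] := expV_bound 0 (1 - t).
rewrite gt_eqF//; have [tp|tn] := ltP 0 t; first by rewrite ltr_pwDl// expV0_gt0.
by rewrite ltr_wpDl// expV0_gt0//; lra.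
Qed.

Lemma Dk_smooth_step k : Dk k smooth_step.
Proof.
apply: DkM; first exact: Dk_expV.
apply: DkV; first exact: smooth_step_den.
apply: DkD; first exact: Dk_expV.
apply: (@Dk_comp k (expV 0) (fun t => 1 - t)); first exact: Dk_expV.
apply: DkD; first exact: Dk_cst.
rewrite (_ : -%R = (fun t : R => -1 * t)); last by apply/funext => t; rewrite mulN1r.
by apply: DkM; [exact: Dk_cst|exact: Dk_id].
Qed.

Lemma smooth_step0 (t : R) : t <= 0 -> smooth_step t = 0.
Proof. by move=> t0; rewrite /smooth_step {1}/expV ltNge t0 /= mul0r. Qed.

Lemma smooth_step1 (t : R) : 1 <= t -> smooth_step t = 1.
Proof.
move=> t1; have h : expV 0 (1 - t) = 0.
  by rewrite /expV ifF//; apply/negbTE; rewrite -leNgt subr_le0.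
by rewrite /smooth_step h addr0 divff// gt_eqF// expV0_gt0//; lra.
Qed.

(** Telescoping; stated for arbitrary [X] because it serves both the kernel and its derivative. The
    next lemma is the corresponding summation by parts. *)
Lemma second_difference_sum (X : R -> R) (t : R) (M : nat) :
  \sum_(m < M) (X (t - m%:R + 2) - 2 * X (t - m%:R + 1) + X (t - m%:R)) =
  X (t + 2) - X (t + 1) - X (t + 2 - M%:R) + X (t + 1 - M%:R).
Proof.
elim: M => [|M IH]; first by rewrite big_ord0 !subr0; ring.
rewrite big_ord_recr /= IH -[M.+1%:R]natr1.
rewrite (_ : t - M%:R + 2 = t + 2 - M%:R); last by ring.
rewrite (_ : t - M%:R + 1 = t + 1 - M%:R); last by ring.
rewrite (_ : t + 2 - (M%:R + 1) = t + 1 - M%:R); last by ring.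
rewrite (_ : t + 1 - (M%:R + 1) = t - M%:R); last by ring.
by ring.
Qed.

Lemma second_difference_wsum (X : R -> R) (t : R) (M : nat) :
  \sum_(m < M) m%:R * (X (t - m%:R + 2) - 2 * X (t - m%:R + 1) + X (t - m%:R)) =
  X (t + 1) - M%:R * X (t + 2 - M%:R) + (M%:R - 1) * X (t + 1 - M%:R).
Proof.
elim: M => [|M IH]; first by rewrite big_ord0 !subr0; ring.
rewrite big_ord_recr /= IH -[M.+1%:R]natr1.
rewrite (_ : t - M%:R + 2 = t + 2 - M%:R); last by ring.
rewrite (_ : t - M%:R + 1 = t + 1 - M%:R); last by ring.
rewrite (_ : t + 2 - (M%:R + 1) = t + 1 - M%:R); last by ring.
rewrite (_ : t + 1 - (M%:R + 1) = t - M%:R); last by ring.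
by ring.
Qed.

Lemma sum_local_bound (f : R -> R) (K : R) :
  (forall s, `|f s| <= K) -> (forall s, f s != 0 -> -2 <= s <= 1) ->
  forall (t : R) (M : nat), \sum_(m < M) `|f (t - m%:R)| <= K * 4.
Proof.
move=> fK f0 t M.
have K0 : 0 <= K by exact: le_trans (normr_ge0 _) (fK 0).
(* [H] is nondecreasing with values in [0, 4] and increases by exactly 1 from s - 1 to s when s lies
   in [-2, 1]. So K (H s - H (s - 1)) dominates |f s| and telescopes, without counting the at most
   four nonzero terms. *)
pose H (s : R) := Num.max 0 (Num.min 4 (s + 3)).
have HB s : `|f s| <= K * (H s - H (s - 1)).
  have [fs0|fs0] := eqVneq (f s) 0.
    rewrite fs0 normr0 mulr_ge0// subr_ge0 /H ge_max !le_max lexx /=.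
    apply/orP; right; rewrite le_min !ge_min lexx /=.
    by apply/orP; right; lra.
  have /andP[s1 s2] := f0 _ fs0; rewrite (_ : H s - H (s - 1) = 1) ?mulr1//.
  rewrite /H min_r; last by lra.
  rewrite max_r; last by lra.
  rewrite min_r; last by lra.
  rewrite max_r; last by lra.
  by ring.
apply: (@le_trans _ _ (\sum_(m < M) K * (H (t - m%:R) - H (t - m.+1%:R)))).
  apply: ler_sum => m _; apply: le_trans (HB _) _; rewrite -[m.+1%:R]natr1.
  by rewrite (_ : t - (m%:R + 1) = t - m%:R - 1)//; ring.
rewrite -mulr_sumr ler_wpM2l//.
have -> : \sum_(m < M) (H (t - m%:R) - H (t - m.+1%:R)) = H t - H (t - M%:R).
  elim: M => [|M IH]; first by rewrite big_ord0 subr0 subrr.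
  by rewrite big_ord_recr /= IH; ring.
have H4 s : 0 <= H s <= 4.
  by rewrite /H le_max lexx /= ge_max ge_min lexx ler0n.
by have /andP[? ?] := H4 t; have /andP[? ?] := H4 (t - M%:R); lra.
Qed.

Lemma compact_support_bounded (f : R -> R) : continuous f ->
  (forall s, f s != 0 -> -2 <= s <= 1) -> exists K, forall s, `|f s| <= K.
Proof.
move=> cf f0.
have [||c _ cmax] := @EVT_max R (fun x => `|f x|) (-2) 1; first by lra.
  apply: continuous_subspaceT => x; apply: continuous_comp; first exact: cf.
  exact: norm_continuous.
exists `|f c| => s; have [->|fs] := eqVneq (f s) 0; first by rewrite normr0.
by apply: cmax; rewrite in_itv /=; exact: f0.
Qed.

(* [b] generates a smooth partition of unity on the integer lattice that also
   reproduces linear functions; the last two conditions are the differentiated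
   forms of these two identities. *)
Record lattice_kernel (b b' : R -> R) (B : R) : Prop := LatticeKernel {
  lk_smooth : forall k, Dk k b ;
  lk_derive : forall x : R, is_derive x 1 b (b' x) ;
  lk_supp : forall t, b t != 0 -> -2 <= t <= 1 ;
  lk_supp' : forall t, b' t != 0 -> -2 <= t <= 1 ;
  lk_bound : forall t (M : nat), \sum_(m < M) `|b (t - m%:R)| <= B ;
  lk_bound' : forall t (M : nat), \sum_(m < M) `|b' (t - m%:R)| <= B ;
  lk_sum : forall t (M : nat), 1 <= t -> t + 3 <= M%:R ->
    \sum_(m < M) b (t - m%:R) = 1 ;
  lk_sum' : forall t (M : nat), 1 <= t -> t + 3 <= M%:R ->
    \sum_(m < M) b' (t - m%:R) = 0 ;
  lk_wsum' : forall t (M : nat), 1 <= t -> t + 3 <= M%:R ->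
    \sum_(m < M) m%:R * b' (t - m%:R) = 1 }.

(** The hat function is the second difference of the positive part of t. Here the positive part is
    replaced by a smooth [E] that is 0 for t <= 0 and t for t >= 1. The second difference still has
    compact support, and the sums over the lattice telescope to values of [E] where it is exactly
    affine. *)
Lemma lattice_kernel_exists : exists b b' B, lattice_kernel b b' B.
Proof.
pose E (t : R) := t * smooth_step t.
have kE k : Dk k E by apply: DkM; [exact: Dk_id|exact: Dk_smooth_step].
have E0 t : t <= 0 -> E t = 0 by move=> t0; rewrite /E smooth_step0// mulr0.
have E1 t : 1 <= t -> E t = t by move=> t1; rewrite /E smooth_step1// mulr1.
have [E' EE' _] := kE 1%N.
have E'0 (t : R) : t < 0 -> E' t = 0.
  move=> t0; rewrite -(@derive_val _ _ _ _ _ _ _ (EE' t)).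
  apply: (@derive_val _ _ _ _ _ _ _ (@near_eq_is_derive _ _ _ (fun=> 0) _ _ _ _ _ _)).
  by near=> s; rewrite E0// ltW//; near: s; exact: lt_nbhsl.
have E'1 (t : R) : 1 < t -> E' t = 1.
  move=> t0; rewrite -(@derive_val _ _ _ _ _ _ _ (EE' t)).
  apply: (@derive_val _ _ _ _ _ _ _ (@near_eq_is_derive _ _ _ id _ _ _ _ _ _)).
  by near=> s; rewrite E1// ltW//; near: s; exact: lt_nbhsr.
pose b (s : R) := E (s + 2) - 2 * E (s + 1) + E s.
pose b' (s : R) := E' (s + 2) - 2 * E' (s + 1) + E' s.
have kb k : Dk k b.
  rewrite /b (_ : (fun s => _) = (fun s => E (s + 2) + (- 2) * E (s + 1) + E s)); last first.
    by apply/funext => s; ring.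
  apply: DkD => //; apply: DkD; first exact: Dk_shift.
  by apply: DkM; [exact: Dk_cst|exact: Dk_shift].
have dE (c x : R) : is_derive x 1 (fun s : R => E (s + c)) (E' (x + c)).
  have dc : is_derive x 1 (fun s : R => s + c) 1.
    by apply: is_derive_eq (is_deriveD (is_derive_id x 1) (is_derive_cst c x 1)) _; rewrite addr0.
  by apply: is_derive_eq (@is_derive1_comp R E (fun s => s + c) x _ _ (EE' (x + c)) dc) _; rewrite mulr1.
have db (x : R) : is_derive x 1 b (b' x).
  have d1 := is_deriveD (is_deriveB (dE 2 x) (is_deriveZ 2 (dE 1 x))) (EE' x).
  exact: d1.
have suppb t : b t != 0 -> -2 <= t <= 1.
  apply: contraNT; rewrite negb_and -!ltNge => /orP[t0|t0].
    by rewrite /b !E0 ?mulr0 ?subr0 ?addr0//; lra.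
  by apply/eqP; rewrite /b !E1; lra.
have suppb' t : b' t != 0 -> -2 <= t <= 1.
  apply: contraNT; rewrite negb_and -!ltNge => /orP[t0|t0].
    by rewrite /b' !E'0 ?mulr0 ?subr0 ?addr0//; lra.
  by apply/eqP; rewrite /b' !E'1; lra.
have cb : continuous b by move=> x; exact: is_derive_continuous (db x).
have cb' : continuous b'.
  have [b1 bb1 [b2 bb2 _]] := kb 2.
  have -> : b' = b1.
    apply/funext => x; rewrite -(@derive_val _ _ _ _ _ _ _ (db x)).
    exact: (@derive_val _ _ _ _ _ _ _ (bb1 x)).
  by move=> x; exact: is_derive_continuous (bb2 x).
have [K bK] := compact_support_bounded cb suppb.
have [K' bK'] := compact_support_bounded cb' suppb'.
exists b, b', (Num.max (K * 4) (K' * 4)); split => //.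
- by move=> t M; rewrite le_max sum_local_bound.
- by move=> t M; rewrite le_max (@sum_local_bound _ K') ?orbT.
- move=> t M t1 tM; rewrite /b second_difference_sum.
  rewrite (E1 (t + 2)) ?(E1 (t + 1)) ?(E0 (t + 2 - _)) ?(E0 (t + 1 - _)); lra.
- move=> t M t1 tM; rewrite /b' second_difference_sum.
  rewrite ?(E'1 (t + 2)) ?(E'1 (t + 1)) ?(E'0 (t + 2 - _)) ?(E'0 (t + 1 - _)); lra.
- move=> t M t1 tM; rewrite /b' second_difference_wsum.
  rewrite ?(E'1 (t + 2)) ?(E'1 (t + 1)) ?(E'0 (t + 2 - _)) ?(E'0 (t + 1 - _)); lra.
Unshelve. all: by end_near. Qed.

End smooth_real_functions.

(** * Lattice mollification *)

Section tensor_products.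
Context {R : realType} (n : nat).
Local Notation Rn := 'rV[R]_n.
Implicit Types (f : 'I_n -> R -> R) (x : Rn).

Lemma derive_along (g : Rn -> R) x v :
  'D_v g x = 'D_1 (fun h : R => g (h *: v + x)) 0.
Proof.
rewrite /derive; set G := (X in _ = lim (X @ _)).
rewrite (_ : (fun h => _) = G)//; apply/funext => h; rewrite /G /shift /=.
by rewrite addr0 scale0r add0r /GRing.scale /= mulr1.
Qed.

Lemma differentiable_coord_comp (g : R -> R) (g' : R) x i :
  is_derive (x 0 i) 1 g g' -> differentiable (fun y : Rn => g (y 0 i)) x.
Proof.
move=> [dg _]; apply: (@differentiable_comp _ _ _ _ (fun y : Rn => y 0 i) g x).
  exact: differentiable_coord.
exact/derivable1_diffP.
Qed.

Lemma differentiable_tensor f (f' : 'I_n -> R -> R) x :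
  (forall j (t : R), is_derive t 1 (f j) (f' j t)) ->
  differentiable (fun y : Rn => \prod_j f j (y 0 j)) x.
Proof.
move=> ff'; elim: (index_enum _) => [|j s IH].
  rewrite (_ : (fun y => _) = fun=> 1); last by apply/funext => y; rewrite big_nil.
  exact: differentiable_cst.
rewrite (_ : (fun y => _) = (fun y : Rn => f j (y 0 j)) *
    (fun y : Rn => \prod_(l <- s) f l (y 0 l))); last first.
  by apply/funext => y; rewrite big_cons.
by apply: differentiableM => //; exact: differentiable_coord_comp (ff' j (x 0 j)).
Qed.

Lemma partial_tensor f (f' : 'I_n -> R -> R) x i :
  (forall j (t : R), is_derive t 1 (f j) (f' j t)) ->
  partial i (fun y : Rn => \prod_j f j (y 0 j)) x =
  \prod_j (if j == i then f' j else f j) (x 0 j).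
Proof.
move=> ff'; rewrite /partial derive_along.
have -> : (fun h : R => \prod_j f j ((h *: delta_mx 0 i + x) 0 j)) =
    (fun h : R => (\prod_(j | j != i) f j (x 0 j)) *: f i (h + x 0 i)).
  apply/funext => h; rewrite (bigD1 i)//= !mxE !eqxx /= mulr1 mulrC; congr (_ * _).
  apply: eq_bigr => j ji; rewrite !mxE (negbTE ji) /= mulr0 add0r//.
have ds : is_derive (0 : R) 1 (fun h : R => h + x 0 i) 1.
  by apply: is_derive_eq (is_deriveD (is_derive_id (0 : R) 1) (is_derive_cst (x 0 i) (0 : R) 1)) _; rewrite addr0.
have dc := @is_derive1_comp R (f i) (fun h : R => h + x 0 i) 0 _ _ (ff' i _) ds.
rewrite (@derive_val _ _ _ _ _ _ _ (is_deriveZ _ dc)) add0r mulr1.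
rewrite [RHS](bigD1 i)//= eqxx mulrC; congr (_ * _).
by apply: eq_bigr => j ji; rewrite (negbTE ji).
Qed.

(** One more derivative is assumed than is obtained: [Ck 0] asks for continuity, which is deduced
    here from differentiability. *)
Lemma Ck_tensor k f : (forall j, Dk k.+1 (f j)) ->
  Ck k (fun y : Rn => \prod_j f j (y 0 j)).
Proof.
elim: k f => [|k IH] f kf.
  have /(_ _)/cid2-/all_sig2[f' ff' _] := kf.
  by move=> x; apply: differentiable_continuous; exact: differentiable_tensor.
have /(_ _)/cid2-/all_sig2[f' ff' kf'] := kf.
split=> [x|i]; first exact: differentiable_tensor.
rewrite (_ : partial i _ = fun y : Rn => \prod_j (if j == i then f' j else f j) (y 0 j)); last first.
  by apply/funext => y; exact: partial_tensor.
by apply: (IH (fun j => if j == i then f' j else f j)) => j; case: ifP => _; [exact: kf'|exact: DkW].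
Qed.

Lemma Ck0 k : Ck k (fun _ : Rn => 0 : R).
Proof.
elim: k => [|k IH]; first by move=> x; exact: cst_continuous.
split=> [x|i]; first exact: differentiable_cst.
by rewrite (_ : partial i _ = fun=> 0)//; apply/funext => x; exact: derive_cst.
Qed.

Lemma Ck_lin k (c : R) (g h : Rn -> R) : Ck k g -> Ck k h ->
  Ck k (fun x => c * g x + h x).
Proof.
elim: k g h => [|k IH] g h kg kh.
  move=> x; apply: (@continuousD _ _ _ (fun x => c * g x) h x); last exact: kh.
  by apply: (@continuousM _ _ (fun=> c) g x); [exact: cst_continuous|exact: kg].
have [dg pg] := kg; have [dh ph] := kh.
have dcg x : differentiable (fun x => c * g x) x by exact: differentiableZ.
split=> [x|i]; first exact: differentiableD.
rewrite (_ : partial i _ = fun x => c * partial i g x + partial i h x); first exact: (IH (partial i g) (partial i h) (pg i) (ph i)).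
apply/funext => x; rewrite /partial.
have dgx : derivable g x (delta_mx 0 i) by exact: diff_derivable.
have dhx : derivable h x (delta_mx 0 i) by exact: diff_derivable.
exact: (@derive_val _ _ _ _ _ _ _
  (is_deriveD (is_deriveZ c (derivableP dgx)) (derivableP dhx))).
Qed.

Lemma Ck_sum k (I : Type) (s : seq I) (c : I -> R) (g : I -> Rn -> R) :
  (forall l, Ck k (g l)) -> Ck k (fun x => \sum_(l <- s) c l * g l x).
Proof.
move=> kg; elim: s => [|l s IH].
  by rewrite (_ : (fun x => _) = fun=> 0); [exact: Ck0|apply/funext => x; rewrite big_nil].
rewrite (_ : (fun x => _) = fun x => c l * g l x + \sum_(l <- s) c l * g l x); last first.
  by apply/funext => x; rewrite big_cons.
exact: Ck_lin.
Qed.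

Lemma partial_sum (I : Type) (s : seq I) (c : I -> R) (g : I -> Rn -> R) i x :
  (forall l, Ck 1 (g l)) ->
  partial i (fun x => \sum_(l <- s) c l * g l x) x = \sum_(l <- s) c l * partial i (g l) x.
Proof.
move=> kg; elim: s => [|l s IH].
  rewrite big_nil (_ : (fun x => _) = fun=> 0); first exact: derive_cst.
  by apply/funext => y; rewrite big_nil.
rewrite (_ : (fun x => _) = (fun x => c l *: g l x) + fun x => \sum_(l <- s) c l * g l x); last first.
  by apply/funext => y; rewrite big_cons.
rewrite big_cons -IH /partial.
have [dg _] := kg l; have [ds _] : Ck 1 (fun x => \sum_(l <- s) c l * g l x) by exact: Ck_sum.
have dgx : derivable (g l) x (delta_mx 0 i) by exact: diff_derivable.
have dsx : derivable (fun x => \sum_(l <- s) c l * g l x) x (delta_mx 0 i) by exact: diff_derivable.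
exact: (@derive_val _ _ _ _ _ _ _
  (is_deriveD (is_deriveZ (c l) (derivableP dgx)) (derivableP dsx))).
Qed.

End tensor_products.

Section lattice_mollifier.
Context {R : realType} (n : nat).
Local Notation Rn := 'rV[R]_n.
Variables (b b' : R -> R) (B : R) (lk : lattice_kernel b b' B).
Variables (eta : R) (N M : nat).
Hypothesis eta0 : 0 < eta.
Local Notation index := {ffun 'I_n -> 'I_M}.
Implicit Types (k : index) (x y : Rn) (F : Rn -> R).

(** Position measured in mesh units and shifted by [N], so that the indices 0, ..., M-1 stand for
    the lattice points from -N to M-1-N. *)
Definition lattice_coord x (i : 'I_n) : R := x 0 i / eta + N%:R.

Definition lattice_node k : Rn := \row_i (eta * ((k i)%:R - N%:R)).

Definition lattice_weight k x : R := \prod_i b (lattice_coord x i - (k i)%:R).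

Definition lattice_dweight (i : 'I_n) k x : R :=
  eta^-1 * \prod_j (if j == i then b' else b) (lattice_coord x j - (k j)%:R).

Definition mollify F x : R := \sum_k F (lattice_node k) * lattice_weight k x.

(** The region where the finite range of indices contains all nonzero terms of the kernel sums, so
    that their identities hold exactly. *)
Definition in_lattice x :=
  forall i, 1 <= lattice_coord x i /\ lattice_coord x i + 3 <= M%:R.

Let kernel_coord_smooth k m i : Dk m (fun s : R => b (s / eta + N%:R - (k i)%:R)).
Proof.
apply: (@Dk_comp R m b (fun s => s / eta + N%:R - (k i)%:R)); first exact: lk_smooth lk m.
rewrite (_ : (fun s => _) = (fun s => s * eta^-1 + (N%:R - (k i)%:R))); last first.
  by apply/funext => s; rewrite addrA.
by apply: DkD; [apply: DkM; [exact: Dk_id|exact: Dk_cst]|exact: Dk_cst].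
Qed.

Let kernel_coord_derive k i (s : R) :
  is_derive s 1 (fun s : R => b (s / eta + N%:R - (k i)%:R))
    (eta^-1 * b' (s / eta + N%:R - (k i)%:R)).
Proof.
have ds : is_derive s 1 (fun s : R => s / eta + N%:R - (k i)%:R) eta^-1.
  rewrite (_ : (fun s => _) = (fun s : R => eta^-1 *: s + (N%:R - (k i)%:R))); last first.
    by apply/funext => u; rewrite addrA mulrC.
  have d1 := is_deriveD (is_deriveZ (eta^-1) (is_derive_id s 1))
    (is_derive_cst (N%:R - (k i)%:R : R) s 1).
  by apply: (is_derive_eq d1); rewrite addr0 /GRing.scale /= mulr1.
have := @is_derive1_comp R b _ s _ _ (lk_derive lk (s / eta + N%:R - (k i)%:R)) ds.
by rewrite mulrC.
Qed.

Lemma smooth_lattice_weight k m : Ck m (lattice_weight k).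
Proof.
by apply: (@Ck_tensor R n m (fun i s => b (s / eta + N%:R - (k i)%:R))) => j; exact: kernel_coord_smooth.
Qed.

Lemma partial_lattice_weight i k x :
  partial i (lattice_weight k) x = lattice_dweight i k x.
Proof.
rewrite [LHS](partial_tensor _ _ (fun j s => kernel_coord_derive k j s)) /lattice_dweight.
rewrite (bigD1 i)//= [in RHS](bigD1 i)//= eqxx mulrA; congr (_ * _).
by apply: eq_bigr => j /negbTE ->.
Qed.

Lemma smooth_mollify F : smooth (mollify F).
Proof. by move=> m; apply: Ck_sum => k; exact: smooth_lattice_weight. Qed.

Lemma partial_mollify F i x :
  partial i (mollify F) x = \sum_k F (lattice_node k) * lattice_dweight i k x.
Proof.
rewrite partial_sum; last by move=> k; exact: smooth_lattice_weight.
by apply: eq_bigr => k _; rewrite partial_lattice_weight.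
Qed.

Let near_node k x : (forall i, -2 <= lattice_coord x i - (k i)%:R <= 1) ->
  `|lattice_node k - x| <= 2 * eta.
Proof.
move=> kx; apply: rV_norm_le => [|i]; first by rewrite mulr_ge0// ltW.
have := kx i; rewrite /lattice_coord !mxE.
rewrite (_ : eta * ((k i)%:R - N%:R) - x 0 i =
  - eta * (x 0 i / eta + N%:R - (k i)%:R)); last by field; exact: lt0r_neq0.
set s := _ - _ => /andP[s1 s2].
rewrite normrM normrN (gtr0_norm eta0) mulrC ler_wpM2r ?(ltW eta0)// ler_norml.
by apply/andP; split; lra.
Qed.

Lemma lattice_weight_supp k x : lattice_weight k x != 0 ->
  `|lattice_node k - x| <= 2 * eta.
Proof. by move=> /prodf_neq0 kx; apply: near_node => i; apply: (lk_supp lk); exact: kx. Qed.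

Lemma lattice_dweight_supp i k x : lattice_dweight i k x != 0 ->
  `|lattice_node k - x| <= 2 * eta.
Proof.
rewrite mulf_eq0 negb_or => /andP[_ /prodf_neq0 kx]; apply: near_node => j.
have := kx j isT; case: ifP => _; first exact: (lk_supp' lk).
exact: (lk_supp lk).
Qed.

(** A sum over multi-indices of a product is the product of the one-dimensional sums; the sums that
    follow factor in the same way. *)
Lemma lattice_weight_sum x : in_lattice x -> \sum_k lattice_weight k x = 1.
Proof.
move=> ix; rewrite -(bigA_distr_bigA (fun i (m : 'I_M) => b (lattice_coord x i - m%:R))) /=.
by rewrite big1// => i _; have [? ?] := ix i; exact: (lk_sum lk).
Qed.

Let B_ge0 : 0 <= B.
Proof. by have := lk_bound lk 0 0; rewrite big_ord0. Qed.

Lemma lattice_weight_norm_sum x : \sum_k `|lattice_weight k x| <= B ^+ n.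
Proof.
rewrite (eq_bigr (fun k : index => \prod_i `|b (lattice_coord x i - (k i)%:R)|)); last first.
  by move=> k _; rewrite normr_prod.
rewrite -(bigA_distr_bigA (fun i (m : 'I_M) => `|b (lattice_coord x i - m%:R)|)) /=.
rewrite -[X in _ ^+ X]card_ord -prodr_const; apply: ler_prod => i _.
by rewrite (lk_bound lk) sumr_ge0.
Qed.

Lemma lattice_dweight_norm_sum i x :
  \sum_k `|lattice_dweight i k x| <= eta^-1 * B ^+ n.
Proof.
rewrite (eq_bigr (fun k : index => eta^-1 *
  \prod_j `|(if j == i then b' else b) (lattice_coord x j - (k j)%:R)|)); last first.
  by move=> k _; rewrite normrM normr_prod gtr0_norm// invr_gt0.
rewrite -mulr_sumr ler_wpM2l ?invr_ge0 ?(ltW eta0)//.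
rewrite -(bigA_distr_bigA (fun j (m : 'I_M) =>
  `|(if j == i then b' else b) (lattice_coord x j - m%:R)|)) /=.
rewrite -[X in _ ^+ X]card_ord -prodr_const; apply: ler_prod => j _.
by rewrite sumr_ge0//=; case: ifP => _; [exact: (lk_bound' lk)|exact: (lk_bound lk)].
Qed.

Lemma lattice_dweight_sum i x : in_lattice x -> \sum_k lattice_dweight i k x = 0.
Proof.
move=> ix; rewrite -mulr_sumr -(bigA_distr_bigA (fun j (m : 'I_M) =>
  (if j == i then b' else b) (lattice_coord x j - m%:R))) /=.
rewrite (bigD1 i)//= eqxx; have [? ?] := ix i.
by rewrite (lk_sum' lk)// mul0r mulr0.
Qed.

(** After factoring, direction [i] contributes the weighted sum of [b'], which is 1, when i = j, and
    the plain sum of [b'], which is 0, otherwise. *)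
Lemma lattice_dweight_wsum i j x : in_lattice x ->
  \sum_k lattice_dweight i k x * (lattice_node k 0 j - x 0 j) = (i == j)%:R.
Proof.
move=> ix; rewrite (eq_bigr (fun k : index => \prod_l
    ((if l == i then b' else b) (lattice_coord x l - (k l)%:R) *
     (if l == j then (k l)%:R - lattice_coord x l else 1)))); last first.
  move=> k _; rewrite big_split /=.
  have -> : \prod_l (if l == j then (k l)%:R - lattice_coord x l else 1) =
      (k j)%:R - lattice_coord x j.
    by rewrite (bigD1 j)//= eqxx big1 ?mulr1// => l /negbTE ->.
  by rewrite /lattice_dweight !mxE /lattice_coord; field; exact: lt0r_neq0.
rewrite -(bigA_distr_bigA (fun l (m : 'I_M) =>
  (if l == i then b' else b) (lattice_coord x l - m%:R) *
  (if l == j then m%:R - lattice_coord x l else 1))) /=.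
have [<-|ij] := eqVneq i j.
  rewrite big1// => l _; have [l1 l3] := ix l; case: ifP => _.
    rewrite (eq_bigr (fun m : 'I_M => m%:R * b' (lattice_coord x l - m%:R) -
       lattice_coord x l * b' (lattice_coord x l - m%:R))); last by move=> m _; ring.
    by rewrite sumrB -mulr_sumr (lk_sum' lk)// (lk_wsum' lk)// mulr0 subr0.
  by under eq_bigr do rewrite mulr1; exact: (lk_sum lk).
rewrite (bigD1 i)//= eqxx (negbTE ij); have [i1 i3] := ix i.
by under eq_bigr do rewrite mulr1; rewrite (lk_sum' lk)// mul0r.
Qed.

Lemma mollify_supp F x : mollify F x != 0 ->
  exists2 y, `|y - x| <= 2 * eta & F y != 0.
Proof.
move=> Fx; apply: contrapT => H; move/eqP: Fx; apply; rewrite /mollify big1// => k _.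
apply/eqP; rewrite mulf_eq0; apply: contrapT => /negP; rewrite negb_or => /andP[Fk wk].
by apply: H; exists (lattice_node k) => //; exact: lattice_weight_supp.
Qed.

Lemma mollify_approx F x (delta : R) : in_lattice x ->
  (forall y, `|y - x| <= 2 * eta -> `|F y - F x| <= delta) ->
  `|mollify F x - F x| <= B ^+ n * delta.
Proof.
move=> ix FB; rewrite -[X in _ - X]mulr1 -(lattice_weight_sum ix) mulr_sumr -sumrB.
apply: (le_trans (ler_norm_sum _ _ _)).
apply: (@le_trans _ _ (\sum_k `|lattice_weight k x| * delta)).
  apply: ler_sum => k _; rewrite -mulrBl normrM mulrC.
  have [->|wk] := eqVneq (lattice_weight k x) 0; first by rewrite normr0 !mul0r.
  by rewrite ler_wpM2l//; apply: FB; exact: lattice_weight_supp.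
rewrite -mulr_suml ler_wpM2r ?lattice_weight_norm_sum//.
by apply: le_trans (FB x _); rewrite ?subrr// normr0 mulr_ge0// ltW.
Qed.

(** The moment identities cancel the affine part of [F] at [x], and only the remainder is multiplied
    by 1/eta. Nothing is assumed about derivatives of [F]: the vector [c] need only satisfy a
    Taylor-type bound at scale eta. *)
Lemma mollify_partial_approx F x i (c : 'I_n -> R) (delta : R) : in_lattice x ->
  (forall y, `|y - x| <= 2 * eta ->
    `|F y - F x - \sum_j c j * (y 0 j - x 0 j)| <= delta) ->
  `|partial i (mollify F) x - c i| <= eta^-1 * B ^+ n * delta.
Proof.
move=> ix FB; rewrite partial_mollify.
have -> : \sum_k F (lattice_node k) * lattice_dweight i k x - c i =
    \sum_k lattice_dweight i k x * (F (lattice_node k) - F x -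
      \sum_j c j * (lattice_node k 0 j - x 0 j)).
  under [in RHS]eq_bigr do rewrite mulrBr mulrBr.
  rewrite sumrB sumrB -[X in _ = _ - X - _]mulr_suml lattice_dweight_sum// mul0r subr0.
  congr (_ - _); first by apply: eq_bigr => k _; rewrite mulrC.
  under [in RHS]eq_bigr do rewrite mulr_sumr.
  rewrite exchange_big /= (bigD1 i)//= [X in _ = _ + X]big1 ?addr0.
    under eq_bigr do rewrite mulrCA.
    by rewrite -mulr_sumr lattice_dweight_wsum// eqxx mulr1.
  move=> j ji; under eq_bigr do rewrite mulrCA.
  by rewrite -mulr_sumr lattice_dweight_wsum// eq_sym (negbTE ji) mulr0.
apply: (le_trans (ler_norm_sum _ _ _)).
apply: (@le_trans _ _ (\sum_k `|lattice_dweight i k x| * delta)).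
  apply: ler_sum => k _; rewrite normrM.
  have [->|wk] := eqVneq (lattice_dweight i k x) 0; first by rewrite normr0 !mul0r.
  by rewrite ler_wpM2l//; apply: FB; exact: lattice_dweight_supp wk.
rewrite -mulr_suml ler_wpM2r ?lattice_dweight_norm_sum//.
apply: le_trans (FB x _); last by rewrite subrr normr0 mulr_ge0// ltW.
exact: normr_ge0.
Qed.

End lattice_mollifier.

(** * The signed distance *)

Lemma lipschitz_bound {R : realType} (V W : normedModType R) (f : V -> W) (A : set V) :
  [lipschitz f x | x in A] ->
  exists2 L : R, 0 < L & forall x y, A x -> A y -> `|f x - f y| <= L * `|x - y|.
Proof.
move=> [M [_ HM]]; exists (Num.max M 0 + 1); first by rewrite ltr_wpDl// le_max lexx orbT.
move=> x y Ax Ay; apply: (HM _ _ (x, y)) => //.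
by rewrite (@le_lt_trans _ _ (Num.max M 0)) ?le_max ?lexx// ltrDl.
Qed.

Lemma derive_norm_le {R : realType} (V : normedModType R) (f : V -> R) (x v : V) (K : R) :
  derivable f x v -> (\forall h \near (0 : R)^', `|f (h *: v + x) - f x| <= K * `|h|) ->
  `|'D_v f x| <= K.
Proof.
move=> dfx fK; rewrite /derive -lim_norm//; apply: limr_le; first exact: is_cvg_norm.
near=> h; have h0 : h != 0 by near: h; exact: nbhs_dnbhs_neq.
rewrite /shift /= /GRing.scale /= normrM normfV ler_pdivrMl ?normr_gt0// mulrC.
by near: h.
Unshelve. all: by end_near. Qed.

Section approach.
Context {R : realType} (n : nat).
Local Notation Rn := 'rV[R]_n.

(** The step goes towards a point of [A] that is nearest up to s^2. This error is negligible after
    division by s, so no nearest point has to exist. *)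
Lemma dist_approach (A : set Rn) (x : Rn) (s : R) : A !=set0 -> 0 < s < dist x A ->
  exists2 u, enorm u = 1 & dist (x + s *: u) A <= dist x A - s + s ^+ 2.
Proof.
move=> A0 /andP[s0 sA].
have [y Ay xy] := dist_adherent x A0 (exprn_gt0 2 s0).
have xA := dist_le x Ay.
have r0 : 0 < enorm (y - x) by rewrite enormBC; lra.
exists ((enorm (y - x))^-1 *: (y - x)).
  by rewrite enormZ ger0_norm ?invr_ge0 ?enorm_ge0// mulVf ?gt_eqF.
apply: (le_trans (dist_le _ Ay)).
rewrite scalerA (_ : x + _ - y = (s / enorm (y - x) - 1) *: (y - x)); last first.
  by rewrite scalerBl scale1r; rewrite opprB [x + _]addrC -addrA.
rewrite enormZ ler0_norm; last by rewrite subr_le0 ler_pdivrMr// mul1r enormBC; lra.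
rewrite opprB mulrBl mul1r divfK ?gt_eqF// enormBC; lra.
Qed.

End approach.

Section signed_distance.
Context {R : realType} (n : nat).
Local Notation Rn := 'rV[R]_n.
Variables (D : set Rn) (eps0 : R).
Hypotheses (n0 : (0 < n)%N) (oD : open D) (D0 : D !=set0) (bD : bounded_set D).
Hypotheses (eps00 : 0 < eps0) (C11d : C11 (tube D (2 * eps0)) (sdist D)).
Local Notation d := (sdist D).
Local Notation g i := (partial i (sdist D)).
Implicit Types (x y z u v : Rn).

Lemma bounded_domain_bound : exists2 M : R, 0 < M & forall x, D x -> `|x| <= M.
Proof.
have [M [_ HM]] := bD; exists (Num.max M 0 + 1).
  by rewrite ltr_wpDl// le_max lexx orbT.
move=> x Dx; apply: (HM _ _ x) => //.
by rewrite (@le_lt_trans _ _ (Num.max M 0)) ?le_max ?lexx// ltrDl.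
Qed.

Lemma bounded_setC0 : ~` D !=set0.
Proof.
have [M M0 HM] := bounded_domain_bound.
exists (\row_i (M + 1)) => /HM; apply/negP; rewrite -ltNge.
apply: (@lt_le_trans _ _ (`|(\row_(i < n) (M + 1)) 0 (Ordinal n0)|)); last exact: rV_coord_le_norm.
by rewrite mxE ger0_norm; lra.
Qed.

Lemma sdist_lt0 x : D x <-> d x < 0.
Proof.
split=> [Dx|]; last by apply: contraPP => Dx; rewrite sdistP//; apply/negP; rewrite -leNgt dist_ge0.
rewrite sdistN// oppr_lt0.
have /nbhs_ballP[r /= r0 xrD] : nbhs x D by exact: open_nbhs_nbhs.
apply: (lt_le_trans r0); apply: lb_le_inf.
  by have [y Dy] := bounded_setC0; exists (enorm (x - y)), y.
move=> _ [y Dy <-]; rewrite leNgt; apply/negP => xy; apply: Dy; apply: xrD.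
by rewrite -ball_normE /=; exact: le_lt_trans (norm_le_enorm _) xy.
Qed.

Lemma closed_sdist_le (e : R) : closed [set x | d x <= e].
Proof. by apply: closed_comp (@closed_le R e); move=> x _; exact: continuous_sdist. Qed.

Lemma open_sdist_lt (e : R) : open [set x | d x < e].
Proof. by apply: open_comp (@open_lt R e); move=> x _; exact: continuous_sdist. Qed.

Lemma closure_sublevel (e : R) x : closure (sublevel D e) x -> d x <= e.
Proof.
have cl := @closed_sdist_le e.
have /closure_subset : sublevel D e `<=` [set x | d x <= e] by move=> y /ltW.
by move=> /(_ x) h /h; rewrite -(closure_id _).1.
Qed.

Lemma tube_of_lt (e : R) x : `|d x| < e -> tube D e x.
Proof.
rewrite ltr_norml => /andP[x1 x2]; split=> //.
by move=> /closure_sublevel; rewrite leNgt x1.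
Qed.

Lemma le_of_tube (e : R) x : tube D e x -> - e <= d x < e.
Proof.
move=> [x2 x1]; rewrite x2 andbT leNgt; apply/negP => xe; apply: x1.
exact: subset_closure.
Qed.

Lemma open_tube (e : R) : open (tube D e).
Proof.
rewrite /tube setDE; apply: openI; first exact: open_sdist_lt.
by apply: closed_openC; exact: closed_closure.
Qed.

Lemma sublevel_bound (e : R) : exists2 M : R, 0 < M & forall x, sublevel D e x -> `|x| <= M.
Proof.
have [M M0 HM] := bounded_domain_bound.
exists (M + `|e|) => [|x xe]; first by rewrite ltr_pwDl.
have [Dx|Dx] := pselect (D x); first by rewrite (le_trans (HM _ Dx))// lerDl.
move: xe; rewrite /sublevel /= sdistP// => xe.
have e0 : 0 < e - dist x D by rewrite subr_gt0.
have [y Dy xy] := dist_adherent x D0 e0.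
rewrite -(subrK y x) addrC (le_trans (ler_normD _ _))// lerD//; first exact: HM.
rewrite (le_trans (norm_le_enorm _))// (le_trans (ltW xy))// addrC subrK.
exact: ler_norm.
Qed.

Lemma grad_lip : exists2 L : R, 0 < L & forall i x y,
  tube D (2 * eps0) x -> tube D (2 * eps0) y -> `|g i x - g i y| <= L * `|x - y|.
Proof.
have [_ /lipschitz_bound[L L0 HL]] := C11d; exists L => // i x y tx ty.
apply: le_trans (HL x y tx ty); apply: le_trans (rV_coord_le_norm _ i).
by rewrite !mxE.
Qed.

Lemma differentiable_sdist x : tube D (2 * eps0) x -> differentiable d x.
Proof. by have [dd _] := C11d; exact: dd. Qed.

Lemma derive_sdist x v : tube D (2 * eps0) x -> 'D_v d x = \sum_j g j x * v 0 j.
Proof.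
move=> tx; have dx := differentiable_sdist tx; rewrite deriveE//.
rewrite {1}(row_sum_delta v) linear_sum; apply: eq_bigr => j _.
by rewrite linearZ /= -deriveE// mulrC.
Qed.

Lemma sdist_near x y : `|d y| <= `|d x| + 2 * n%:R * `|y - x|.
Proof.
have := sdist_lip_norm D y x; have := ler_normD (d y - d x) (d x).
by rewrite subrK; lra.
Qed.

(** The hypothesis keeps the whole segment from [x] to [y] inside the tube where d is
    differentiable; the mean value theorem is then applied along it. *)
Lemma sdist_mvt x y : `|d x| + 2 * n%:R * `|y - x| < 2 * eps0 ->
  exists2 z, tube D (2 * eps0) z /\ `|z - x| <= `|y - x| &
    d y - d x = \sum_j g j z * (y 0 j - x 0 j).
Proof.
move=> xy.
have tz (t : R) : 0 <= t <= 1 -> tube D (2 * eps0) (t *: (y - x) + x) /\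
    `|t *: (y - x) + x - x| <= `|y - x|.
  move=> /andP[t0 t1].
  have zx : `|t *: (y - x) + x - x| <= `|y - x|.
    by rewrite addrK normrZ ger0_norm// ler_piMl.
  split=> //; apply: tube_of_lt; apply: le_lt_trans xy.
  apply: (le_trans (sdist_near x _)); rewrite lerD2l ler_wpM2l// mulr_ge0//.
have dseg (t : R) : 0 <= t <= 1 -> is_derive t 1 (fun t : R => d (t *: (y - x) + x))
    (\sum_j g j (t *: (y - x) + x) * (y 0 j - x 0 j)).
  move=> /tz[tt _]; have dz := differentiable_sdist tt.
  have E : (fun h : R => h^-1 *: ((fun t : R => d (t *: (y - x) + x)) (h *: 1 + t) -
      d (t *: (y - x) + x))) =
      (fun h => h^-1 *: ((d \o shift (t *: (y - x) + x)) (h *: (y - x)) - d (t *: (y - x) + x))).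
    apply/funext => h; rewrite /shift /=; congr (_ *: (d _ - _)).
    by rewrite [h *: 1]mulr1 scalerDl addrA.
  have /diff_derivable := dz => /(_ (y - x)) dv.
  apply: DeriveDef; first by rewrite /derivable /shift /= E.
  rewrite /derive /shift /= E -/(derive d (t *: (y - x) + x) (y - x)) derive_sdist//.
  by apply: eq_bigr => j _; rewrite !mxE.
have dseg' (t : R) : t \in `]0, 1[ -> is_derive t 1 (fun t : R => d (t *: (y - x) + x))
    (\sum_j g j (t *: (y - x) + x) * (y 0 j - x 0 j)).
  by rewrite in_itv /= => /andP[t0 t1]; apply: dseg; rewrite !ltW.
have [|c] := MVT_segment ler01 dseg'.
  apply: derivable_within_continuous => t; rewrite in_itv /= => t01.
  by have [] := dseg t t01.
rewrite in_itv /= => c01; rewrite scale1r scale0r add0r subrK subr0 mulr1 => E.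
by exists (c *: (y - x) + x); [exact: tz|].
Qed.

(** Not sharp, but it also covers the points where d = 0. *)
Lemma grad_bound i x : tube D (2 * eps0) x -> `|g i x| <= 2 * n%:R.
Proof.
move=> tx; apply: derive_norm_le; first by apply: diff_derivable; exact: differentiable_sdist.
near=> h; apply: (le_trans (sdist_lip_norm D _ _)); rewrite addrK normrZ.
rewrite ler_wpM2l ?mulr_ge0// ler_piMr//; apply: rV_norm_le => // j.
by rewrite mxE; case: (_ && _); rewrite ?normr1 ?normr0.
Unshelve. all: by end_near. Qed.

(** Near [x] the sign of d does not change, so d is plus or minus the distance to one fixed set and
    is 1-Lipschitz. The derivative in the direction v = grad d is |v|^2, hence |v|^2 <= |v|. *)
Lemma grad_sdist_le1 x : 0 < `|d x| < 2 * eps0 -> \sum_i g i x ^+ 2 <= 1.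
Proof.
move=> /andP[dx0 dx]; have tx := tube_of_lt dx.
pose v : Rn := \row_i g i x.
have vE : \sum_i g i x ^+ 2 = enorm v ^+ 2.
  by rewrite sqr_enorm; apply: eq_bigr => i _; rewrite mxE.
have Dv : 'D_v d x = enorm v ^+ 2.
  by rewrite derive_sdist// -vE; apply: eq_bigr => i _; rewrite mxE expr2.
have : `|'D_v d x| <= enorm v.
  apply: derive_norm_le; first by apply: diff_derivable; exact: differentiable_sdist.
  near=> h.
  have hx : 2 * enorm (h *: v) < `|d x|.
    rewrite enormZ mulrCA.
    rewrite (@le_lt_trans _ _ (`|h| * (2 * enorm v + 1)))//; first by rewrite ler_wpM2l// lerDl.
    rewrite -ltr_pdivlMr; last by rewrite ltr_wpDl// mulr_ge0// enorm_ge0.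
    near: h; apply: dnbhs0_lt; rewrite divr_gt0// ltr_wpDl// mulr_ge0// enorm_ge0//.
  have := sdist_lip D (h *: v + x) x; rewrite addrK => /ler_normlP[dl dr].
  rewrite [_ * `|h|]mulrC -enormZ.
  have [Dx|Dx] := pselect (D x).
    have dx1 : d x < 0 by exact/sdist_lt0.
    have dy : d (h *: v + x) < 0 by move: hx; rewrite ltr0_norm//; lra.
    have Dy : D (h *: v + x) by exact/sdist_lt0.
    rewrite !sdistN// ler_norml.
    have := dist_lip (h *: v + x) x (~` D); have := dist_lip x (h *: v + x) (~` D).
    by rewrite (enormBC x) addrK => *; apply/andP; split; lra.
  have dx1 : 0 <= d x by rewrite sdistP// dist_ge0.
  have dy : 0 < d (h *: v + x) by move: hx (dx0); rewrite ger0_norm//; lra.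
  have Dy : ~ D (h *: v + x) by move=> /sdist_lt0; lra.
  rewrite !sdistP// ler_norml.
  have := dist_lip (h *: v + x) x D; have := dist_lip x (h *: v + x) D.
  by rewrite (enormBC x) addrK => *; apply/andP; split; lra.
rewrite Dv vE ger0_norm ?sqr_ge0//; have := enorm_ge0 v => v0 v2.
by rewrite -(expr1n _ 2) ler_sqr ?nnegrE//; nra.
Unshelve. all: by end_near. Qed.

Lemma sdist_approach x (s : R) : 0 < s < `|d x| ->
  exists2 u, enorm u = 1 & s - s ^+ 2 <= `|d (x + s *: u) - d x|.
Proof.
move=> /andP[s0 sd]; have [Dx|Dx] := pselect (D x).
  have sA : 0 < s < dist x (~` D).
    by rewrite s0/=; move: sd; rewrite sdistN// normrN ger0_norm// dist_ge0.
  have [u u1 us] := dist_approach bounded_setC0 sA; exists u => //.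
  rewrite ler_normr (sdistN Dx) /sdist; have := dist_ge0 (x + s *: u) D.
  by move=> *; apply/orP; left; lra.
have sA : 0 < s < dist x D by rewrite s0/=; move: sd; rewrite sdistP// ger0_norm// dist_ge0.
have [u u1 us] := dist_approach D0 sA; exists u => //.
rewrite ler_normr (sdistP Dx) /sdist; have := dist_ge0 (x + s *: u) (~` D).
by move=> *; apply/orP; right; lra.
Qed.

(** Along a suitable unit vector d changes by at least s - s^2 over a step s, while the mean value
    theorem and the Lipschitz bound on the gradient limit the change to s (|grad d| + n L s).
    Dividing by s and taking s small concludes. *)
Lemma grad_sdist_ge1 x : 0 < `|d x| < 2 * eps0 -> 1 <= enorm (\row_i g i x).
Proof.
move=> /andP[dx0 dx]; have [L L0 HL] := grad_lip; set v : Rn := \row_i _.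
have C0 : 0 < 1 + n%:R * L by rewrite ltr_pwDl// mulr_ge0// ltW.
apply/ler_addgt0Pr => e e0.
(* The three bounds keep the step short of the target set, keep the segment in the tube, and make
   the total error (1 + n L) s smaller than [e]. *)
pose m : R := Num.min (`|d x|) (Num.min ((2 * eps0 - `|d x|) / (2 * n%:R)) (e / (1 + n%:R * L))).
have n0' : 0 < n%:R :> R by rewrite ltr0n.
have m0 : 0 < m by rewrite /m !lt_min dx0 !divr_gt0 ?mulr_gt0 ?subr_gt0.
pose s := m / 2; have s0 : 0 < s by rewrite divr_gt0.
have sm : s < m by rewrite /s; lra.
move: (sm); rewrite {1}/m !lt_min => /and3P[s1 s2 s3].
have [u u1 us] := @sdist_approach x s (introT andP (conj s0 s1)).
have su : `|x + s *: u - x| <= s.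
  by rewrite addrC addKr (le_trans (norm_le_enorm _))// enormZ u1 mulr1 gtr0_norm.
have [|z [tz zx] E] := @sdist_mvt x (x + s *: u).
  rewrite ltr_pdivlMr ?mulr_gt0// in s2.
  by have : 2 * n%:R * `|x + s *: u - x| <= 2 * n%:R * s by [rewrite ler_wpM2l// mulr_ge0|]; lra.
have tx := tube_of_lt dx.
have hE : d (x + s *: u) - d x = s * \sum_j v 0 j * u 0 j +
    s * \sum_j (g j z - g j x) * u 0 j.
  rewrite E !mulr_sumr -big_split /=; apply: eq_bigr => j _; rewrite !mxE.
  by move: (g j z) (g j x) (u 0 j) (x 0 j) => a c p q; ring.
have h1 : `|\sum_j v 0 j * u 0 j| <= enorm v.
  have cs (w : Rn) : \sum_j w 0 j * u 0 j <= enorm w.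
    by have := enorm_CauchySchwarz w u; rewrite u1 mulr1.
  rewrite ler_norml cs andbT lerNl -sumrN -enormN.
  by rewrite (eq_bigr (fun j => (- v) 0 j * u 0 j)) ?cs// => j _; rewrite [(- v) 0 j]mxE mulNr.
have h2 : `|\sum_j (g j z - g j x) * u 0 j| <= n%:R * L * s.
  apply: (le_trans (ler_norm_sum _ _ _)).
  have -> : n%:R * L * s = \sum_(j < n) (L * s) by rewrite sumr_const card_ord -[RHS]mulr_natl mulrA.
  apply: ler_sum => j _; rewrite normrM -[leRHS]mulr1 ler_pM//.
    by apply: (le_trans (HL j z x tz tx)); rewrite ler_wpM2l// ?(ltW L0)// (le_trans zx).
  by rewrite -u1 enorm_coord.
have h3 : s - s ^+ 2 <= s * (enorm v + n%:R * L * s).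
  apply: (le_trans us); rewrite hE -mulrDr normrM gtr0_norm// ler_wpM2l ?(ltW s0)//.
  by apply: (le_trans (ler_normD _ _)); exact: lerD.
have h4 : 1 - s <= enorm v + n%:R * L * s.
  by rewrite -(ler_pM2l s0) mulrBr mulr1 -expr2.
rewrite ltr_pdivlMr// mulrDr mulr1 in s3.
by move: h4 s3; rewrite (mulrC s); lra.
Qed.

Lemma grad_sdist_sq x : 0 < `|d x| < 2 * eps0 -> \sum_i g i x ^+ 2 = 1.
Proof.
move=> dx; apply/eqP; rewrite eq_le grad_sdist_le1//=.
have -> : \sum_i g i x ^+ 2 = enorm (\row_i g i x) ^+ 2.
  by rewrite sqr_enorm; apply: eq_bigr => i _; rewrite mxE.
by rewrite expr_ge1// ?enorm_ge0// grad_sdist_ge1.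
Qed.

(** Here points with d = 0 must be included: such a point is a limit of points of D, and the
    gradient is continuous. The sum of absolute values is used because it directly yields one
    partial derivative of size at least 1/n. *)
Lemma grad_sdist_sum_ge1 x : `|d x| < 2 * eps0 -> 1 <= \sum_i `|g i x|.
Proof.
move=> dx; have key y : 0 < `|d y| < 2 * eps0 -> 1 <= \sum_i `|g i y|.
  move=> dy; apply: (le_trans (grad_sdist_ge1 dy)); apply: (le_trans (enorm_le_sum _)).
  by apply: ler_sum => i _; rewrite mxE.
have [dx0|dx0] := eqVneq (d x) 0; last by apply: key; rewrite normr_gt0 dx0.
have [L L0 HL] := grad_lip; have tx := tube_of_lt dx.
apply/ler_addgt0Pr => e e0.
have n0' : 0 < n%:R :> R by rewrite ltr0n.
pose s := Num.min (eps0 / 2) (e / (n%:R * L)).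
have s0 : 0 < s by rewrite lt_min !divr_gt0 ?mulr_gt0.
have Dx : ~ D x by move=> /sdist_lt0; rewrite dx0 ltxx.
have [y Dy xy] := dist_adherent x D0 s0.
move: xy; rewrite -sdistP// dx0 add0r => xy.
have dy0 : d y < 0 by exact/sdist_lt0.
have dy : 0 < `|d y| < 2 * eps0.
  rewrite normr_gt0 lt_eqF//=; have := sdist_lip D y x; rewrite dx0 subr0 enormBC.
  move: xy; rewrite lt_min => /andP[xy1 _] /le_lt_trans; apply.
  by rewrite ltr_pM2l// (lt_trans xy1)// ltr_pdivrMr// ltr_pMr// ltr1n.
have ty : tube D (2 * eps0) y by apply: tube_of_lt; case/andP: dy.
have := key y dy => k; apply: (le_trans k).
rewrite -lerBlDl -sumrB.
apply: (@le_trans _ _ (\sum_(i < n) (L * s))).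
  apply: ler_sum => i _; apply: (le_trans (lerB_dist _ _)).
  apply: (le_trans (HL i y x ty tx)); rewrite ler_wpM2l ?(ltW L0)//.
  by rewrite (le_trans (norm_le_enorm _))// enormBC ltW.
rewrite sumr_const card_ord -[leLHS]mulr_natl mulrA -ler_pdivlMl ?mulr_gt0//.
by rewrite mulrC ge_min lexx orbT.
Qed.

End signed_distance.

(** * Volume of the tube *)

Section tube_volume.
Context {R : realType} (n : nat).
Local Notation Rn := 'rV[R]_n.
Local Notation mu := (@lebesgue_rV R n).

Lemma lebesgue_rV_cover_le (I : finType) (T : set Rn) (A : I -> set Rn) (c : R) :
  measurable T -> (forall i, measurable (A i)) -> T `<=` \bigcup_i A i ->
  (forall i, (mu (A i) <= c%:E)%E) -> (mu T <= (#|I|%:R * c)%:E)%E.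
Proof.
move=> mT mA TA Ac.
have H (s : seq I) : measurable (\big[setU/set0]_(i <- s) A i) /\
    (mu (\big[setU/set0]_(i <- s) A i) <= ((size s)%:R * c)%:E)%E.
  elim: s => [|i s [ms IH]]; first by rewrite big_nil measure0 mul0r.
  rewrite big_cons; split; first exact: measurableU.
  apply: (le_trans (measureU2 mu (mA i) ms)).
  rewrite /= -nat1r mulrDl mul1r EFinD; apply: leeD => //.
have [mE HE] := H (enum I); rewrite cardE; apply: le_trans HE.
apply: le_measure; rewrite ?inE//; apply: (subset_trans TA).
by rewrite -bigcup_seq => x [i _ Aix]; exists i => //=; rewrite mem_enum.
Qed.

Variables (D : set Rn) (eps0 : R).
Hypotheses (n0 : (0 < n)%N) (oD : open D) (D0 : D !=set0) (bD : bounded_set D).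
Hypotheses (eps00 : 0 < eps0) (C11d : C11 (tube D (2 * eps0)) (sdist D)).
Local Notation d := (sdist D).
Local Notation g i := (partial i (sdist D)).

Lemma measurable_tube (e : R) : measurable (tube D e).
Proof. by apply: open_measurable_rV; exact: open_tube. Qed.

Lemma tube_norm_le (e : R) (x : Rn) : 0 < e -> tube D e x -> `|d x| <= e.
Proof. by move=> e0 /le_of_tube/andP[? ?]; rewrite ler_norml; apply/andP; split=> //; exact: ltW. Qed.

Lemma tube_volume : exists2 C : R, 0 < C & forall e : R, 0 < e <= eps0 ->
  (mu (tube D e) <= (C * e)%:E)%E.
Proof.
have [M M0 HM] := sublevel_bound D0 bD eps0.
have [L L0 HL] := grad_lip C11d.
have n0' : 0 < n%:R :> R by rewrite ltr0n.
(* The side of the cubes does not depend on [e]. The first bound keeps segments between points of a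
   cube that meets the tube inside the larger tube; the second lets each partial derivative vary by
   at most 1/(2n) over a distance 2r. *)
have [r [r0 r1 r2]] : exists r : R,
    [/\ 0 < r, r <= eps0 / (4 * n%:R) & r <= (4 * n%:R * L)^-1].
  exists (Num.min (eps0 / (4 * n%:R)) ((4 * n%:R * L)^-1)).
  by rewrite lt_min divr_gt0 ?invr_gt0 ?mulr_gt0// !ge_min !lexx orbT.
have rn : 2 * n%:R * r <= eps0 / 2.
  by move: r1; rewrite ler_pdivlMr ?mulr_gt0//; lra.
have rL : L * (2 * r) <= (2 * n%:R)^-1.
  move: r2; rewrite -[_^-1]mul1r ler_pdivlMr ?mulr_gt0// => h.
  by rewrite -[_^-1]mul1r ler_pdivlMr ?mulr_gt0//; lra.
pose N := (Num.truncn (2 * M / r)).+1.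
pose cube (f : {ffun 'I_n -> 'I_N}) : set Rn := [set x | forall i,
  (fun i => `[- M + r * (f i)%:R, - M + r * (f i)%:R + r]%classic) i (x 0 i)].
have mcube f : measurable (cube f) by apply: measurable_rV_box => i; exact: measurable_itv.
(* The number of cubes times the section bound per unit of [e]: along a section d changes by at most
   2e and its slope is at least 1/(2n), so the section has diameter at most 4ne. *)
pose C := #|{ffun 'I_n -> 'I_N}|%:R * (2 * (4 * n%:R) * r ^+ n.-1).
have C0 : 0 <= C by rewrite !mulr_ge0// exprn_ge0// ltW.
exists (C + 1); first by rewrite ltr_wpDl.
move=> e /andP[e0 ee]; apply: (@le_trans _ _ (C * e)%:E); last first.
  by rewrite lee_fin ler_wpM2r ?(ltW e0)// lerDl.
have -> : C * e = #|{ffun 'I_n -> 'I_N}|%:R * (2 * (4 * n%:R * e) * r ^+ n.-1).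
  by rewrite /C; ring.
apply: (@lebesgue_rV_cover_le _ _ (fun f => tube D e `&` cube f)) => [||x tx|f].
- exact: measurable_tube.
- by move=> f; apply: measurableI => //; exact: measurable_tube.
- have xM : `|x| <= M.
    by apply: HM; rewrite /sublevel /=; have /andP[_ h] := le_of_tube tx; exact: lt_le_trans ee.
  have xi (i : 'I_n) : 0 <= (x 0 i + M) / r.
    rewrite divr_ge0 ?(ltW r0)//; have := le_trans (rV_coord_le_norm x i) xM.
    by rewrite ler_norml => /andP[? _]; lra.
  have xiN (i : 'I_n) : (Num.truncn ((x 0 i + M) / r)%R < N)%N.
    rewrite ltnS; apply: le_truncn; rewrite ler_pM2r ?invr_gt0//.
    have := le_trans (rV_coord_le_norm x i) xM.
    by rewrite ler_norml => /andP[_ ?]; lra.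
  exists [ffun i => Ordinal (xiN i)] => //; split=> // i.
  rewrite /= ffunE in_itv /=; have /andP[t1 t2] := truncn_itv (xi i).
  rewrite ler_pdivlMr// in t1; rewrite ltr_pdivrMr// -natr1 in t2.
  by apply/andP; split; lra.
have [->|/set0P[x0 [tx0 cx0]]] := eqVneq (tube D e `&` cube f) set0.
  by rewrite measure0 lee_fin !mulr_ge0 ?(ltW e0)// exprn_ge0// ltW.
have dtube x : tube D e x -> `|d x| < 2 * eps0.
  by move=> /(tube_norm_le e0) h; apply: (le_lt_trans h); lra.
have cube_diam x y : cube f x -> cube f y -> `|x - y| <= r.
  move=> cx cy; apply: rV_norm_le => [|i]; first exact: ltW.
  have := cx i; have := cy i; rewrite /= !in_itv /= !mxE => /andP[? ?] /andP[? ?].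
  by rewrite ler_norml; apply/andP; split; lra.
have [j gj] : exists j, n%:R^-1 <= `|g j x0|.
  apply: contrapT => /forallNP H.
  have := grad_sdist_sum_ge1 n0 oD D0 bD eps00 C11d (dtube _ tx0).
  apply/negP; rewrite -ltNge -(mulfV (lt0r_neq0 n0')).
  rewrite [X in _ < X](_ : _ = \sum_(i < n) n%:R^-1); last first.
    by rewrite sumr_const card_ord -[RHS]mulr_natl.
  apply: ltr_sum; last by move=> i _; rewrite ltNge; apply/negP; exact: H.
  by apply/hasP; exists (Ordinal n0); rewrite ?mem_index_enum.
apply: (@lebesgue_rV_section R n j _ (fun i => - M + r * (f i)%:R)).
- exact: ltW.
- by rewrite !mulr_ge0// ltW.
- by apply: measurableI => //; exact: measurable_tube.
- by move=> x [_ cx] i; have := cx i; rewrite /= in_itv.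
move=> x y [tx cx] [ty cy] xy.
have yx : `|y - x| <= r by exact: cube_diam.
have [|z [tz zx] E] := @sdist_mvt R n D eps0 C11d x y.
  have : 2 * n%:R * `|y - x| <= 2 * n%:R * r by rewrite ler_wpM2l// mulr_ge0.
  have := tube_norm_le e0 tx.
  by lra.
(* The direction [j] was chosen at the single point [x0] of the cube; the mean value point [z] is
   within 2r of it, so at least half of the lower bound 1/n survives. *)
have gz : (2 * n%:R)^-1 <= `|g j z|.
  have := HL j x0 z (tube_of_lt (dtube _ tx0)) tz.
  have : `|x0 - z| <= 2 * r.
    rewrite -(subrK x x0) -addrA (le_trans (ler_normD _ _))//.
    have := cube_diam _ _ cx0 cx; have := le_trans zx yx; rewrite distrC; lra.
  move=> h1 h2; have : `|g j x0 - g j z| <= L * (2 * r).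
    by apply: (le_trans h2); rewrite ler_wpM2l// ltW.
  have nE : n%:R^-1 = (2 * n%:R)^-1 + (2 * n%:R)^-1 :> R by field; exact: lt0r_neq0.
  move=> h; rewrite -(lerD2l (2 * n%:R)^-1) -nE; apply: (le_trans gj).
  by rewrite -lerBlDr; apply: (le_trans (lerB_dist _ _)); exact: le_trans h rL.
have : d y - d x = g j z * (y 0 j - x 0 j).
  rewrite E (bigD1 j)//= big1 ?addr0// => i ij.
  by rewrite (xy i ij) subrr mulr0.
move=> /(congr1 Num.norm); rewrite normrM => E2.
have dxy : `|d y - d x| <= 2 * e.
  apply: (le_trans (ler_normB _ _)).
  by rewrite mulr_natl mulr2n; apply: lerD; exact: tube_norm_le.
rewrite distrC.
have : (2 * n%:R)^-1 * `|y 0 j - x 0 j| <= 2 * e.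
  by apply: le_trans dxy; rewrite E2 ler_wpM2r.
by rewrite ler_pdivrMl ?mulr_gt0// (_ : 2 * n%:R * (2 * e) = 4 * n%:R * e)//; ring.
Qed.

(** The zero set lies in every tube, and the volume of the tube is at most a constant times its
    width. *)
Lemma sdist_eq0_null : mu [set x | d x = 0] = 0%E.
Proof.
have [C C0 HC] := tube_volume.
have mZ : measurable [set x | d x = 0].
  rewrite (_ : [set x | d x = 0] = d @^-1` [set 0]); last by apply/seteqP; split.
  apply: closed_measurable_rV; apply: closed_comp; last exact: closed_eq.
  by move=> x _; exact: continuous_sdist.
apply/eqP; rewrite eq_le measure_ge0 andbT; apply/lee_addgt0Pr => e e0.
rewrite add0e; pose s := Num.min eps0 (e / C).
have s0 : 0 < s by rewrite lt_min eps00 divr_gt0.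
apply: (@le_trans _ _ (mu (tube D s))).
  apply: le_measure; rewrite ?inE//; first exact: measurable_tube.
  by move=> x /= dx; apply: tube_of_lt; rewrite dx normr0.
apply: le_trans (HC s _) _; first by rewrite s0 ge_min lexx.
by rewrite lee_fin -ler_pdivlMl// mulrC ge_min lexx orbT.
Qed.

End tube_volume.

(** * Smooth test fields *)

Section mollified_field.
Context {R : realType} (n : nat).
Local Notation Rn := 'rV[R]_n.

Lemma real_mvt (P Q : R -> R) (s t : R) : (forall u : R, is_derive u 1 P (Q u)) ->
  exists2 c, `|c - s| <= `|t - s| & P t - P s = Q c * (t - s).
Proof.
move=> PQ; have cP (a b : R) : {within `[a, b], continuous P}.
  by apply: continuous_subspaceT => u; exact: is_derive_continuous (PQ u).
have [st|ts] := leP s t.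
  have [c] := MVT_segment st (fun u _ => PQ u) (cP s t).
  rewrite in_itv /= => /andP[sc ct] E; exists c => //.
  by rewrite !ger0_norm ?subr_ge0// lerD2r.
have [c] := MVT_segment (ltW ts) (fun u _ => PQ u) (cP t s).
rewrite in_itv /= => /andP[sc ct] E; exists c.
  by rewrite !ler0_norm ?subr_le0// ?(ltW ts)// lerN2 lerD2r.
by rewrite -opprB E; ring.
Qed.

Variables (D : set Rn) (eps0 : R).
Hypotheses (n0 : (0 < n)%N) (oD : open D) (D0 : D !=set0) (bD : bounded_set D).
Hypotheses (eps00 : 0 < eps0) (C11d : C11 (tube D (2 * eps0)) (sdist D)).
Local Notation d := (sdist D).
Local Notation g i := (partial i (sdist D)).

Section profile.
Variables (L : R) (P Q : R -> R) (M : R).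
Hypotheses (L0 : 0 < L) (HL : forall i x y, tube D (2 * eps0) x ->
  tube D (2 * eps0) y -> `|g i x - g i y| <= L * `|x - y|).
Hypotheses (PQ : forall s : R, is_derive s 1 P (Q s))
  (QM : forall s t, `|Q s - Q t| <= M * `|s - t|) (Q0 : Q 0 = 0).
Let F i (x : Rn) := P (d x) * g i x.

Let M0 : 0 <= M.
Proof. by apply: (le_trans (normr_ge0 (Q 1 - Q 0))); have := QM 1 0; rewrite subr0 normr1 mulr1. Qed.

Let Q_le s : `|Q s| <= M * `|s|.
Proof. by have := QM s 0; rewrite Q0 !subr0. Qed.

Section point.
Variables (x y : Rn) (rho : R).
Hypotheses (dx : `|d x| <= eps0) (xy : `|y - x| <= rho) (rhoe : 2 * n%:R * rho < eps0).

Let rho0 : 0 <= rho. Proof. exact: le_trans (normr_ge0 _) xy. Qed.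

Let tx : tube D (2 * eps0) x.
Proof. by apply: tube_of_lt; apply: (le_lt_trans dx); rewrite ltr_pMl// ltr1n. Qed.

Let dxy : `|d y - d x| <= 2 * n%:R * rho.
Proof. by apply: (le_trans (sdist_lip_norm D y x)); rewrite ler_wpM2l// mulr_ge0. Qed.

Let dy : `|d y| <= 2 * eps0.
Proof.
have := ler_normD (d y - d x) (d x); rewrite subrK => /le_trans; apply.
rewrite mulr_natl mulr2n; apply: lerD => //.
by apply: (le_trans dxy); exact: ltW.
Qed.

Let ty : tube D (2 * eps0) y.
Proof.
apply: tube_of_lt; have := ler_normD (d y - d x) (d x); rewrite subrK => /le_lt_trans; apply.
rewrite mulr_natl mulr2n; apply: ltr_leD => //.
exact: le_lt_trans dxy rhoe.
Qed.

Let Pxy : `|P (d y) - P (d x)| <= M * (2 * eps0) * (2 * n%:R * rho).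
Proof.
have [c cx ->] := real_mvt (d x) (d y) PQ.
rewrite normrM ler_pM//; apply: (le_trans (Q_le c)); rewrite ler_wpM2l//.
rewrite -(subrK (d x) c) (le_trans (ler_normD _ _))//.
rewrite mulr_natl mulr2n lerD//; apply: (le_trans cx).
by apply: (le_trans dxy); exact: ltW.
Qed.

Lemma field_variation i : `|F i y - F i x| <=
  (M * (2 * eps0) * (2 * n%:R) * (2 * n%:R) + L * `|P (d x)|) * rho.
Proof.
have -> : F i y - F i x = (P (d y) - P (d x)) * g i y + P (d x) * (g i y - g i x).
  by rewrite /F; move: (P (d y)) (P (d x)) (g i y) (g i x) => a c p q; ring.
rewrite (le_trans (ler_normD _ _))// [leRHS]mulrDl lerD// normrM.
  rewrite (_ : _ * rho = M * (2 * eps0) * (2 * n%:R * rho) * (2 * n%:R)); last by ring.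
  by rewrite ler_pM//; exact: (grad_bound C11d).
rewrite mulrC mulrAC ler_wpM2r//.
by apply: (le_trans (HL i ty tx)); rewrite ler_wpM2l// ltW.
Qed.

(** The linear part omits the term P(d) times the Hessian of d, which need not exist. The Lipschitz
    bound on grad d puts that term into the remainder L rho |P(d x)|; all other errors are of second
    order in rho. *)
Lemma field_taylor i : `|F i y - F i x - \sum_j (Q (d x) * g i x * g j x) * (y 0 j - x 0 j)| <=
  ((2 * n%:R) * (M * (2 * n%:R) ^+ 2 + M * eps0 * (n%:R * L)) +
   M * (2 * eps0) * (2 * n%:R) * L) * rho ^+ 2 + L * rho * `|P (d x)|.
Proof.
pose lin := \sum_j g j x * (y 0 j - x 0 j).
have -> : \sum_j (Q (d x) * g i x * g j x) * (y 0 j - x 0 j) = g i x * (Q (d x) * lin).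
  rewrite /lin !mulr_sumr; apply: eq_bigr => j _.
  by move: (Q (d x)) (g i x) (g j x) (y 0 j - x 0 j) => a p q e; ring.
have h1 : `|d y - d x - lin| <= n%:R * L * rho ^+ 2.
  have [|z [tz zx] ->] := @sdist_mvt R n D eps0 C11d x y.
    rewrite [ltRHS]mulr_natl mulr2n ler_ltD//; apply: le_lt_trans rhoe.
    by rewrite ler_wpM2l// mulr_ge0.
  rewrite /lin -sumrB (le_trans (ler_norm_sum _ _ _))//.
  have -> : n%:R * L * rho ^+ 2 = \sum_(j < n) (L * rho) * rho.
    by rewrite sumr_const card_ord -[RHS]mulr_natl expr2 !mulrA.
  apply: ler_sum => j _; rewrite -mulrBl normrM ler_pM//.
    apply: (le_trans (HL j tz tx)); rewrite ler_wpM2l ?(ltW L0)//.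
    exact: le_trans zx xy.
  by apply: le_trans xy; have := rV_coord_le_norm (y - x) j; rewrite !mxE.
have h2 : `|P (d y) - P (d x) - Q (d x) * (d y - d x)| <= M * (2 * n%:R * rho) ^+ 2.
  have [c cx ->] := real_mvt (d x) (d y) PQ.
  rewrite -mulrBl normrM expr2 mulrA ler_pM//.
  by apply: (le_trans (QM _ _)); rewrite ler_wpM2l// (le_trans cx).
have h3 : `|P (d y) - P (d x) - Q (d x) * lin| <=
    (M * (2 * n%:R) ^+ 2 + M * eps0 * (n%:R * L)) * rho ^+ 2.
  have -> : P (d y) - P (d x) - Q (d x) * lin =
     (P (d y) - P (d x) - Q (d x) * (d y - d x)) + Q (d x) * (d y - d x - lin).
    by rewrite [X in _ = _ + X]mulrBr addrA subrK.
  rewrite (le_trans (ler_normD _ _))// [leRHS]mulrDl lerD//; first by rewrite -mulrA -exprMn.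
  rewrite normrM -[leRHS]mulrA ler_pM//.
  by apply: (le_trans (Q_le _)); rewrite ler_wpM2l.
(* The first two summands are products of first-order quantities or Taylor remainders, hence
   O(rho^2). The last is only O(rho), but it carries the factor P(d x). *)
have -> : F i y - F i x - g i x * (Q (d x) * lin) =
    g i x * (P (d y) - P (d x) - Q (d x) * lin) +
    (P (d y) - P (d x)) * (g i y - g i x) + P (d x) * (g i y - g i x).
  rewrite /F; move: (P (d y)) (P (d x)) (g i y) (g i x) (Q (d x) * lin) => a c p q r.
  by ring.
have gyx : `|g i y - g i x| <= L * rho.
  by apply: (le_trans (HL i ty tx)); rewrite ler_wpM2l// ltW.
rewrite (le_trans (ler_normD _ _))// lerD//; last by rewrite normrM mulrC ler_wpM2r.
rewrite (le_trans (ler_normD _ _))// [leRHS]mulrDl lerD// normrM.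
  by rewrite -mulrA ler_pM//; exact: (grad_bound C11d).
rewrite (_ : _ * rho ^+ 2 = M * (2 * eps0) * (2 * n%:R * rho) * (L * rho)); last by ring.
by rewrite ler_pM.
Qed.

End point.
End profile.

Lemma compact_sdist_le (e : R) : compact [set x | `|d x| <= e].
Proof.
have [Rad R0 HRad] := sublevel_bound D0 bD (e + 1).
apply: bounded_closed_compact.
  exists Rad; split; first exact: num_real.
  move=> M RM x /= dx; apply: le_trans (ltW RM); apply: HRad.
  by rewrite /sublevel /=; apply: (le_lt_trans (ler_norm _)); apply: (le_lt_trans dx); rewrite ltrDl.
rewrite (_ : [set x | _] = d @^-1` [set s | `|s| <= e]); last by apply/seteqP; split.
apply: closed_comp; first by move=> x _; exact: continuous_sdist.
apply: (@closed_comp _ _ (fun s : R => `|s|) [set s | s <= e]); last exact: closed_le.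
by move=> x _; exact: norm_continuous.
Qed.

End mollified_field.

(** The order of quantifiers is the point: [C] is fixed before the width and the profile, while [C']
    may depend on them because it is always multiplied by the mesh [eta]. The strip of half-width
    (e' + e)/2 leaves room for the support to spread under mollification. *)
Lemma test_field_exists {R : realType} (n : nat) (D : set 'rV[R]_n) (eps0 : R) :
  (0 < n)%N -> open D -> D !=set0 -> bounded_set D ->
  0 < eps0 -> C11 (tube D (2 * eps0)) (sdist D) ->
  exists2 C : R, 0 < C &
  forall (e e' : R) (P Q : R -> R) (M : R), 0 < e' < e -> e <= eps0 ->
    (forall s : R, is_derive s 1 P (Q s)) ->
    (forall s t, `|Q s - Q t| <= M * `|s - t|) -> Q 0 = 0 ->
    (forall s, P s != 0 -> `|s| <= e') ->
  exists C' eta1 : R, [/\ 0 <= C', 0 < eta1 &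
    forall eta : R, 0 < eta <= eta1 -> exists T : 'I_n -> 'rV[R]_n -> R,
    [/\ forall i, test_function (tube D e) (T i),
        forall i x, T i x != 0 -> `|sdist D x| <= (e' + e) / 2,
        forall i x, `|sdist D x| <= (e' + e) / 2 ->
          `|T i x| <= C * `|P (sdist D x)| + C' * eta &
        forall x, `|sdist D x| <= (e' + e) / 2 ->
          `|\sum_i partial i (T i) x - Q (sdist D x)| <= C * `|P (sdist D x)| + C' * eta]].
Proof.
move=> n0 oD D0 bD eps00 C11d; pose d := sdist D; pose g i := partial i d.
have [b [b' [B lk]]] := @lattice_kernel_exists R.
have B0 : 0 <= B by have := lk_bound lk 0 0; rewrite big_ord0.
have Bn0 : 0 <= B ^+ n by exact: exprn_ge0.
have [L L0 HL] := grad_lip C11d.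
have [Rad Rad0 HRad] := sublevel_bound D0 bD eps0.
have n0' : 0 < n%:R :> R by rewrite ltr0n.
have C1 : 0 <= 2 * n%:R + 2 * L * B ^+ n by rewrite addr_ge0// !mulr_ge0// ltW.
have C2 : 0 <= n%:R * (B ^+ n * (2 * L)) by rewrite !mulr_ge0// ltW.
(* The first two terms serve the size of the field, by [grad_bound] and [field_variation]; the third
   serves its divergence, as [n] times the first-order remainder of [field_taylor] at rho = 2 eta,
   divided by eta. *)
exists (2 * n%:R + 2 * L * B ^+ n + n%:R * (B ^+ n * (2 * L)) + 1).
  by rewrite ltr_wpDl// addr_ge0.
move=> e e' P Q M /andP[e'0 e'e] ee PQ QM Q0 suppP.
have M0 : 0 <= M.
  by apply: (le_trans (normr_ge0 (Q 1 - Q 0))); have := QM 1 0; rewrite subr0 normr1 mulr1.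
pose A := (2 * n%:R) * (M * (2 * n%:R) ^+ 2 + M * eps0 * (n%:R * L)) +
   M * (2 * eps0) * (2 * n%:R) * L.
pose A' := M * (2 * eps0) * (2 * n%:R) * (2 * n%:R).
have A0 : 0 <= A by rewrite !(addr_ge0, mulr_ge0, exprn_ge0)// ltW.
have A'0 : 0 <= A' by rewrite !mulr_ge0// ltW.
have c1 : 0 <= 2 * B ^+ n * A' by rewrite mulr_ge0// mulr_ge0.
have c2 : 0 <= n%:R * (B ^+ n * (4 * A)) by rewrite mulr_ge0// mulr_ge0// mulr_ge0.
(* Mollification moves the support by at most 2 eta, which changes d by at most 4 n eta; the bound
   on eta makes this at most (e - e')/2. *)
exists (2 * B ^+ n * A' + n%:R * (B ^+ n * (4 * A))), (Num.min 1 ((e - e') / (8 * n%:R))).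
split; first exact: addr_ge0.
  by rewrite lt_min ltr01 divr_gt0 ?subr_gt0// mulr_gt0.
move=> eta /andP[eta0]; rewrite le_min => /andP[eta1].
rewrite ler_pdivlMr ?mulr_gt0// => eta2.
pose F i (x : 'rV[R]_n) := P (d x) * g i x.
(* On the ball of radius [Rad] the shifted coordinates lie between 1 and 2N - 1, so adding 3 stays
   below M' and [in_lattice] holds on the whole strip. *)
pose N := (Num.truncn (Rad / eta + 1)).+1; pose M' := (2 * N + 3)%N.
exists (fun i => mollify b eta N M' (F i)).
have supp i x : mollify b eta N M' (F i) x != 0 -> `|d x| <= (e' + e) / 2.
  move=> /(mollify_supp lk eta0)[y yx]; rewrite /F mulf_eq0 negb_or => /andP[/suppP dy _].
  apply: (le_trans (sdist_near D y x)); rewrite (distrC x y).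
  have : 2 * n%:R * `|y - x| <= 2 * n%:R * (2 * eta) by rewrite ler_wpM2l// mulr_ge0.
  by move: eta2 dy; clear; lra.
have rhoe : 2 * n%:R * (2 * eta) < eps0 by move: eta2 ee e'0 eps00; clear; lra.
have dxe x : `|d x| <= (e' + e) / 2 -> `|d x| <= eps0.
  by move=> /le_trans; apply; move: e'e ee; clear; lra.
have inl x : `|d x| <= (e' + e) / 2 -> in_lattice eta N M' x.
  move=> dx i; have xR : `|x 0 i| <= Rad.
    apply: (le_trans (rV_coord_le_norm x i)); apply: HRad; rewrite /sublevel /=.
    apply: (le_lt_trans (ler_norm _)); apply: (le_lt_trans dx).
    by move: e'e ee; clear; lra.
  have xN : `|x 0 i / eta| <= Rad / eta.
    by rewrite normrM normfV (gtr0_norm eta0) ler_pM2r ?invr_gt0.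
  have RN : Rad / eta + 1 <= N%:R.
    have h0 : 0 <= Rad / eta + 1 by rewrite addr_ge0// divr_ge0// ltW.
    by have /andP[_ h1] := truncn_itv h0; exact: ltW h1.
  have M'E : M'%:R = 2 * N%:R + 3 :> R by rewrite /M' natrD natrM.
  rewrite /lattice_coord M'E; move: xN RN; rewrite ler_norml => /andP[].
  move: (x 0 i / eta) (Rad / eta) (N%:R : R) => a c q; clear => *.
  by split; lra.
split=> [i|//|i x dx|x dx].
- have clK : closure [set x | mollify b eta N M' (F i) x != 0] `<=` [set x | `|d x| <= (e' + e) / 2].
    have clK := compact_closed (@norm_hausdorff _ _) (@compact_sdist_le R n D D0 bD ((e' + e) / 2)).
    rewrite [X in _ `<=` X]((closure_id _).1 clK).
    by apply: closure_subset; exact: supp.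
  split; first exact: (smooth_mollify lk).
    apply: (subclosed_compact _ (@compact_sdist_le R n D D0 bD ((e' + e) / 2))) => //; exact: closed_closure.
  move=> x /clK /= dx; apply: tube_of_lt; apply: (le_lt_trans dx).
  by move: e'e; clear; lra.
- have h := @mollify_approx R n b b' B lk eta N M' eta0 (F i) x _ (inl x dx)
    (fun y yx => @field_variation R n D eps0 eps00 C11d L P Q M L0 HL PQ QM Q0 x y (2 * eta) (dxe x dx) yx rhoe i).
  have hF : `|F i x| <= 2 * n%:R * `|P (d x)|.
    rewrite /F normrM mulrC ler_wpM2r//; apply: (grad_bound C11d).
    by apply: tube_of_lt; apply: (le_lt_trans (dxe x dx)); rewrite ltr_pMl// ltr1n.
  have := ler_normD (mollify b eta N M' (F i) x - F i x) (F i x); rewrite subrK => h3.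
  apply: (le_trans h3); apply: (le_trans (lerD h hF)).
  have p0 : 0 <= `|P (d x)| by [].
  have k1 : 2 * L * B ^+ n * `|P (d x)| * eta <= 2 * L * B ^+ n * `|P (d x)|.
    by rewrite ler_piMr// !mulr_ge0// ltW.
  have k2 : 0 <= n%:R * (B ^+ n * (2 * L)) * `|P (d x)| by rewrite mulr_ge0.
  have k3 : 0 <= n%:R * (B ^+ n * (4 * A)) * eta by rewrite mulr_ge0// ltW.
  rewrite -/A'; move: k1 k2 k3 p0.
  move: (B ^+ n) (`|P (d x)|) (A) (A') => Bn p a a'; clear => *.
  by lra.
have key i : `|partial i (mollify b eta N M' (F i)) x - Q (d x) * g i x ^+ 2| <=
    B ^+ n * (4 * A * eta + 2 * L * `|P (d x)|).
  have h := @mollify_partial_approx R n b b' B lk eta N M' eta0 (F i) x i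
    (fun j => Q (d x) * g i x * g j x) _ (inl x dx)
    (fun y yx => @field_taylor R n D eps0 eps00 C11d L P Q M L0 HL PQ QM Q0 x y (2 * eta) (dxe x dx) yx rhoe i).
  rewrite expr2 mulrA; apply: (le_trans h); rewrite -/A le_eqVlt; apply/orP; left; apply/eqP.
  move: (B ^+ n) (`|P (d x)|) (A) => Bn p a.
  by field; exact: lt0r_neq0.
(* This is where |grad d| = 1 is used; on {d = 0} the factor Q(0) = 0 makes it unnecessary. *)
have QE : Q (d x) = \sum_i Q (d x) * g i x ^+ 2.
  rewrite -mulr_sumr; have [->|dx0] := eqVneq (d x) 0; first by rewrite Q0 mul0r.
  rewrite (grad_sdist_sq n0 oD D0 bD C11d) ?mulr1// normr_gt0 dx0 /=.
  by apply: (le_lt_trans (dxe x dx)); rewrite ltr_pMl// ltr1n.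
rewrite {1}QE -sumrB; apply: (le_trans (ler_norm_sum _ _ _)).
apply: (@le_trans _ _ (\sum_(i < n) B ^+ n * (4 * A * eta + 2 * L * `|P (d x)|))).
  by apply: ler_sum => i _; exact: key.
rewrite sumr_const card_ord -[leLHS]mulr_natl.
have p0 : 0 <= `|P (d x)| by [].
have k1 : 0 <= (2 * n%:R + 2 * L * B ^+ n) * `|P (d x)| by rewrite mulr_ge0.
have k2 : 0 <= 2 * B ^+ n * A' * eta by rewrite mulr_ge0// ltW.
move: k1 k2 p0; move: (B ^+ n) (`|P (d x)|) (A) (A') => Bn p a a'; clear => *.
by lra.
Qed.

(** * Integration by parts in the tube *)

Lemma integral_supported d (T : measurableType d) (R : realType)
    (mu : {measure set T -> \bar R}) (K U : set T) (f : T -> \bar R) :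
  K `<=` U -> (forall x, U x -> ~ K x -> f x = 0%E) ->
  (\int[mu]_(x in U) f x = \int[mu]_(x in K) f x)%E.
Proof.
move=> KU f0; rewrite integral_mkcond [RHS]integral_mkcond; apply: eq_integral => x _.
rewrite !patchE; case: ifPn => [/set_mem Ux|/negP Ux]; last first.
  by case: ifPn => // /set_mem Kx; exfalso; apply: Ux; apply/mem_set; exact: KU.
by case: ifPn => // /negP Kx; apply: f0 => // Kx'; apply: Kx; exact/mem_set.
Qed.

Lemma measurable_enorm d (T : measurableType d) (R : realType) (n : nat) (A : set T)
    (G : T -> 'rV[R]_n) : (forall i, measurable_fun A (fun x => G x 0 i)) ->
  measurable_fun A (fun x => enorm (G x)).
Proof.
move=> mG; apply: (@measurableT_comp _ _ _ _ _ _ (@Num.sqrt R)).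
  by apply: continuous_measurable_fun; exact: sqrt_continuous.
by apply: measurable_sum => i; exact: measurable_funX.
Qed.

(** For the weak formula: [s] will be the tested integrand, whose integral vanishes, so [f] has to
    be small only modulo [s]. *)
Lemma abs_integral_le_mod_null d (T : measurableType d) (R : realType)
    (mu : {measure set T -> \bar R}) (K : set T) (f s b : T -> R) :
  measurable K -> mu.-integrable K (EFin \o f) -> mu.-integrable K (EFin \o s) ->
  measurable_fun K b ->
  (\int[mu]_(x in K) (s x)%:E = 0)%E ->
  (forall x, K x -> `|f x - s x| <= b x) ->
  (`| \int[mu]_(x in K) (f x)%:E | <= \int[mu]_(x in K) (b x)%:E)%E.
Proof.
move=> mK fi si mb s0 fsb.
have fsi : mu.-integrable K (EFin \o (fun x => f x - s x)).
  by have := integrableB mK fi si; apply: eq_integrable.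
have -> : (\int[mu]_(x in K) (f x)%:E = \int[mu]_(x in K) (f x - s x)%:E)%E.
  under [RHS]eq_integral do rewrite EFinB.
  by rewrite (integralB mK fi si) s0 sube0.
apply: (le_trans (le_abse_integral _ mK (measurable_int _ fsi))).
apply: ge0_le_integral => //.
- by apply: measurableT_comp => //; exact: measurable_int fsi.
- exact/measurable_EFinP.
Qed.

Lemma continuous_bounded_on {R : realType} (n : nat) (K : set 'rV[R]_n)
    (f : 'rV[R]_n -> R) : compact K -> continuous f -> [bounded f x | x in K].
Proof.
move=> cK cf; have cfK : compact (f @` K).
  exact: (continuous_compact (continuous_subspaceT cf) cK).
have [M [Mr HM]] := compact_bounded cfK; exists M; split=> // c Mc x Kx.
by apply: (HM c Mc); exists x.
Qed.

(** The function and its weak gradient are only locally integrable in the tube, so all integrals are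
    first reduced to a compact strip [K] containing every support involved. The estimate holds there
    up to an error proportional to the mesh, and the mesh is then sent to 0. *)
Lemma weak_ibp_estimate {R : realType} (n : nat) (D : set 'rV[R]_n) (eps0 : R) :
  (0 < n)%N -> open D -> D !=set0 -> bounded_set D ->
  0 < eps0 -> C11 (tube D (2 * eps0)) (sdist D) ->
  exists2 C : R, 0 < C &
  forall (e e' : R) (P Q : R -> R) (M : R) (h : 'rV[R]_n -> R)
    (G : 'rV[R]_n -> 'rV[R]_n), 0 < e' < e -> e <= eps0 ->
    (forall s : R, is_derive s 1 P (Q s)) ->
    (forall s t, `|Q s - Q t| <= M * `|s - t|) -> Q 0 = 0 ->
    (forall s, P s != 0 -> `|s| <= e') ->
    is_weak_grad (tube D e) h G ->
  (`| \int[lebesgue_rV n]_(x in tube D e) (h x * Q (sdist D x))%:E | <=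
   C%:E * \int[lebesgue_rV n]_(x in tube D e)
     (`|P (sdist D x)| * (`|h x| + enorm (G x)))%:E)%E.
Proof.
move=> n0 oD D0 bD eps00 C11d.
have [C C0 HC] := test_field_exists n0 oD D0 bD eps00 C11d.
have n0' : 0 < n%:R :> R by rewrite ltr0n.
exists (n%:R * C); first exact: mulr_gt0.
move=> e e' P Q M h G e'e ee PQ QM Q0 suppP wG.
have [C' [eta1 [C'0 eta10 HT]]] := HC e e' P Q M e'e ee PQ QM Q0 suppP.
have /andP[e'0 e'lt] := e'e.
set e1 := (e' + e) / 2 in HT.
have e1e : e1 < e by rewrite /e1; lra.
have e'e1 : e' < e1 by rewrite /e1; lra.
clearbody e1.
pose K := [set x | `|sdist D x| <= e1]; pose U := tube D e.
pose mu := @lebesgue_rV R n.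
have cK : compact K by exact: compact_sdist_le.
have KU : K `<=` U by move=> x /= dx; apply: tube_of_lt; exact: le_lt_trans e1e.
have mK : measurable K by apply: closed_measurable_rV; exact: compact_closed.
have [[mh hi] Gi weak] := wG.
have hK : mu.-integrable K (EFin \o h) by exact: hi.
have GK i : mu.-integrable K (fun x => (G x 0 i)%:E) by have [_] := Gi i; exact.
have mhK : measurable_fun K h by exact/measurable_EFinP/measurable_int/hK.
have mGK i : measurable_fun K (fun x => G x 0 i).
  by apply/measurable_EFinP; exact: measurable_int (GK i).
have meG : measurable_fun K (fun x => enorm (G x)) by exact: measurable_enorm.
have cP : continuous P by move=> s; exact: is_derive_continuous (PQ s).
have cQ : continuous Q.
  move=> s; apply/cvgrPdist_le => eps eps0'.
  have M0 : 0 <= M.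
    by apply: (le_trans (normr_ge0 (Q 1 - Q 0))); have := QM 1 0; rewrite subr0 normr1 mulr1.
  near=> t; apply: (le_trans (QM _ _)).
  apply: (@le_trans _ _ ((M + 1) * `|s - t|)); first by rewrite ler_wpM2r// lerDl.
  rewrite -ler_pdivlMl ?ltr_wpDl//; near: t; apply: cvgr_dist_le; first exact: cvg_id.
  by rewrite mulr_gt0// invr_gt0 ltr_wpDl.
have cd := @continuous_sdist R n D.
have cPd : continuous (fun x => P (sdist D x)) by move=> x; apply: continuous_comp; [exact: cd|exact: cP].
have cQd : continuous (fun x => Q (sdist D x)) by move=> x; apply: continuous_comp; [exact: cd|exact: cQ].
have mc (f : 'rV[R]_n -> R) : continuous f -> measurable_fun K f.
  exact: continuous_measurable_rV.
have Mc (f k : 'rV[R]_n -> R) : mu.-integrable K (EFin \o f) -> continuous k ->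
    mu.-integrable K (EFin \o (fun x => f x * k x)).
  move=> fi ck; have := integrableMl mK fi (mc _ ck) (continuous_bounded_on cK ck).
  by apply: eq_integrable.
pose w x := `|h x| + enorm (G x).
have w0 x : 0 <= w x by rewrite addr_ge0// enorm_ge0.
have mw : measurable_fun K w.
  by apply: measurable_funD => //; exact: measurableT_comp.
have Wfin : (\int[mu]_(x in K) (w x)%:E < +oo)%E.
  have wi : mu.-integrable K (fun x => (`|h x|)%:E + \sum_i `|(G x 0 i)%:E|)%E.
    apply: integrableD => //; first exact: (integrable_abse hK).
    apply: integrable_sum => // i _; exact: (integrable_abse (GK i)).
  apply: le_lt_trans (integrable_lty _ wi) => //; apply: ge0_le_integral => //.
  - by move=> x _; rewrite lee_fin.
  - exact/measurable_EFinP.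
  - exact: measurable_int wi.
  - move=> x _; rewrite /w sumEFin -EFinD lee_fin lerD2l; exact: enorm_le_sum.
have W0 : (0 <= \int[mu]_(x in K) (w x)%:E)%E.
  by apply: integral_ge0 => x _; rewrite lee_fin.
have Qsupp s : e1 < `|s| -> Q s = 0.
  move=> es; rewrite -(@derive_val _ _ _ _ _ _ _ (PQ s)).
  apply: (@derive_val _ _ _ _ _ _ _ (@near_eq_is_derive _ _ _ (fun=> 0) _ _ _ _ _ _)).
  have es' : e' < `|s| by exact: lt_trans es.
  near=> t; apply/esym/eqP; apply: contraT => /suppP; rewrite leNgt; suff -> : e' < `|t| by [].
  by near: t; apply: (cvgr_gt (`|s|)) => //; exact: norm_continuous.
rewrite (@integral_supported _ _ _ _ K U) => //; last first.
  by move=> x Ux /negP; rewrite -ltNge => /Qsupp ->; rewrite mulr0.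
rewrite [X in (_ <= _ * X)%E](@integral_supported _ _ _ _ K U) => //; last first.
  move=> x Ux /negP; rewrite -ltNge => dx; rewrite (_ : P _ = 0) ?normr0 ?mul0r//.
  by apply/eqP; apply: contraT => /suppP; rewrite leNgt (lt_trans e'e1 dx).
have main eta : 0 < eta <= eta1 ->
    (`| \int[mu]_(x in K) (h x * Q (sdist D x))%:E | <=
     (n%:R * C)%:E * \int[mu]_(x in K) (`|P (sdist D x)| * w x)%:E +
     (n%:R * C' * eta)%:E * \int[mu]_(x in K) (w x)%:E)%E.
  move=> etaI; have /andP[eta0 _] := etaI.
  have [T [tT suppT Tle dTle]] := HT eta etaI.
  have cT i : continuous (T i) by have [sT _ _] := tT i; exact: (sT 0%N).
  have cdT i : continuous (partial i (T i)) by have [sT _ _] := tT i; have [_ H] : Ck 1 (T i) := sT 1%N; exact: H.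
  have Tz i x : ~ K x -> T i x = 0.
    by move=> Kx; apply/eqP; apply: contraT => /suppT.
  have dTz i x : ~ K x -> partial i (T i) x = 0.
    move=> Kx; rewrite /partial (@near_eq_derive _ _ _ (T i) (fun=> 0)) ?derive_cst//.
    have : nbhs x (~` K) by apply: open_nbhs_nbhs; split => //; apply: closed_openC; exact: compact_closed.
    by apply: filterS => y; exact: Tz.
  (* The sum over [i] of the weak formulas tested against [T i], so its integral is 0. Subtracting
     it from h Q(d) leaves h times a small divergence error, and the gradient times the small
     field. *)
  pose s x := \sum_i (h x * partial i (T i) x + G x 0 i * T i x).
  have si : mu.-integrable K (EFin \o s).
    have : mu.-integrable K (fun x => \sum_i
        (h x * partial i (T i) x + G x 0 i * T i x)%:E)%E.
      apply: integrable_sum => // i _.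
      have := integrableD mK (Mc _ _ hK (cdT i)) (Mc _ _ (GK i) (cT i)).
      by apply: eq_integrable.
    by apply: eq_integrable => // x _; rewrite /= sumEFin.
  have s0 : (\int[mu]_(x in K) (s x)%:E = 0)%E.
    under eq_integral do rewrite /s -sumEFin.
    rewrite integral_sum//; last first.
      move=> i; have := integrableD mK (Mc _ _ hK (cdT i)) (Mc _ _ (GK i) (cT i)).
      by apply: eq_integrable.
    rewrite big1// => i _; under eq_integral do rewrite EFinD.
    rewrite (integralD mK (Mc _ _ hK (cdT i)) (Mc _ _ (GK i) (cT i))) /=.
    have := weak (T i) i (tT i).
    rewrite (@integral_supported _ _ _ _ K U) => //; last first.
      by move=> x _ Kx; rewrite dTz// mulr0.
    rewrite [X in (_ = - X)%E](@integral_supported _ _ _ _ K U) => //; last first.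
      by move=> x _ Kx; rewrite Tz// mulr0.
    move=> ->; rewrite addeC subee//.
    exact: integrable_fin_num (Mc _ _ (GK i) (cT i)).
  pose bd x := n%:R * C * (`|P (sdist D x)| * w x) + n%:R * C' * eta * w x.
  have mPw : measurable_fun K (fun x => `|P (sdist D x)| * w x).
    apply: measurable_funM => //; apply: measurableT_comp => //; exact: mc.
  have mbd : measurable_fun K bd.
    by apply: measurable_funD; apply: measurable_funM.
  apply: le_trans (abs_integral_le_mod_null mK (Mc _ _ hK cQd) si mbd s0 _) _.
    move=> x Kx.
    have -> : h x * Q (sdist D x) - s x = h x * (Q (sdist D x) - \sum_i partial i (T i) x)
        - \sum_i G x 0 i * T i x.
      by rewrite /s big_split /= -mulr_sumr mulrBr opprD addrA.
    pose m := C * `|P (sdist D x)| + C' * eta.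
    have m0 : 0 <= m by rewrite addr_ge0// mulr_ge0// ltW.
    have h1 : `|h x * (Q (sdist D x) - \sum_i partial i (T i) x)| <= `|h x| * m.
      by rewrite normrM ler_wpM2l// distrC; exact: dTle.
    have h2 : `|\sum_i G x 0 i * T i x| <= n%:R * enorm (G x) * m.
      apply: (le_trans (ler_norm_sum _ _ _)).
      have -> : n%:R * enorm (G x) * m = \sum_(i < n) enorm (G x) * m.
        by rewrite sumr_const card_ord -[RHS]mulr_natl mulrA.
      apply: ler_sum => i _; rewrite normrM ler_pM//; first exact: enorm_coord.
      exact: Tle.
    have h3 : `|h x| * m <= n%:R * `|h x| * m.
      by rewrite ler_wpM2r// ler_peMl// ler1n.
    apply: (le_trans (ler_normB _ _)); apply: (le_trans (lerD h1 h2)).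
    apply: (@le_trans _ _ (n%:R * w x * m)).
      have -> : n%:R * w x * m = n%:R * `|h x| * m + n%:R * enorm (G x) * m.
        by rewrite -mulrDl -mulrDr.
      by rewrite lerD2r.
    rewrite /bd /m; move: (`|P _|) (w x) => p v; clear.
    by rewrite le_eqVlt; apply/orP; left; apply/eqP; ring.
  have nC : 0 <= n%:R * C by rewrite mulr_ge0// ltW.
  have nC' : 0 <= n%:R * C' * eta by rewrite !mulr_ge0// ltW.
  rewrite (eq_integral (fun x => ((n%:R * C)%:E * (`|P (sdist D x)| * w x)%:E +
    (n%:R * C' * eta)%:E * (w x)%:E)%E)); last by move=> x _; rewrite -!EFinM -EFinD.
  have mPw' : measurable_fun K (fun x => (`|P (sdist D x)| * w x)%:E) by exact/measurable_EFinP.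
  have mw' : measurable_fun K (fun x => (w x)%:E) by exact/measurable_EFinP.
  have Pw0 x : K x -> (0 <= (`|P (sdist D x)| * w x)%:E)%E by move=> _; rewrite lee_fin mulr_ge0.
  have w0' x : K x -> (0 <= (w x)%:E)%E by move=> _; rewrite lee_fin.
  rewrite ge0_integralD//; last 4 first.
  - by move=> x Kx; rewrite mule_ge0//; exact: Pw0.
  - exact: measurable_funeM.
  - by move=> x Kx; rewrite mule_ge0//; exact: w0'.
  - exact: measurable_funeM.
  by rewrite !ge0_integralZl.
have [W WE] : exists W : R, (\int[mu]_(x in K) (w x)%:E = W%:E)%E.
  exists (fine (\int[mu]_(x in K) (w x)%:E)%E); rewrite fineK//.
  by rewrite ge0_fin_numE.
rewrite WE lee_fin in W0.
apply/lee_addgt0Pr => eps eps0'.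
pose c := n%:R * C' * W.
have c0 : 0 <= c by rewrite !mulr_ge0.
(* This makes the mesh error c eta at most eps; the summand 1 guards against c = 0. *)
pose eta := Num.min eta1 (eps / (c + 1)).
have eta0 : 0 < eta by rewrite lt_min eta10 divr_gt0// ltr_wpDl.
apply: (le_trans (main eta _)); first by rewrite eta0 ge_min lexx.
rewrite leeD2l// WE -EFinM lee_fin mulrAC -/c.
have : eta <= eps / (c + 1) by rewrite ge_min lexx orbT.
rewrite ler_pdivlMr ?ltr_wpDl// => h1.
apply: le_trans h1; rewrite mulrC ler_wpM2l ?(ltW eta0)// lerDl//.
Unshelve. all: by end_near. Qed.

(** * The transition profile *)

Section transition_profile.
Context {R : realType}.

Definition lip (f : R -> R) :=
  exists2 M : R, 0 <= M & forall s t, `|f s - f t| <= M * `|s - t|.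

Lemma lip_max (f g : R -> R) : lip f -> lip g -> lip (fun s => Num.max (f s) (g s)).
Proof.
move=> [M M0 fM] [K K0 gK]; exists (M + K); first exact: addr_ge0.
move=> s t; rewrite mulrDl; have := lerD (fM s t) (gK s t); apply: le_trans.
move: (f s) (f t) (g s) (g t) => a b c e; clear.
have := ler_norm (a - b); have := ler_norm (c - e); have := ler_norm (b - a); have := ler_norm (e - c).
rewrite (distrC b) (distrC e); have := normr_ge0 (a - b); have := normr_ge0 (c - e).
move: (`|a - b|) (`|c - e|) => p q *; rewrite ler_norml.
by case: (leP a c) => ?; case: (leP b e) => ?; apply/andP; split; lra.
Qed.

Lemma lip_opp (f : R -> R) : lip f -> lip (fun s => - f s).
Proof. by move=> [M M0 fM]; exists M => // s t; rewrite -opprD normrN. Qed.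

Lemma lip_min (f g : R -> R) : lip f -> lip g -> lip (fun s => Num.min (f s) (g s)).
Proof.
move=> lf lg; rewrite (_ : (fun s => _) = (fun s => - Num.max (- f s) (- g s))).
  by apply: lip_opp; apply: lip_max; exact: lip_opp.
by apply/funext => s; rewrite -oppr_min opprK.
Qed.

Lemma lip_continuous (f : R -> R) : lip f -> continuous f.
Proof.
move=> [M M0 fM] s; apply/cvgrPdist_le => e e0; near=> t; apply: (le_trans (fM _ _)).
apply: (@le_trans _ _ ((M + 1) * `|s - t|)); first by rewrite ler_wpM2r// lerDl.
rewrite -ler_pdivlMl ?ltr_wpDl//; near: t; apply: cvgr_dist_le; first exact: cvg_id.
by rewrite mulr_gt0// invr_gt0 ltr_wpDl.
Unshelve. all: by end_near. Qed.

Lemma antiderivative_exists (Q : R -> R) (a : R) : continuous Q ->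
  (forall s, s <= a -> Q s = 0) ->
  exists2 P : R -> R, (forall s : R, is_derive s 1 P (Q s)) & forall s, s <= a -> P s = 0.
Proof.
move=> cQ Q0.
(* Starting at a - 1, where [Q] already vanishes, makes [a] an interior point at which the
   fundamental theorem of calculus applies. *)
pose P (x : R) := (\int[lebesgue_measure]_(t in `[a - 1, x]%classic) Q t)%R.
have P0 s : s <= a -> P s = 0.
  move=> sa; rewrite /P /Rintegral integral0_eq//= => t; rewrite /= in_itv /= => /andP[_ ts].
  by rewrite Q0// (le_trans ts).
exists P => // s; have [sa|sa] := ltP s a.
  rewrite Q0 ?ltW//; apply: (@near_eq_is_derive _ _ _ (fun=> 0)) => //.
  by near=> t; rewrite P0// ltW//; near: t; exact: lt_nbhsl.
have sE : s < s + 1 by rewrite ltrDl.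
have as1 : a - 1 < s by lra.
have Qi : lebesgue_measure.-integrable `[a - 1, s + 1]%classic (EFin \o Q).
  apply: continuous_compact_integrable; first exact: segment_compact.
  exact: continuous_subspaceT.
have [dP PE] := continuous_FTC1_closed sE Qi as1 (cQ s).
by apply: DeriveDef; [exact: dP|rewrite -PE derive1E].
Unshelve. all: by end_near. Qed.

Variables (S : R -> R).
Hypothesis hS : condS1 S.

Lemma condS1_lip : lip S.
Proof.
have [/lipschitz_bound[L L0 HL] _ _ _] := hS; exists L; first exact: ltW.
by move=> s t; exact: HL.
Qed.

Lemma condS1_odd t : S (- t) = - S t.
Proof. by have [_ _ _ ->] := hS. Qed.

Lemma condS1_ge1 t : 1 <= t -> S t = 1.
Proof.
move=> t1; have t0 : 0 < t by exact: lt_le_trans t1.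
by have [_ h _ _] := hS; rewrite h gtr0_norm// divff// gt_eqF.
Qed.

Lemma condS1_leN1 t : t <= -1 -> S t = -1.
Proof. by move=> t1; rewrite -(opprK t) condS1_odd condS1_ge1//; lra. Qed.

Lemma condS1_nondecreasing s t : s <= t -> S s <= S t.
Proof.
have cS := lip_continuous condS1_lip.
have key (u v : R) : -1 <= u -> u <= v -> v <= 1 -> S u <= S v.
  move=> u1 uv v1; have [_ _ dS _] := hS.
  have abs1 (x : R) : x \in `]-1, 1[ -> `|x| < 1.
    by rewrite in_itv /= ltr_norml.
  apply: (@ger0_derive1_le_cc R S (-1) 1) => //.
  - by move=> x /abs1/dS[].
  - by move=> x /abs1/dS[_ /ltW].
  - exact: continuous_subspaceT.
  - by rewrite in_itv /= u1 (le_trans uv).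
  - by rewrite in_itv /= v1 (le_trans u1).
have SN1 : S (-1) = -1 by rewrite condS1_leN1.
have S1 : S 1 = 1 by rewrite condS1_ge1.
move=> st; have [s1|s1] := leP s (-1).
  rewrite (condS1_leN1 s1); have [t1|t1] := leP t (-1); first by rewrite (condS1_leN1 t1).
  have [t2|t2] := leP 1 t; first by rewrite (condS1_ge1 t2); lra.
  by rewrite -[leLHS]SN1; apply: key; [exact: lexx|exact: ltW|exact: ltW].
have [t2|t2] := leP 1 t; last by apply: key; [exact: ltW|exact: st|exact: ltW].
rewrite (condS1_ge1 t2); have [s2|s2] := leP 1 s; first by rewrite (condS1_ge1 s2).
by rewrite -[leRHS]S1; apply: key; [exact: ltW|exact: ltW|exact: lexx].
Qed.

Lemma condS1_bound t : -1 <= S t <= 1.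
Proof.
have h1 : S (Num.min t (-1)) <= S t by apply: condS1_nondecreasing; rewrite ge_min lexx.
have h2 : S t <= S (Num.max t 1) by apply: condS1_nondecreasing; rewrite le_max lexx.
rewrite (condS1_leN1 (t := Num.min t (-1))) ?ge_min ?lexx ?orbT// in h1.
rewrite (condS1_ge1 (t := Num.max t 1)) ?le_max ?lexx ?orbT// in h2.
by rewrite h1 h2.
Qed.

Lemma condS1_0 : S 0 = 0.
Proof. by have := condS1_odd 0; rewrite oppr0; lra. Qed.

(** The absolute value of omega - 1_D at d = eps u, for u different from 0; it is the same on both
    sides of the boundary because [S] is odd. *)
Let sigma (u : R) := (1 + S (- `|u|)) / 2.

Let sigma_ge0 u : 0 <= sigma u.
Proof. by rewrite /sigma; have /andP[? _] := condS1_bound (- `|u|); lra. Qed.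

Let sigma_le u : sigma u <= 2^-1.
Proof.
rewrite /sigma; have : S (- `|u|) <= S 0 by apply: condS1_nondecreasing; rewrite oppr_le0.
by rewrite condS1_0; lra.
Qed.

(** Monotonicity of [S]. This turns every bound by the defect into a bound by the weight, both for
    the primitive and for the majorant in dominated convergence. *)
Let sigma_le_omega u : sigma u <= (1 + S (- u)) / 2.
Proof.
rewrite /sigma; have : S (- `|u|) <= S (- u).
  by apply: condS1_nondecreasing; rewrite lerN2 ler_norm.
by lra.
Qed.

(* [Q] approximates [omega - 1_D] as a function of the signed distance; it
   is truncated to be Lipschitz and supported inside ]-e, e[, and [P] is its
   even primitive. *)
Lemma transition_profile_exists (e delta : R) : 0 < e -> 0 < delta ->
  exists (e' M : R) (P Q : R -> R),
  [/\ 0 < e' < e, (forall s : R, is_derive s 1 P (Q s)) /\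
      (forall s t, `|Q s - Q t| <= M * `|s - t|), Q 0 = 0,
      (forall s, P s != 0 -> `|s| <= e') /\
      (forall s, `|P s| <= e * ((1 + S (- s / e)) / 2)) &
      (forall s, `|Q s| <= (1 + S (- s / e)) / 2) /\
      (forall s, delta * e <= `|s| ->
        `|Q s - ((1 + S (- s / e)) / 2 - (s < 0)%R%:R)| <= delta)].
Proof.
move=> e0 delta0.
(* Lowering [sigma] by delta makes the profile vanish before |u| reaches 1. Clamping u/delta to
   [-m, m] then replaces the jump at 0 by a steep ramp and gives exactly m with the sign of u once
   |u| >= delta. *)
pose m (u : R) := Num.max 0 (sigma u - delta).
pose q (u : R) := Num.max (- m u) (Num.min (m u) (u / delta)).
have m0 u : 0 <= m u by rewrite le_max lexx.
have mle u : m u <= sigma u.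
  by rewrite ge_max sigma_ge0 lerBlDr lerDl ltW.
have qm u : `|q u| <= m u.
  rewrite ler_norml /q le_max lexx /= ge_max ge_min lexx /= andbT.
  by apply: le_trans (m0 u); rewrite oppr_le0.
have mN u : m (- u) = m u by rewrite /m /sigma normrN.
have qN u : q (- u) = - q u.
  rewrite /q mN; have := m0 u; move: (m u) => a a0; rewrite mulNr; move: (u / delta) => b.
  have maxaa : Num.max (- a) a = a by apply: max_r; lra.
  have [ab|ab] := leP a b.
    have -> : Num.min a (- b) = - b by apply: min_r; lra.
    by rewrite maxaa; apply: max_l; lra.
  have [ab'|ab'] := leP (- a) b.
    have -> : Num.min a (- b) = - b by apply: min_r; lra.
    by apply: max_r; lra.
  have -> : Num.min a (- b) = a by apply: min_l; lra.
  by rewrite maxaa opprK.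
have sigmaN1 u : 1 <= `|u| -> sigma u = 0.
  by move=> u1; rewrite /sigma condS1_leN1 ?subrr ?mul0r// lerN2.
have [LS LS0 HS] := condS1_lip.
have lsig s t : `|sigma s - sigma t| <= LS / 2 * `|s - t|.
  rewrite /sigma -mulrBl opprD addrACA subrr add0r normrM (@ger0_norm _ 2^-1)//.
  rewrite mulrAC ler_wpM2r//; apply: (le_trans (HS _ _)); rewrite ler_wpM2l//.
  by rewrite -opprD normrN ler_dist_dist.
have lq : lip q.
  have lm : lip m.
    apply: lip_max; first by exists 0 => // s t; rewrite subrr normr0 mul0r.
    exists (LS / 2); first by rewrite divr_ge0.
    by move=> s t; rewrite opprB addrA subrK.
  apply: lip_max; first exact: lip_opp.
  apply: lip_min => //; exists delta^-1; first by rewrite invr_ge0 ltW.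
  by move=> s t; rewrite -mulrBl normrM mulrC ger0_norm// invr_ge0 ltW.
(* As [sigma] is Lipschitz and vanishes at 1, it is at most delta within kappa of 1, where [q] is
   therefore 0. The bound 1/2 keeps [e'] positive. *)
pose kappa := Num.min 2^-1 (delta / (LS + 1)).
have kappa0 : 0 < kappa by rewrite lt_min invr_gt0 ltr0n divr_gt0// ltr_wpDl.
have kappa1 : kappa <= 2^-1 by rewrite ge_min lexx.
have kappa2 : LS * kappa <= delta.
  apply: (@le_trans _ _ ((LS + 1) * kappa)); first by rewrite ler_wpM2r ?(ltW kappa0)// lerDl.
  by rewrite mulrC -ler_pdivlMr ?ltr_wpDl// ge_min lexx orbT.
have q0 u : 1 - kappa <= `|u| -> q u = 0.
  move=> u1; suff mu0 : m u = 0 by apply/eqP; rewrite -normr_le0 -mu0.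
  apply/eqP; rewrite eq_le m0 andbT ge_max lexx /= subr_le0.
  have [u2|u2] := leP 1 `|u|; first by rewrite sigmaN1// ltW.
  have -> : sigma u = sigma `|u| - sigma 1 by rewrite (sigmaN1 1) ?normr1// subr0 /sigma normr_id.
  apply: (le_trans (ler_norm _)); apply: (le_trans (lsig _ _)); apply: le_trans kappa2.
  by rewrite -mulrA ler_wpM2l// ler0_norm; lra.
pose e' := e * (1 - kappa).
have e'0 : 0 < e' by rewrite mulr_gt0//; lra.
have e'e : e' < e by rewrite /e' gtr_pMr//; lra.
pose Q (s : R) := q (s / e).
have Q0 s : e' <= `|s| -> Q s = 0.
  by move=> es; apply: q0; rewrite normrM normfV (gtr0_norm e0) ler_pdivlMr// mulrC.
have [M M0 HM] := lq.
have QM s t : `|Q s - Q t| <= M / e * `|s - t|.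
  apply: (le_trans (HM _ _)); rewrite -mulrBl normrM normfV (gtr0_norm e0).
  by rewrite mulrA mulrAC.
have QN s : Q (- s) = - Q s by rewrite /Q mulNr qN.
have Qz : Q 0 = 0 by have := QN 0; rewrite oppr0; lra.
have Qsig s : `|Q s| <= sigma (s / e) by exact: le_trans (qm _) (mle _).
have cQ : continuous Q.
  by apply: lip_continuous; exists (M / e) => //; rewrite divr_ge0// ltW.
have [P PQ P0] : exists2 P : R -> R, (forall s : R, is_derive s 1 P (Q s)) &
    forall s, s <= - e' -> P s = 0.
  apply: antiderivative_exists => // s se; apply: Q0.
  by rewrite ler0_norm; lra.
have dN (s : R) : is_derive s 1 (fun s : R => P (- s)) (- Q (- s)).
  have dn : is_derive s 1 (fun s : R => - s) (-1).
    exact: (is_deriveN (is_derive_id s 1)).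
  have := @is_derive1_comp R P (fun s => - s) s _ _ (PQ (- s)) dn.
  by rewrite mulrN1.
(* [Q] is odd, so the derivative of P(-s) - P(s) vanishes. Evenness carries both the vanishing and
   the size of [P] from the left half-line to the right one. *)
have PN s : P (- s) = P s.
  have dE (t : R) : is_derive t 1 (fun s : R => P (- s) - P s) 0.
    by apply: is_derive_eq (is_deriveB (dN t) (PQ t)) _; rewrite QN opprK subrr.
  have := is_derive_0_is_cst s 0 dE; rewrite oppr0 subrr => /eqP.
  by rewrite subr_eq0 => /eqP.
have suppP s : P s != 0 -> `|s| <= e'.
  apply: contraNT; rewrite -ltNge => es; have [s0|s0] := leP 0 s.
    by rewrite -PN P0//; rewrite ger0_norm// in es; rewrite lerN2 ltW.
  by rewrite P0//; rewrite ltr0_norm// in es; lra.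
(* [P] vanishes at -e, so P s is a value Q c with c between -e and s, times a length at most [e].
   Since [sigma] is nondecreasing on the negative half-line, |Q c| <= sigma (s / e). The factor [e]
   is the first power of eps in the theorem. *)
have Psig_neg s : s <= 0 -> `|P s| <= e * sigma (s / e).
  move=> s0; have [se|se] := leP s (- e).
    rewrite P0 ?normr0; last by lra.
    by rewrite mulr_ge0 ?sigma_ge0// ltW.
  have [c cs E] := MVT_segment (ltW se) (fun u _ => PQ u)
    (continuous_subspaceT (fun u => is_derive_continuous (PQ u))).
  move: cs; rewrite in_itv /= => /andP[c1 c2].
  rewrite (P0 (- e)) ?subr0 in E; last by lra.
  rewrite E normrM mulrC ler_pM//; first by rewrite ger0_norm; lra.
  apply: (le_trans (Qsig c)); rewrite /sigma ler_pM2r ?invr_gt0// lerD2l.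
  apply: condS1_nondecreasing; rewrite lerN2 !normrM ler_pM2r; last by rewrite normr_gt0 invr_eq0 gt_eqF.
  by rewrite !ler0_norm; lra.
have Psig s : `|P s| <= e * sigma (s / e).
  have [s0|s0] := leP s 0; first exact: Psig_neg.
  have sN : - s <= 0 by rewrite oppr_le0 ltW.
  by have := Psig_neg _ sN; rewrite PN /sigma mulNr normrN.
exists e', (M / e), P, Q; split => //; first by rewrite e'0.
- split=> // s; apply: (le_trans (Psig s)); rewrite ler_pM2l// mulNr; exact: sigma_le_omega.
split=> s; first by apply: (le_trans (Qsig s)); rewrite mulNr; exact: sigma_le_omega.
move=> ds; have u1 : delta <= `|s / e|.
  by rewrite normrM normfV (gtr0_norm e0) ler_pdivlMr.
have msig : `|m (s / e) - sigma (s / e)| <= delta.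
  rewrite ler_norml /m; have := sigma_ge0 (s / e); move: (sigma (s / e)) => a a0.
  by have [?|?] := leP 0 (a - delta); apply/andP; split; lra.
have m1 : m (s / e) <= 1 by apply: (le_trans (mle _)); apply: (le_trans (sigma_le _)); lra.
have [s0|s0] := leP 0 s.
  have u0 : 0 <= s / e by rewrite divr_ge0// ltW.
  rewrite subr0 -[X in _ - X](_ : sigma (s / e) = _); last by rewrite /sigma ger0_norm// mulNr.
  rewrite /Q /q min_l; last first.
    by apply: (le_trans m1); rewrite ler_pdivlMr// mul1r; rewrite ger0_norm in u1.
  by rewrite max_r//; have := m0 (s / e); lra.
have u0 : s / e < 0 by rewrite pmulr_llt0// invr_gt0.
have -> : (1 + S (- s / e)) / 2 - true%:R = - sigma (s / e).
  by rewrite /sigma ltr0_norm// opprK mulNr condS1_odd /=; lra.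
rewrite -[s / e]opprK; have -> : Q s = - m (s / e).
  have := QN s; rewrite /Q /q => _.
  rewrite min_r; last first.
    by apply: le_trans (m0 _); rewrite ler_pdivrMr// mul0r ltW.
  rewrite max_l// ler_pdivrMr// mulNr lerNr; rewrite ltr0_norm// in u1.
  by apply: (le_trans _ u1); rewrite ler_piMl// ltW.
by rewrite opprK -opprD normrN.
Qed.

End transition_profile.

(** * Weighted norms *)

(* Replaces Hoelder's inequality: optimizing over [t] afterwards gives the same power. *)
Lemma powR_young {R : realType} (a t r : R) : 0 <= a -> 0 < t -> 1 <= r ->
  a <= a `^ r / t `^ (r - 1) + t.
Proof.
move=> a0 t0 r1; have [at_|ta] := leP a t.
  by rewrite (le_trans at_)// lerDr divr_ge0// powR_ge0.
apply: (@le_trans _ _ (a `^ r / t `^ (r - 1))); last by rewrite lerDl ltW.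
rewrite ler_pdivlMr ?powR_gt0// -(mulr_powRB1 a0 (lt_le_trans ltr01 r1)).
by rewrite ler_wpM2l// ge0_ler_powR ?nnegrE ?subr_ge0 ?(ltW t0)// ltW.
Qed.

(** Apply [powR_young] to [f] and [k] with a common parameter t and integrate: this gives i /
    t^(r-1) + 2 t V, where i is the integral on the right. At the optimal t both parts are multiples
    of t V, which explains the factor 3. *)
Lemma weighted_hoelder d (T : measurableType d) (R : realType)
    (mu : {measure set T -> \bar R}) (U : set T) (V r : R) (w f k : T -> R) :
  measurable U -> 0 < V -> (mu U <= V%:E)%E -> 1 <= r ->
  measurable_fun U w -> measurable_fun U f -> measurable_fun U k ->
  (forall x, 0 <= w x <= 1) -> (forall x, 0 <= f x) -> (forall x, 0 <= k x) ->
  (\int[mu]_(x in U) ((f x + k x) * w x)%:E <= (3 * V `^ (1 - r^-1))%:E *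
   (\int[mu]_(x in U) ((f x `^ r + k x `^ r) * w x)%:E) `^ r^-1)%E.
Proof.
move=> mU V0 UV r1 mw mf mk w01 f0 k0.
have r0 : 0 < r by exact: lt_le_trans r1.
have w0 x : 0 <= w x by case/andP: (w01 x).
have w1 x : w x <= 1 by case/andP: (w01 x).
have mfk : measurable_fun U (fun x => (f x `^ r + k x `^ r) * w x).
  apply: measurable_funM => //; apply: measurable_funD.
    exact: (measurableT_comp (@measurable_powR R r) mf).
  exact: (measurableT_comp (@measurable_powR R r) mk).
set I := (\int[mu]_(x in U) ((f x `^ r + k x `^ r) * w x)%:E)%E.
have I0 : (0 <= I)%E.
  by apply: integral_ge0 => x _; rewrite lee_fin mulr_ge0// addr_ge0// powR_ge0.
have c0 : 0 < 3 * V `^ (1 - r^-1) by rewrite mulr_gt0// powR_gt0.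
have [Ioo|Ioo] := eqVneq I +oo%E.
  by rewrite Ioo poweRyr ?invr_eq0 ?gt_eqF// gt0_muley ?lte_fin// leey.
have [i IE] : exists i : R, I = i%:E.
  by exists (fine I); rewrite fineK// ge0_fin_numE// lt_neqAle Ioo leey.
have i0 : 0 <= i by rewrite IE lee_fin in I0.
have key t : 0 < t -> (\int[mu]_(x in U) ((f x + k x) * w x)%:E <=
    (i / t `^ (r - 1) + 2 * t * V)%:E)%E.
  move=> t0; have tr0 : 0 <= (t `^ (r - 1))^-1 by rewrite invr_ge0 powR_ge0.
  apply: (@le_trans _ _ (\int[mu]_(x in U)
      ((t `^ (r - 1))^-1%:E * ((f x `^ r + k x `^ r) * w x)%:E + (2 * t)%:E))%E).
    apply: ge0_le_integral => //.
    - by move=> x _; rewrite lee_fin mulr_ge0// addr_ge0.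
    - by apply/measurable_EFinP; apply: measurable_funM => //; exact: measurable_funD.
    - apply: emeasurable_funD; last exact: measurable_cst.
      by apply: measurable_funeM; exact/measurable_EFinP.
    move=> x _; rewrite -EFinM -EFinD lee_fin.
    have := powR_young (f0 x) t0 r1; have := powR_young (k0 x) t0 r1.
    move: (f x `^ r) (k x `^ r) => fr kr h1 h2.
    apply: (@le_trans _ _ ((kr / t `^ (r - 1) + t + (fr / t `^ (r - 1) + t)) * w x)).
      by rewrite ler_wpM2r// addrC lerD.
    rewrite (_ : (_ + _) * w x = (t `^ (r - 1))^-1 * ((fr + kr) * w x) + 2 * t * w x); last by ring.
    by rewrite lerD2l ler_piMr// mulr_ge0// ltW.
  rewrite ge0_integralD//; last 3 first.
  - by move=> x _; rewrite -EFinM lee_fin mulr_ge0// mulr_ge0// addr_ge0// powR_ge0.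
  - by apply: measurable_funeM; exact/measurable_EFinP.
  - by move=> x _; rewrite lee_fin mulr_ge0// ltW.
  rewrite ge0_integralZl//; last 2 first.
  - exact/measurable_EFinP.
  - by move=> x _; rewrite lee_fin mulr_ge0// addr_ge0// powR_ge0.
  rewrite -/I IE integral_cst// EFinD leeD//; first by rewrite -EFinM lee_fin mulrC.
  by rewrite [leRHS]EFinM lee_wpmul2l// lee_fin mulr_ge0// ltW.
rewrite IE poweR_EFin -EFinM.
(* For i = 0 the balancing value of t would be 0, which is not allowed; instead t is made
   arbitrarily small. *)
have [i00|i00] := eqVneq i 0.
  rewrite i00 powR0 ?invr_eq0 ?gt_eqF// mulr0; apply/lee_addgt0Pr => e e0; rewrite add0e.
  have t0 : 0 < e / (2 * V) by rewrite divr_gt0// mulr_gt0.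
  apply: (le_trans (key _ t0)); rewrite i00 mul0r add0r lee_fin le_eqVlt; apply/orP; left.
  by apply/eqP; field; exact: lt0r_neq0.
have ip : 0 < i by rewrite lt_def i00.
(* With t = (i / V)^(1/r) the first term i / t^(r-1) equals t V. *)
pose t := i `^ r^-1 / V `^ r^-1.
have t0 : 0 < t by rewrite divr_gt0// powR_gt0.
apply: (le_trans (key _ t0)); rewrite lee_fin le_eqVlt; apply/orP; left; apply/eqP.
have tr : t `^ r = i / V.
  rewrite /t powRM ?invr_ge0 ?powR_ge0// -powRrM mulVf ?gt_eqF// powRr1//; congr (_ * _).
  by rewrite -powRN -powRrM mulNr mulVf ?gt_eqF// powR_inv1// ltW.
have h1 : t * V = V `^ (1 - r^-1) * i `^ r^-1.
  rewrite powRB; last by apply/implyP => _; rewrite gt_eqF.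
  by rewrite powRr1 ?(ltW V0)// /t; ring.
have h2 : i / t `^ (r - 1) = t * V.
  have tr1 : t * t `^ (r - 1) = i / V by rewrite mulr_powRB1// ltW.
  apply: (@mulIf _ (t `^ (r - 1))); first by rewrite gt_eqF// powR_gt0.
  rewrite divfK ?gt_eqF ?powR_gt0// mulrAC tr1 divfK//; exact: lt0r_neq0.
by rewrite h2 -mulrA h1; ring.
Qed.

Section weighted_norms.
Context {R : realType} (n : nat).
Local Notation Rn := 'rV[R]_n.
Local Notation mu := (@lebesgue_rV R n).
Implicit Types (U : set Rn) (w h : Rn -> R) (p : \bar R).

(** Needed for essential suprema: that of a nonnegative function is nonnegative only if the measure
    is not zero. *)
Lemma lebesgue_rV_setT_gt0 : (0 < mu [set: Rn])%E.
Proof.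
apply: (@lt_le_trans _ _ (mu [set x : Rn | forall i, `[0, 1]%classic (x 0 i)])).
  rewrite (lebesgue_rV_box (A := fun=> `[0, 1]%classic)); last by move=> i; exact: measurable_itv.
  rewrite big1 ?lte01// => i _; rewrite lebesgue_measure_itv /= lte_fin ltr01.
  by rewrite oppr0 adde0.
apply: le_measure; rewrite ?inE//.
by apply: (@measurable_rV_box R n (fun=> `[0, 1]%classic)) => i; exact: measurable_itv.
Qed.

Lemma Lpwy_ge0 U w h : (0 <= Lpw_norm +oo%E U w h)%E.
Proof.
apply: ess_sup_gee; first exact: lebesgue_rV_setT_gt0.
by apply: aeW => x; apply: erestrict_ge0 => y _; rewrite lee_fin.
Qed.

Lemma Lpwy_ae U w h : \forall x \ae mu, U x -> (`|h x|%:E <= Lpw_norm +oo%E U w h)%E.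
Proof.
have := ess_sup_ge mu ((fun x => `|h x|%:E) \_ U).
by apply: filterS => x + Ux; rewrite patchE mem_set.
Qed.

(** On a set of finite measure with weight at most 1, Young's inequality at t = 1 gives |h| w <=
    |h|^r w + 1; for infinite exponent h is essentially bounded. *)
Lemma Lpw_integrable p U w h : (1 <= p)%E -> measurable U -> (mu U < +oo)%E ->
  measurable_fun U w -> (forall x, 0 <= w x <= 1) -> Lpw p U w h ->
  mu.-integrable U (fun x => (h x * w x)%:E).
Proof.
move=> p1 mU Uoo mw w01 [mh hp].
have w0 x : 0 <= w x by case/andP: (w01 x).
have w1 x : w x <= 1 by case/andP: (w01 x).
have mhw : measurable_fun U (fun x => (h x * w x)%:E).
  by apply/measurable_EFinP; exact: measurable_funM.
apply/integrableP; split=> //.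
have mahw : measurable_fun U (fun x => `|(h x * w x)%:E|%E) by exact: measurableT_comp.
case: p p1 hp => [r||] p1 hp; last by rewrite leeNy_eq in p1.
- rewrite lee_fin in p1; have r0 : 0 < r by exact: lt_le_trans p1.
  have Ir : (\int[mu]_(x in U) (`|h x| `^ r * w x)%:E < +oo)%E.
    by apply: lty_poweRy hp; rewrite invr_eq0 gt_eqF.
  have mp : measurable_fun U (fun x => (`|h x| `^ r * w x)%:E).
    apply/measurable_EFinP; apply: measurable_funM => //.
    by apply: (measurableT_comp (@measurable_powR R r)); exact: measurableT_comp.
  apply: (@le_lt_trans _ _ (\int[mu]_(x in U) ((`|h x| `^ r * w x)%:E + 1))%E).
    apply: ge0_le_integral => //; first by apply: emeasurable_funD => //; exact: measurable_cst.
    move=> x _; rewrite -EFinD lee_fin normrM (ger0_norm (w0 x)).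
    have := powR_young (normr_ge0 (h x)) ltr01 p1; rewrite powR1 invr1 mulr1 => hy.
    apply: (@le_trans _ _ ((`|h x| `^ r + 1) * w x)); first exact: ler_wpM2r.
    by rewrite mulrDl mul1r lerD2l.
  rewrite ge0_integralD//; last first.
    by move=> x _; rewrite lee_fin mulr_ge0// powR_ge0.
  by rewrite lte_add_pinfty// integral_cst// mul1e.
have N0 := Lpwy_ge0 U w h.
apply: (@le_lt_trans _ _ (\int[mu]_(x in U) (Lpw_norm +oo%E U w h))%E).
  apply: ae_ge0_le_integral => //.
  have := Lpwy_ae U w h; apply: filterS => x hx Ux; apply: le_trans (hx Ux).
  by rewrite lee_fin normrM (ger0_norm (w0 x)) ler_piMr.
by rewrite integral_cst// lte_mul_pinfty// ge0_fin_numE.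
Qed.

Lemma W1pw_bound p U w h (V : R) : (1 <= p)%E -> measurable U -> 0 < V ->
  (mu U <= V%:E)%E -> measurable_fun U w -> (forall x, 0 <= w x <= 1) ->
  measurable_fun U h -> (forall i, measurable_fun U (fun x => wgrad U h x 0 i)) ->
  (\int[mu]_(x in U) ((`|h x| + enorm (wgrad U h x)) * w x)%:E <=
   (3 * V `^ (1 - fine p^-1%E))%:E * W1pw_norm p U w h)%E.
Proof.
move=> p1 mU V0 UV mw w01 mh mg.
have mah : measurable_fun U (fun x => `|h x|) by exact: measurableT_comp.
have mG : measurable_fun U (fun x => enorm (wgrad U h x)) by exact: measurable_enorm.
have w0 x : 0 <= w x by case/andP: (w01 x).
have w1 x : w x <= 1 by case/andP: (w01 x).
case: p p1 => [r||] p1; last by rewrite leeNy_eq in p1.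
  by rewrite fine_invr /=; apply: weighted_hoelder => // x; exact: enorm_ge0.
(* The convention 1/oo = 0 turns the power of [V] into [V] itself, the bound for the integral of a
   bounded function. *)
rewrite invey [fine _]/= subr0 powRr1 ?(ltW V0)//.
set N := W1pw_norm +oo%E U w h.
have N1 : (Lpw_norm +oo%E U w h <= N)%E by rewrite le_max lexx.
have N2 : (Lpw_norm +oo%E U w (fun x => enorm (wgrad U h x)) <= N)%E by rewrite le_max lexx orbT.
have N0 : (0 <= N)%E by exact: le_trans (Lpwy_ge0 _ _ _) N1.
have [->|Noo] := eqVneq N +oo%E.
  by rewrite gt0_muley ?lte_fin ?mulr_gt0// leey.
have [c NE] : exists c : R, N = c%:E.
  by exists (fine N); rewrite fineK// ge0_fin_numE// lt_neqAle Noo leey.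
rewrite NE lee_fin in N0.
apply: (@le_trans _ _ (\int[mu]_(x in U) (2 * c)%:E)%E).
  apply: ae_ge0_le_integral => //.
  - by move=> x _; rewrite lee_fin mulr_ge0// addr_ge0// enorm_ge0.
  - by apply/measurable_EFinP; apply: measurable_funM => //; exact: measurable_funD.
  - by move=> x _; rewrite lee_fin mulr_ge0.
  have h1 := Lpwy_ae U w h; have h2 := Lpwy_ae U w (fun x => enorm (wgrad U h x)).
  apply: (filterS2 _ _ h1 h2) => x k1 k2 Ux.
  have := le_trans (k1 Ux) N1; have := le_trans (k2 Ux) N2.
  rewrite NE !lee_fin (ger0_norm (enorm_ge0 _)) => g1 g2.
  rewrite (@le_trans _ _ (`|h x| + enorm (wgrad U h x)))//; last by lra.
  by rewrite ler_piMr// addr_ge0// enorm_ge0.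
rewrite integral_cst// NE.
apply: (@le_trans _ _ ((2 * c)%:E * V%:E)%E); first by rewrite lee_wpmul2l// lee_fin mulr_ge0.
by rewrite -!EFinM lee_fin; nra.
Qed.

End weighted_norms.

(** * The phase-field defect *)

(** A test function on the smaller set is one on the larger set, and all tested integrands vanish
    off the smaller set. This links membership on the sublevel set with the norm on the tube, whose
    [wgrad] is chosen for the tube. *)
Lemma weak_grad_restrict {R : realType} (n : nat) (U V : set 'rV[R]_n)
    (h : 'rV[R]_n -> R) (G : 'rV[R]_n -> 'rV[R]_n) :
  measurable V -> U `<=` V -> is_weak_grad V h G -> is_weak_grad U h G.
Proof.
move=> mV UV [[mh hi] Gi wV]; split.
- by split; [exact: measurable_funS mh|move=> K cK KU; apply: hi => //; exact: subset_trans UV].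
- move=> i; have [mG gi] := Gi i.
  by split; [exact: measurable_funS mG|move=> K cK KU; apply: gi => //; exact: subset_trans UV].
move=> phi i [sphi cphi suppphi].
have phi0 x : ~ U x -> phi x = 0.
  move=> Ux; apply: contrapT => /eqP px; apply: Ux; apply: suppphi.
  exact: subset_closure.
have dphi0 x : ~ U x -> partial i phi x = 0.
  move=> Ux; rewrite /partial (@near_eq_derive _ _ _ phi (fun=> 0)) ?derive_cst//.
  have : nbhs x (~` closure [set x | phi x != 0]).
    apply: open_nbhs_nbhs; split; first by apply: closed_openC; exact: closed_closure.
    by move=> /suppphi.
  apply: filterS => y Cy; apply: contrapT => /eqP py; apply: Cy.
  exact: subset_closure.
have := wV phi i; rewrite (@integral_supported _ _ _ _ U V) => //; last first.
  by move=> x _ Ux; rewrite dphi0// mulr0.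
rewrite [X in (_ -> _ = - X)%E -> _](@integral_supported _ _ _ _ U V) => //; last first.
  by move=> x _ Ux; rewrite phi0// mulr0.
by apply; split=> //; exact: subset_trans UV.
Qed.

Section phase_field_estimate.
Context {R : realType} (n : nat).
Local Notation Rn := 'rV[R]_n.
Local Notation mu := (@lebesgue_rV R n).
Variables (D : set Rn) (S : R -> R).
Hypothesis hS : condS1 S.

Lemma omega_itv (e : R) (x : Rn) : 0 <= omega S D e x <= 1.
Proof. by rewrite /omega; have /andP[? ?] := condS1_bound hS (- sdist D x / e); apply/andP; split; lra. Qed.

Lemma continuous_omega (e : R) : continuous (omega S D e).
Proof.
have cf : continuous (fun s : R => (1 + S (- s / e)) / 2).
  have [M M0 HM] := condS1_lip hS; apply: lip_continuous; exists (M * `|e^-1|).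
    by rewrite mulr_ge0.
  move=> s t; rewrite -mulrBl opprD addrACA subrr add0r normrM (@ger0_norm _ 2^-1)//.
  apply: (@le_trans _ _ `|S (- s / e) - S (- t / e)|).
    by rewrite ler_piMr// invf_le1// ler1n.
  apply: (le_trans (HM _ _)); rewrite -mulrBl normrM -opprD normrN.
  by rewrite -mulrA [`|e^-1| * _]mulrC.
by move=> x; exact: (continuous_comp (@continuous_sdist R n D x) (cf (sdist D x))).
Qed.

Variable (eps0 : R).
Hypotheses (n0 : (0 < n)%N) (oD : open D) (D0 : D !=set0) (bD : bounded_set D).
Hypotheses (eps00 : 0 < eps0) (C11d : C11 (tube D (2 * eps0)) (sdist D)).
Local Notation d := (sdist D).

(** The estimate holds for the truncated profiles with delta = 1/(k+1), with a right-hand side that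
    does not depend on k. These profiles converge to the defect off the null set {d = 0} and are
    dominated by omega. *)
Lemma tube_defect_bound : exists2 C : R, 0 < C &
  forall (e : R) (h : Rn -> R) (G : Rn -> Rn), 0 < e <= eps0 ->
    is_weak_grad (tube D e) h G ->
    mu.-integrable (tube D e) (fun x => (h x * omega S D e x)%:E) ->
  (`| \int[mu]_(x in tube D e) (h x * (omega S D e x - (d x < 0)%R%:R))%:E | <=
   (C * e)%:E * \int[mu]_(x in tube D e)
     ((`|h x| + enorm (G x)) * omega S D e x)%:E)%E.
Proof.
have [C C0 HC] := weak_ibp_estimate n0 oD D0 bD eps00 C11d.
exists C => // e h G /andP[e0 ee] wG hi; set U := tube D e.
have mU : measurable U by exact: measurable_tube.
have [[mh _] Gi _] := wG.
have mG i : measurable_fun U (fun x => G x 0 i) by have [] := Gi i.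
have meG : measurable_fun U (fun x => enorm (G x)) by exact: measurable_enorm.
have mom : measurable_fun U (omega S D e) by exact: continuous_measurable_rV (@continuous_omega e).
have om0 x : 0 <= omega S D e x by case/andP: (omega_itv e x).
have om1 x : omega S D e x <= 1 by case/andP: (omega_itv e x).
pose w x := (`|h x| + enorm (G x)) * omega S D e x.
have w0 x : 0 <= w x by rewrite mulr_ge0// addr_ge0// enorm_ge0.
have mw : measurable_fun U w.
  by apply: measurable_funM => //; apply: measurable_funD => //; exact: measurableT_comp.
have /(_ _)/cid-/all_sig[Q HQ] : forall k : nat, exists Q : R -> R,
    [/\ continuous Q, forall s, `|Q s| <= (1 + S (- s / e)) / 2,
      forall s, k.+1%:R^-1 * e <= `|s| ->
        `|Q s - ((1 + S (- s / e)) / 2 - (s < 0)%R%:R)| <= k.+1%:R^-1 &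
      (`| \int[mu]_(x in U) (h x * Q (d x))%:E | <=
        (C * e)%:E * \int[mu]_(x in U) (w x)%:E)%E].
  move=> k; have k0 : 0 < k.+1%:R^-1 :> R by rewrite invr_gt0.
  have [e' [M [P [Q [e'e [PQ QM] Q0 [suppP Pom] [Qom Qclose]]]]]] :=
    transition_profile_exists hS e0 k0.
  have cP : continuous P by move=> s; exact: is_derive_continuous (PQ s).
  have cQ : continuous Q.
    apply: lip_continuous; exists M => //.
    by apply: (le_trans (normr_ge0 (Q 1 - Q 0))); have := QM 1 0; rewrite subr0 normr1 mulr1.
  exists Q; split=> //; apply: (le_trans (HC e e' P Q M h G e'e ee PQ QM Q0 suppP wG)).
  rewrite EFinM -muleA lee_wpmul2l ?lee_fin ?(ltW C0)//.
  have mP : measurable_fun U (fun x => P (d x)).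
    apply: continuous_measurable_rV => // x.
    by apply: continuous_comp; [exact: continuous_sdist|exact: cP].
  rewrite -ge0_integralZl//; last 3 first.
  - exact/measurable_EFinP.
  - by move=> x _; rewrite lee_fin.
  - by rewrite lee_fin ltW.
  apply: ge0_le_integral => //.
  - by move=> x _; rewrite lee_fin mulr_ge0// addr_ge0// enorm_ge0.
  - apply/measurable_EFinP; apply: measurable_funM; first exact: measurableT_comp.
    by apply: measurable_funD => //; exact: measurableT_comp.
  - by apply: measurable_funeM; exact/measurable_EFinP.
  move=> x _; rewrite -EFinM lee_fin /w mulrCA [leLHS]mulrC ler_wpM2l//.
  by rewrite addr_ge0// enorm_ge0.
have mQ k : measurable_fun U (fun x => (h x * Q k (d x))%:E).
  apply/measurable_EFinP; apply: measurable_funM => //.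
  apply: continuous_measurable_rV => // x; have [cQ _ _ _] := HQ k.
  by apply: continuous_comp; [exact: continuous_sdist|exact: cQ].
have mphi : measurable_fun U (fun x => (h x * (omega S D e x - (d x < 0)%R%:R))%:E).
  apply/measurable_EFinP; apply: measurable_funM => //; apply: measurable_funB => //.
  have mD : measurable D by exact: open_measurable_rV.
  rewrite (_ : (fun x => _) = \1_D); first exact: measurable_indic.
  apply/funext => x; rewrite indicE; congr (_%:R); congr nat_of_bool.
  by apply/idP/idP => [/(sdist_lt0 n0 oD bD)/mem_set|/set_mem/(sdist_lt0 n0 oD bD)].
have cvgae : {ae mu, forall x, U x -> (h x * Q k (d x))%:E @[k --> \oo] -->
    (h x * (omega S D e x - (d x < 0)%R%:R))%:E}.
  exists [set x | d x = 0]; split.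
  + apply: closed_measurable_rV; rewrite (_ : [set x | _] = d @^-1` [set 0]); last by apply/seteqP; split.
    by apply: closed_comp; [move=> x _; exact: continuous_sdist|exact: closed_eq].
  + exact: (sdist_eq0_null n0 oD D0 bD eps00 C11d).
  move=> x /= H; apply: contrapT => dx0; apply: H => Ux.
  apply: cvg_EFin; first exact: nearW.
  have dxp : 0 < `|d x| by rewrite normr_gt0; apply/eqP.
  apply/cvgrPdist_le => eta eta0 /=.
  (* Once 1/(k+1) is below the first bound, [x] lies where [Q k] is close to the defect; below the
     second, the error multiplied by |h x| is at most eta. *)
  pose r := Num.min (`|d x| / e) (eta / (`|h x| + 1)).
  have r0 : 0 < r by rewrite lt_min !divr_gt0// ltr_wpDl.
  have := near_infty_natSinv_lt (PosNum r0); apply: filterS => k /= kr.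
  have [_ _ Qc _] := HQ k.
  have k1 : k.+1%:R^-1 * e <= `|d x|.
    rewrite -ler_pdivlMr//; apply: (le_trans (ltW kr)); by rewrite ge_min lexx.
  rewrite -mulrBr normrM distrC.
  apply: (@le_trans _ _ ((`|h x| + 1) * k.+1%:R^-1)).
    by rewrite ler_pM ?lerDl//; exact: Qc.
  rewrite mulrC -ler_pdivlMr ?ltr_wpDl//; apply: (le_trans (ltW kr)).
  by rewrite ge_min lexx orbT.
have dom : {ae mu, forall x, forall k, U x ->
    (`|(h x * Q k (d x))%:E| <= `|(h x * omega S D e x)%:E|)%E}.
  apply: aeW => x k _; rewrite !abse_EFin lee_fin !(normrM (h x)) ler_wpM2l// (ger0_norm (om0 x)).
  by have [_ Qo _ _] := HQ k; exact: Qo.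
have [_ _ cvgQ] := dominated_convergence mU mQ mphi cvgae (integrable_abse hi) dom.
apply: (cvge_to_le (cvg_abse cvgQ)).
by apply: nearW => k; have [] := HQ k.
Qed.

End phase_field_estimate.

Unset Implicit Arguments.

Theorem theorem5p2 (R : realType) (n : nat) (D Omega : set 'rV[R]_n)
    (S : R -> R) (eps0 : R) (p : \bar R) :
  (0 < n)%N ->
  domain D -> bounded_set D -> C11_boundary D ->
  domain Omega -> closure D `<=` Omega ->
  admissible_width D Omega eps0 ->
  condS1 S -> condS2 S ->
  (1 <= p)%E ->
  exists2 C : R, 0 < C &
  forall (eps : R) (h : 'rV[R]_n -> R), 0 < eps <= eps0 ->
    W1pw p (sublevel D eps) (omega S D eps) h ->
    (`| \int[lebesgue_rV n]_(x in Omega) (h x * omega S D eps x)%:E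
        - \int[lebesgue_rV n]_(x in D) (h x)%:E |
     <= (C * eps `^ (2 - fine (p^-1)%E))%:E
        * W1pw_norm p (tube D eps) (omega S D eps) h)%E.
Proof.
move=> n0 [oD _ D0] bD _ _ clD [eps00 C11d _ tubeO] hS _ p1.
have [CV CV0 HV] := tube_volume n0 oD D0 bD eps00 C11d.
have [CB CB0 HB] := tube_defect_bound hS n0 oD D0 bD eps00 C11d.
pose a := 1 - fine p^-1%E.
exists (CB * (3 * CV `^ a)); first by rewrite !mulr_gt0// powR_gt0.
move=> eps h /andP[e0 ee] [Lh [g wg _]].
pose V := sublevel D eps; pose U := tube D eps; pose om := omega S D eps.
have UV : U `<=` V by move=> x [].
have mV : measurable V by apply: open_measurable_rV; exact: open_sdist_lt.
have mU : measurable U by exact: measurable_tube.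
have mD : measurable D by exact: open_measurable_rV.
have mh : measurable_fun V h by have [] := Lh.
have mom (A : set 'rV[R]_n) : measurable A -> measurable_fun A om.
  by move=> mA; apply: continuous_measurable_rV => //; exact: continuous_omega.
have om01 x : 0 <= om x <= 1 by exact: omega_itv.
have DV : D `<=` V.
  by move=> x /(sdist_lt0 n0 oD bD) dx; rewrite /V /sublevel /=; exact: lt_trans e0.
have Voo : (lebesgue_rV n V < +oo)%E.
  have [M M0 HM] := sublevel_bound D0 bD eps.
  by apply: le_lt_trans (lebesgue_rV_bounded (ltW M0) HM mV) _; rewrite ltry.
have hoV : (lebesgue_rV n).-integrable V (fun x => (h x * om x)%:E).
  exact: Lpw_integrable p1 mV Voo (mom V mV) om01 Lh.
have hoU : (lebesgue_rV n).-integrable U (fun x => (h x * om x)%:E).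
  exact: integrableS mV mU UV hoV.
have VO : V `<=` Omega.
  move=> x xV; have [Dx|Dx] := pselect (D x).
    by apply: clD; exact: subset_closure.
  apply: tubeO; apply: tube_of_lt; move: xV; rewrite /V /sublevel /= sdistP// => xe.
  by rewrite ger0_norm ?dist_ge0//; lra.
(* On D the weight is at least 1/2, so weighted integrability of h gives integrability of h over
   D. *)
have omD x : D x -> 1 <= 2 * om x.
  move=> /(sdist_lt0 n0 oD bD) dx; rewrite /om /omega.
  have : S 0 <= S (- sdist D x / eps).
    by apply: (condS1_nondecreasing hS); rewrite divr_ge0 ?oppr_ge0// ltW.
  by rewrite (condS1_0 hS); lra.
pose hD (x : 'rV[R]_n) := h x * (sdist D x < 0)%R%:R.
have mind : measurable_fun V (fun x => (sdist D x < 0)%R%:R : R).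
  rewrite (_ : (fun x => _) = \1_D); first exact: measurable_indic.
  apply/funext => x; rewrite indicE; congr (_%:R); congr nat_of_bool.
  by apply/idP/idP => [/(sdist_lt0 n0 oD bD)/mem_set|/set_mem/(sdist_lt0 n0 oD bD)].
have hDV : (lebesgue_rV n).-integrable V (fun x => (hD x)%:E).
  apply: (le_integrable mV _ _ (integrableZl mV 2 hoV)).
    by apply/measurable_EFinP; exact: measurable_funM.
  move=> x Vx; rewrite /hD -EFinM !abse_EFin lee_fin.
  rewrite [2 * _]mulrCA !(normrM (h x)) ler_wpM2l//.
  have /andP[w0 _] := om01 x.
  case: (boolP (sdist D x < 0)) => [/(sdist_lt0 n0 oD bD)/omD w1|_] /=; last by rewrite normr0.
  by rewrite normr1 ger0_norm// mulr_ge0.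
have -> : (\int[lebesgue_rV n]_(x in Omega) (h x * omega S D eps x)%:E =
    \int[lebesgue_rV n]_(x in V) (h x * om x)%:E)%E.
  apply: integral_supported => // x Ox Vx.
  rewrite /omega (condS1_leN1 hS) ?subrr ?mul0r ?mulr0//.
  rewrite mulNr lerN2 ler_pdivlMr// mul1r leNgt; exact/negP.
have -> : (\int[lebesgue_rV n]_(x in D) (h x)%:E = \int[lebesgue_rV n]_(x in V) (hD x)%:E)%E.
  rewrite [RHS](@integral_supported _ _ _ _ D V) //; last first.
    move=> x Vx Dx; rewrite /hD; case: (boolP (sdist D x < 0)) => [/(sdist_lt0 n0 oD bD)//|_].
    by rewrite mulr0.
  apply: eq_integral => x /set_mem/(sdist_lt0 n0 oD bD) dx.
  by rewrite /hD dx mulr1.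
rewrite -(integralB mV hoV hDV).
under eq_integral do rewrite -EFinB -mulrBr.
(* Inside the sublevel set but outside the tube d <= -eps, where omega and the indicator of D are
   both 1 and the defect vanishes. *)
rewrite (@integral_supported _ _ _ _ U V) //; last first.
  move=> x Vx Ux; have dx : sdist D x <= - eps.
    have [//|dx] := leP (sdist D x) (- eps); exfalso; apply: Ux; split=> //.
    by move=> /closure_sublevel; rewrite leNgt dx.
  rewrite /om /omega (condS1_ge1 hS); last by rewrite ler_pdivlMr// mul1r lerNr.
  by rewrite (le_lt_trans dx) ?oppr_lt0//= (_ : (1 + 1) / 2 - 1 = 0) ?mulr0//; lra.
(* A weak gradient exists on the larger set and restricts to the tube, so the chosen representative
   is a genuine weak gradient. *)
have wG : is_weak_grad U h (wgrad U h).
  by apply: getPex; exists g; exact: weak_grad_restrict mV UV wg.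
have [[mhU _] Gi _] := wG.
have mG i : measurable_fun U (fun x => wgrad U h x 0 i) by have [] := Gi i.
have ebound : 0 < eps <= eps0 by rewrite e0.
apply: (le_trans (HB eps h (wgrad U h) ebound wG hoU)).
have CVe0 : 0 < CV * eps by rewrite mulr_gt0.
apply: (@le_trans _ _ ((CB * eps)%:E *
    ((3 * (CV * eps) `^ a)%:E * W1pw_norm p U om h))%E).
  rewrite lee_wpmul2l ?lee_fin ?mulr_ge0 ?(ltW CB0) ?(ltW e0)//.
  exact: W1pw_bound p1 mU CVe0 (HV eps ebound) (mom U mU) om01 mhU mG.
rewrite muleA -EFinM (_ : CB * eps * _ = CB * (3 * CV `^ a) * eps `^ (2 - fine p^-1%E))//.
(* One factor eps comes from the primitive of the profile, and the power 1 - 1/p from the volume of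
   the tube. *)
have -> : eps `^ (2 - fine p^-1%E) = eps * eps `^ a.
  rewrite -[X in X * _](powRr1 (ltW e0)) -powRD; last by apply/implyP => _; rewrite gt_eqF.
  by congr (_ `^ _); rewrite /a; ring.
rewrite powRM ?(ltW CV0) ?(ltW e0)//; ring.
Qed.
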